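(* Let $dX_t=\mu_t\,dt+\sigma_t\,dB_t$ on $[0,T]$, where $(\mu,\sigma)$ satisfies the non-leverage condition, the moment bound, and the scaling condition with data $(\gamma,L,C_\gamma)$, let $K$ be an admissible kernel for $(\gamma,C_\gamma)$, and let $\tau\in(0,T)$. Suppose that one of the following holds. (1) $\{\sigma_t^2\}$ is an Itô process $\sigma_t^2=\sigma_0^2+\int_0^tf_sds+\int_0^tg_sdW_s$ with $\sup_{t\in[0,T]}\mathbb E[|f_t|]<\infty$, $\sup_{t\in[0,T]}\mathbb E[g_t^2]<\infty$, and $\mathbb E[(g_{\tau+h}-g_\tau)^2]\to0$ as $h\to0$ (in this case $\gamma=1$ and $C_1(x,y)=\min\{|x|,|y|\}1_{\{xy\ge0\}}$). (2) $\sigma_t^2=f(Z_t)$ for a deterministic $f\in C^2(\mathbb R)$ and a Gaussian process $\{Z_t\}_{t\ge0}$ such that: $Z$ satisfies the scaling condition uniformly over $(0,T)$ with exponent $\gamma\in[1,2)$ and functions $L^{(Z)}$, $C_\gamma^{(Z)}$; $\mathbb E[(Z_{\tau+r}-Z_\tau)Z_\tau]=O(|r|)$ and $\mathbb E[Z_{\tau+r}]-\mathbb E[Z_\tau]=O(|r|)$ as $r\to0$; $\mathbb E[(f'(Z_\tau))^4]<\infty$ and $\mathbb E[\sup_{t\in(\tau-\epsilon,\tau+\epsilon)}(f''(Z_t))^4]<\infty$ for some $\epsilon>0$. Then, on an extension of the probability space equipped with a standard normal variable $\xi$ independent of $g_\tau$ in case (1), respectively of $\{Z_t\}_{t\ge0}$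 in case (2), we have, as $h\to0$, $$h^{-\gamma/2}\int_0^TK_h(t-\tau)(\sigma_t^2-\sigma_\tau^2)\,dt\longrightarrow_D\delta_2\,\xi,$$ where $\delta_2^2=g_\tau^2\iint K(x)K(y)C_1(x,y)dxdy$ in case (1), and $\delta_2^2=[f'(Z_\tau)]^2L^{(Z)}(\tau)\iint K(x)K(y)C_\gamma^{(Z)}(x,y)dxdy$ in case (2).
   Context: Setting. On a complete filtered probability space $(\Omega,\mathscr F,\mathbb F=\{\mathscr F_t\}_{t\ge0},\mathbb P)$, $\mu,\sigma$ are $\mathbb F$-adapted processes and $B$ is a standard Brownian motion adapted to $\mathbb F$; in case (1), $W$ is a standard Wiener process adapted to $\mathbb F$ and $f,g$ are progressively measurable. $K_h(x)=K(x/h)/h$. $\to_D$ denotes convergence in distribution. Non-leverage condition: $(\mu,\sigma)$ is independent of $B$. Moment bound: there is $M_T>1$ with $\mathbb E[\mu_t^4+\sigma_t^4]<M_T$ for all $t\in[0,T]$. Scaling condition with data $(\gamma,L,C_\gamma)$ for a process $V$ (applied to $V_t=\sigma_t^2$ when no process is named): $\gamma>0$, $L$ is a nonnegative function of $t$, $C_\gamma:\mathbb R\times\mathbb R\to\mathbb R$ is not identically zero and satisfies $C_\gamma(hr,hs)=h^\gamma C_\gamma(r,s)$ for all $r,s\in\mathbb R$, $h>0$; and for each $t\in(0,T)$, $\mathbb E[(V_{t+r}-V_t)(V_{t+s}-V_t)]=L(t)C_\gamma(r,s)+o((r^2+s^2)^{\gamma/2})$ as $r,s\to0$. It holds uniformly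 over $(0,T)$ if $\sup_{t\in(0,T)}(r^2+s^2)^{-\gamma/2}\big|\mathbb E[(V_{t+r}-V_t)(V_{t+s}-V_t)]-L(t)C_\gamma(r,s)\big|\to0$ as $r,s\to0$ and $\sup_{t\in(0,T)}|L(t)|<\infty$. Admissible kernel for $(\gamma,C_\gamma)$: $K:\mathbb R\to\mathbb R$ such that (1) $\int K(x)dx=1$; (2) $K$ is Lipschitz and piecewise $C^1$ on its support $(A,B)$, where $-\infty\le A<0<B\le\infty$; (3) $\int|K(x)||x|^\gamma dx<\infty$, $K(x)x^{\gamma+1}\to0$ as $|x|\to\infty$, $\int|K'(x)|dx<\infty$, and the total variation of $|K'|$ over $(-\infty,\infty)$ is finite; (4) $\iint K(x)K(y)C_\gamma(x,y)dxdy>0$. *)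

(* Defs.v *)
From HB Require Import structures.
From mathcomp Require Import all_boot all_order all_algebra.
From mathcomp Require Import all_classical all_reals all_analysis.

Set Implicit Arguments.
Unset Strict Implicit.
Unset Printing Implicit Defensive.

Import Order.TTheory GRing.Theory Num.Theory.
Import numFieldNormedType.Exports.

Local Open Scope classical_set_scope.
Local Open Scope ring_scope.

(* A stochastic process is a map X : R -> Omega -> R, of which only the values
   X t with 0 <= t matter; likewise a filtration is a family of set systems
   indexed by R, of which only the members with 0 <= t matter. *)

Section processes.
Context (R : realType) (d : measure_display) (Omega : measurableType d).
Context (P : probability Omega R).
Implicit Types (X W : R -> Omega -> R) (F : R -> set_system Omega).

Definition complete_filtration F : Prop :=
  [/\ measure_is_complete P,
      forall t, 0 <= t -> sigma_algebra [set: Omega] (F t),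
      forall t, 0 <= t -> F t `<=` measurable,
      forall s t, 0 <= s -> s <= t -> F s `<=` F t &
      P.-negligible `<=` F 0].

Definition independent (G H : set_system Omega) : Prop :=
  forall A B, G A -> H B -> P (A `&` B) = (P A * P B)%E.

Definition has_law (Y : Omega -> R) (nu : set R -> \bar R) : Prop :=
  measurable_fun [set: Omega] Y /\
  forall A : set R, measurable A -> P (Y @^-1` A) = nu A.

(* The library's [normal_prob m s] is the uniform law on `[0, 1] when s = 0,
   so degenerate normal laws are given separately, as Dirac masses. *)
Definition gaussian_variable (Y : Omega -> R) : Prop :=
  (exists m, has_law Y \d_ m) \/
  (exists m s, 0 < s /\ has_law Y (normal_prob m s)).

Definition gaussian_process (Z : R -> Omega -> R) : Prop :=
  forall (n : nat) (t a : 'I_n -> R), (forall i, 0 <= t i) ->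
  gaussian_variable (fun w => \sum_(i < n) a i * Z (t i) w).

Definition sigma_var (Y : Omega -> R) : set_system Omega :=
  preimage_set_system [set: Omega] Y measurable.

Definition cylinders X : set_system Omega :=
  \bigcup_(t in `[0, +oo[) sigma_var (X t).

Definition sigma_process X : set_system Omega := <<s cylinders X >>.

Definition sigma_process2 X W : set_system Omega :=
  <<s cylinders X `|` cylinders W >>.

Definition adapted F X : Prop := forall t, 0 <= t -> sigma_var (X t) `<=` F t.

Definition jointly_measurable (T : R) X : Prop :=
  measurable_fun (`[0, T] `*` [set: Omega]) (fun z : R * Omega => X z.1 z.2).

(* On `[0, t] `*` Omega, the process is measurable for the product of the
   Borel sets of `[0, t] with F t. *)
Definition progressively_measurable F X : Prop :=
  forall t, 0 <= t -> forall Y : set R, measurable Y ->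
  <<s `[0, t] `*` [set: Omega],
      [set D | exists (I : set R) A,
         [/\ measurable I, I `<=` `[0, t]%classic, F t A & D = I `*` A]] >>
    [set z : R * Omega | `[0, t]%classic z.1 /\ Y (X z.1 z.2)].

(* Brownian motion relative to F: the increments after s are independent of
   F s. The second parameter of [normal_prob] is the standard deviation. *)
Definition brownian_motion F W : Prop :=
  [/\ adapted F W,
      {ae P, forall w, W 0 w = 0},
      {ae P, forall w, {within `[0, +oo[, continuous (W ^~ w)}} &
      forall s t, 0 <= s -> s < t ->
        has_law (fun w => W t w - W s w) (normal_prob 0 (Num.sqrt (t - s))) /\
        independent (F s) (sigma_var (fun w => W t w - W s w))].

(* The simple process equal to [sp_value i] on the interval
   `]sp_time i, sp_time i.+1] for i < sp_size, and to 0 elsewhere. *)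
Record simple_process : Type := SimpleProcess {
  sp_size : nat;
  sp_time : nat -> R;
  sp_value : nat -> Omega -> R }.

Definition simple_adapted F (H : simple_process) : Prop :=
  [/\ 0 <= sp_time H 0%N,
      forall i, sp_time H i <= sp_time H i.+1,
      forall i, sigma_var (sp_value H i) `<=` F (sp_time H i) &
      exists M, forall i w, `|sp_value H i w| <= M].

Definition simple_eval (H : simple_process) (s : R) (w : Omega) : R :=
  \sum_(i < sp_size H)
    sp_value H i w * \1_(`]sp_time H i, sp_time H i.+1]%classic) s.

Definition simple_integral (H : simple_process) W (t : R) (w : Omega) : R :=
  \sum_(i < sp_size H) sp_value H i w *
    (W (Num.min (sp_time H i.+1) t) w - W (Num.min (sp_time H i) t) w).

(* J is (a continuous version of) the L^2 Ito integral \int_0^. g_s dW_s on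
   [0, T]: the limit in L^2 of the integrals of simple adapted processes that
   approximate g in L^2(ds x P). *)
Definition ito_integral F W (T : R) (g J : R -> Omega -> R) : Prop :=
  [/\ adapted F J,
      {ae P, forall w, {within `[0, T], continuous (J ^~ w)}} &
      exists H : nat -> simple_process,
        [/\ forall n, simple_adapted F (H n),
            (\int[P]_w \int[lebesgue_measure]_(s in `[0%R, T])
                ((g s w - simple_eval (H n) s w) ^+ 2)%R%:E)%E @[n --> \oo]
              --> 0%E &
            forall t, 0 <= t <= T ->
              'E_P[fun w => ((J t w - simple_integral (H n) W t w) ^+ 2)%R]%E
                @[n --> \oo] --> 0%E]].

(* X_t = X_0 + \int_0^t f_s ds + \int_0^t g_s dW_s for t in [0, T]. *)
Definition ito_process F W (T : R) (X f g : R -> Omega -> R) : Prop :=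
  adapted F X /\
  exists J, ito_integral F W T g J /\
    {ae P, forall w,
      (@lebesgue_measure R).-integrable `[0, T] (EFin \o f ^~ w) /\
      forall t, 0 <= t <= T ->
        X t w = X 0 w + \int[lebesgue_measure]_(s in `[0, t]) f s w + J t w}.

Definition moment_bound (T : R) (mu sigma : R -> Omega -> R) : Prop :=
  exists M : R, 1 < M /\ forall t, 0 <= t <= T ->
    ('E_P[fun w => (mu t w ^+ 4 + sigma t w ^+ 4)%R] < M%:E)%E.

Definition scaling_data (T gamma : R) (L : R -> R) (C : R -> R -> R) : Prop :=
  [/\ 0 < gamma,
      forall t, 0 < t < T -> 0 <= L t,
      exists x y, C x y != 0 &
      forall h r s, 0 < h -> C (h * r) (h * s) = h `^ gamma * C r s].

(* (r^2 + s^2)^(-gamma/2) |E[(V_{t+r} - V_t)(V_{t+s} - V_t)] - L(t) C(r, s)| *)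
Definition scaling_error (V : R -> Omega -> R) (gamma : R) (L : R -> R)
    (C : R -> R -> R) (t : R) (p : R * R) : \bar R :=
  (((p.1 ^+ 2 + p.2 ^+ 2) `^ (- (gamma / 2)))%R%:E *
   `| 'E_P[fun w => ((V (t + p.1) w - V t w) * (V (t + p.2) w - V t w))%R]
      - (L t * C p.1 p.2)%R%:E |)%E.

Definition scaling_condition (T : R) (V : R -> Omega -> R) (gamma : R)
    (L : R -> R) (C : R -> R -> R) : Prop :=
  scaling_data T gamma L C /\
  forall t, 0 < t < T ->
    scaling_error V gamma L C t p @[p --> (0 : R, 0 : R)^'] --> 0%E.

(* V is indexed by [0, +oo[, so for given increments r and s the supremum is
   over those t in ]0, T[ for which t + r and t + s are nonnegative. *)
Definition scaling_condition_uniform (T : R) (V : R -> Omega -> R) (gamma : R)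
    (L : R -> R) (C : R -> R -> R) : Prop :=
  [/\ scaling_data T gamma L C,
      ereal_sup [set scaling_error V gamma L C t p |
          t in [set t | [/\ 0 < t < T, 0 <= t + p.1 & 0 <= t + p.2]]]
        @[p --> (0 : R, 0 : R)^'] --> 0%E &
      (ereal_sup [set `|L t|%R%:E | t in `]0%R, T[] < +oo)%E].

(* Convergence in distribution of X_h to Y as h tends to 0 from the right. *)
Definition cvg_in_distribution X (Y : Omega -> R) : Prop :=
  forall phi : R -> R, continuous phi -> (exists M, forall x, `|phi x| <= M) ->
  'E_P[phi \o X h]%E @[h --> 0^'+] --> 'E_P[phi \o Y]%E.

End processes.

(* (Omega', P') extends (Omega, P) through the projection proj. *)
Definition extension_of (R : realType) (d d' : measure_display)
    (Omega : measurableType d) (Omega' : measurableType d')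
    (P : probability Omega R) (P' : probability Omega' R)
    (proj : Omega' -> Omega) : Prop :=
  measurable_fun [set: Omega'] proj /\
  forall A, measurable A -> P' (proj @^-1` A) = P A.

Section kernels.
Context (R : realType).
Implicit Types (K : R -> R) (C : R -> R -> R).

Definition scaled_kernel K (h x : R) : R := K (x / h) / h.

(* \iint K(x) K(y) C(x, y) dx dy *)
Definition kernel_form K C : R :=
  \int[(@lebesgue_measure R \x @lebesgue_measure R)%E]_z
    (K z.1 * K z.2 * C z.1 z.2).

Definition brownian_C (x y : R) : R :=
  if 0 <= x * y then Num.min `|x| `|y| else 0.

(* The values of K at A and B are left free, so that the support is read as a
   closed set. [derive1 K] takes arbitrary real values at the finitely many points
   where K is not differentiable, which affects neither the integrability of K'
   nor the finiteness of the total variation of |K'|. The latter also gives K'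
   one-sided limits at the break points inside `]A, B[. *)
Definition admissible_kernel (gamma : R) C K : Prop :=
  [/\ (\int[lebesgue_measure]_x (K x)%:E = 1)%E,
      (exists A B : \bar R, let I := [set x : R | (A < x%:E < B)%E] in
        [/\ (A < 0 < B)%E,
            closure [set x | K x != 0] = closure I,
            exists k, forall x y, I x -> I y -> `|K x - K y| <= k * `|x - y| &
            exists S : set R, finite_set S /\
              forall x, I x -> ~ S x ->
                derivable K x 1 /\ {for x, continuous (derive1 K)}]),
      [/\ (\int[lebesgue_measure]_x (`|K x| * `|x| `^ gamma)%R%:E < +oo)%E,
          K x * `|x| `^ (gamma + 1) @[x --> +oo] --> 0,
          K x * `|x| `^ (gamma + 1) @[x --> -oo] --> 0,
          (\int[lebesgue_measure]_x `|derive1 K x|%R%:E < +oo)%E &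
          (ereal_sup [set total_variation p.1 p.2 (fun x => `|derive1 K x|%R) |
              p in [set p : R * R | (p.1 <= p.2)%R]] < +oo)%E] &
      0 < kernel_form K C].

(* \int_0^T K_h(t - tau) (V_t - V_tau) dt *)
Definition kernel_error (Omega : Type) K (T tau : R) (V : R -> Omega -> R)
    (h : R) (w : Omega) : R :=
  \int[lebesgue_measure]_(t in `[0, T])
    (scaled_kernel K h (t - tau) * (V t w - V tau w)).

End kernels.

(* Main.v *)
Require Import Defs.
From HB Require Import structures.
From mathcomp Require Import all_boot all_order all_algebra.
From mathcomp Require Import all_classical all_reals all_analysis.
From mathcomp Require Import measurable_realfun.
From mathcomp Require Import ring lra.
Import Order.TTheory GRing.Theory Num.Theory.
Import numFieldNormedType.Exports.
Local Open Scope classical_set_scope.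
Local Open Scope ring_scope.

(** Both cases are instances of one limit statement. Near [tau] the squared volatility [V] is, to
    first order, a factor fixed at time [tau] times the increment of a driving process [N]: on every
    event |G| <= A the difference between [V t - V tau] and [k G * (N t - N tau)] is o(|t -
    tau|^(gamma/2)) in mean. In case (1), [N] is the Wiener process, [G] is g_tau and [k] is the
    identity; in case (2), [N] is Z, [G] is Z_tau and [k] is f'. After the substitution t = tau + h
    x, the normalised kernel error is therefore close to k(G) S, where S is h^(-gamma/2) times the
    integral of K(x) (N(tau + h x) - N(tau)). By the scaling condition, the homogeneity of C and
    dominated convergence, E[S^2] tends to v, which is L(tau) times the double integral of K(x) K(y)
    C(x, y).

    What remains is that S becomes a centred normal variable of variance v, independent of [G]. This
    is expressed by the convergence of E cos(a G + b S + c) to E cos(a G + c) exp(-b^2 v / 2), the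
    hypothesis [trig] of the abstract limit theorem. In case (1), [brownian_trig] replaces g_tau by
    its value at the left end of the time window, which is close in mean and known before all the
    increments that enter S; the identity is then exact. In case (2), [gaussian_trig] uses that
    (Z_tau, S) is jointly Gaussian, so that only means and covariances count; the mean of S and its
    covariance with Z_tau are of order dl^(2 - gamma) with dl = sqrt h, and gamma < 2.

    To stay with finite sums, S is realised as a [grid_sum]: with h = dl^2, the kernel axis is cut
    at |x| = 1/dl and divided into cells so fine that freezing the process on each cell costs
    nothing in the limit ([kernel_error_grid], [grid_sum_variance_cvg]). The passage from cosines to
    all bounded continuous test functions is [cvg_joint], a Stone-Weierstrass argument with
    Bernstein polynomials in sines; [cvg_mixture] transfers the result to the kernel error, and
    [mixed_normal_cvg] is the resulting theorem.

    The first-order expansions are [ito_first_order], from an Ito isometry with the integrand frozen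
    at the left end of an interval, and [gaussian_first_order], from Taylor's formula together with
    the bound of Gaussian fourth moments by squared second moments. The extension of the probability
    space is the product with a standard normal law. *)

(** * Affine substitution for Lebesgue integrals *)

Section integration.
Context {R : realType}.
Notation mu := (@lebesgue_measure R).

Definition affine (c h : R) : measurableTypeR R -> measurableTypeR R :=
  fun x => c + h * x.

Lemma measurable_affine c h : measurable_fun setT (affine c h).
Proof. by apply: measurable_funD => //; apply: measurable_funM. Qed.

Let affine_scaled (c h : R) (h0 : 0 < h) :
    {measure set (measurableTypeR R) -> \bar R} :=
  let m : {measure set (measurableTypeR R) -> \bar R} :=
    measure_function_pushforward__canonical__measure_function_Measure
      mu (measurable_affine c h) in
  mscale (NngNum (ltW h0)) m.

(** Lebesgue measure is determined by its values on half-open intervals; the image under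
    [affine c h] divides their lengths by [h], and the scaling factor restores them. *)
Lemma affine_lebesgue_measure (c h : R) (h0 : 0 < h) (A : set R) : measurable A ->
  mu A = affine_scaled c h h0 A.
Proof.
move=> mA; apply: lebesgue_measure_unique => //= _ [[a b]] _ <-.
rewrite /mscale/= /pushforward.
have -> : affine c h @^-1` [set` `]a, b]] =
    [set` `](a - c) / h, (b - c) / h]] :> set R.
  apply/seteqP; split => x /=; rewrite !in_itv/= /affine ltr_pdivrMr// ler_pdivlMr//;
    by rewrite ltrBlDl lerBrDl (mulrC x).
rewrite !lebesgue_measure_itv/= !lte_fin ltr_pM2r ?invr_gt0// ltrD2r.
case: ifPn => _; last by rewrite mule0.
by rewrite -!EFinD -EFinM; congr (_%:E); field; rewrite gt_eqF.
Qed.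

Lemma ge0_integral_affine (c h : R) (f : R -> \bar R) : 0 < h ->
  measurable_fun setT f -> (forall x, (0 <= f x)%E) ->
  (\int[mu]_x f x = h%:E * \int[mu]_x f (c + h * x)%R)%E.
Proof.
move=> h0 mf f0.
rewrite (eq_measure_integral (affine_scaled c h h0)).
  rewrite ge0_integral_mscale// ge0_integral_pushforward//.
  exact: measurable_affine.
by move=> A mA _; exact: affine_lebesgue_measure.
Qed.

End integration.

(** * Integration against a measure with a density *)

Section density.
Context {d} {T : measurableType d} {R : realType}.
Context (mu nu : {measure set T -> \bar R}) (g : T -> R).
Hypotheses (mg : measurable_fun setT g) (g0 : forall x, 0 <= g x).
Hypothesis nuE : forall A, measurable A -> nu A = (\int[mu]_(x in A) (g x)%:E)%E.
Local Open Scope ereal_scope.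
Import HBNNSimple.

Let density_nnsfun (f : {nnsfun T >-> R}) :
  \int[nu]_x (f x)%:E = \int[mu]_x ((f x)%:E * (g x)%:E).
Proof.
under [LHS]eq_integral do rewrite fimfunE -fsumEFin//.
rewrite [LHS]ge0_integral_fsum//; last 2 first.
  - by move=> r; exact/measurable_EFinP/measurableT_comp.
  - by move=> n x _; rewrite EFinM nnfun_muleindic_ge0.
under [RHS]eq_integral.
  move=> x xD; rewrite fimfunE -fsumEFin// ge0_mule_fsuml; last first.
    by move=> r; rewrite EFinM nnfun_muleindic_ge0.
  over.
rewrite [RHS]ge0_integral_fsum//; last 2 first.
  - move=> r; apply: emeasurable_funM; last exact/measurable_EFinP.
    by apply/measurable_EFinP/measurableT_comp.
  - by move=> n x _; apply: mule_ge0; rewrite ?lee_fin ?EFinM ?nnfun_muleindic_ge0 // -lee_fin EFinM nnfun_muleindic_ge0.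
apply: eq_fsbigr => r _.
under [RHS]eq_integral do rewrite EFinM -muleA (muleC _ (g _)%:E).
rewrite integralZl_indic_nnsfun// integral_indic// setIT nuE//.
have [r0|r0] := leP 0%R r; last first.
  rewrite preimage_nnfun0 // integral_set0 mule0 integral0_eq // => x _.
  by rewrite indicE in_set0 !mule0.
rewrite ge0_integralZl//; last 2 first.
  - by apply: emeasurable_funM; exact/measurable_EFinP.
  - by move=> x _; rewrite mule_ge0// lee_fin.
by congr *%E; rewrite integral_mkcond; apply: eq_integral => x _;
  rewrite patchE indicE; case: ifP => _; rewrite ?mule1 ?mule0.
Qed.

(** Linearity gives the identity for simple functions, and monotone convergence on both sides
    extends it. *)
Lemma ge0_integral_density (f : T -> \bar R) :
  measurable_fun setT f -> (forall x, 0 <= f x) ->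
  \int[nu]_x f x = \int[mu]_x (f x * (g x)%:E).
Proof.
move=> mf f0; pose f_ := nnsfun_approx measurableT mf.
have mfg n : measurable_fun setT (fun x => (f_ n x)%:E * (g x)%:E).
  by apply: emeasurable_funM; apply/measurable_EFinP.
have ndfg : {homo (fun n => fun x => (f_ n x)%:E * (g x)%:E) :
    m n / (m <= n)%N >-> forall x, m x <= n x}.
  move=> m n mn x; rewrite lee_wpmul2r// lee_fin//.
  exact/lefP/nd_nnsfun_approx.
transitivity (limn (fun n => \int[nu]_x (f_ n x)%:E)).
  rewrite -monotone_convergence//=.
  - by apply: eq_integral => x _; apply/esym/cvg_lim => //; exact: cvg_nnsfun_approx.
  - by move=> n; exact/measurable_EFinP.
  - by move=> n x _; rewrite lee_fin.
  - by move=> x _ m n mn; rewrite lee_fin; exact/lefP/nd_nnsfun_approx.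
under eq_fun do rewrite density_nnsfun.
rewrite -monotone_convergence//=.
- apply: eq_integral => x _; apply/cvg_lim => //.
  by apply: cvgeZr => //; exact: cvg_nnsfun_approx.
- by move=> n x _; rewrite mule_ge0// lee_fin.
- by move=> x _ m n mn; exact: ndfg.
Qed.

End density.

Ltac measurability := repeat first
  [ assumption
  | exact: measurable_cst
  | exact: measurable_id
  | match goal with
    | |- measurable_fun _ (fun x => _ + _) => apply: measurable_funD
    | |- measurable_fun _ (fun x => - _) => apply: measurableT_comp => //
    | |- measurable_fun _ (fun x => _ * _) => apply: measurable_funM
    | |- measurable_fun _ (fun x => _ ^+ _) => apply: measurable_funX
    | |- measurable_fun _ (fun x => `| _ |) => apply: measurableT_comp => //
    | |- measurable_fun _ (fun x => \sum_(_ <- _) _) => apply: measurable_sum => ?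
    | |- measurable_fun _ (fun x => Order.max _ _) => apply: measurable_maxr
    | |- measurable_fun _ (fun x => Order.min _ _) => apply: measurable_minr
    end ].

(** * Calculus of bounds on means *)

Section mean_bound.
Context {d} {T : measurableType d} {R : realType}.
Implicit Types (m : {measure set T -> \bar R}) (F G X Y : T -> R).

(** Measurability, sign and bound travel together, and the bound is a real number, so that each
    estimate carries its own integrability and estimates can be added and scaled without finiteness
    conditions. *)
Definition mean_le m F (c : R) : Prop :=
  [/\ measurable_fun setT F, (forall w, 0 <= F w) &
      (\int[m]_w (F w)%:E <= c%:E)%E].

Lemma mean_leW m F c c' : mean_le m F c -> c <= c' -> mean_le m F c'.
Proof.
by move=> [mF F0 Fc] cc'; split=> //; apply: (le_trans Fc); rewrite lee_fin.
Qed.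

Lemma mean_le_ae m F G c : measurable_fun setT F -> (forall w, 0 <= F w) ->
  {ae m, forall w, F w <= G w} -> mean_le m G c -> mean_le m F c.
Proof.
move=> mF F0 FG [mG G0 Gc]; split=> //; apply: (le_trans _ Gc).
apply: ae_ge0_le_integral => //.
- by move=> x _; rewrite lee_fin.
- exact/measurable_EFinP.
- by move=> x _; rewrite lee_fin.
- exact/measurable_EFinP.
- by apply: filterS FG => x Fx _; rewrite lee_fin.
Qed.

Lemma mean_le_mono m F G c : measurable_fun setT F ->
  (forall w, 0 <= F w <= G w) -> mean_le m G c -> mean_le m F c.
Proof.
move=> mF FG; apply: mean_le_ae => //; first by move=> w; case/andP: (FG w).
by apply: aeW => w; case/andP: (FG w).
Qed.

Lemma mean_leD m F G c c' : mean_le m F c -> mean_le m G c' ->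
  mean_le m (fun w => F w + G w) (c + c').
Proof.
move=> [mF F0 Fc] [mG G0 Gc]; split.
- exact: measurable_funD.
- by move=> w; rewrite addr_ge0.
- under eq_integral do rewrite EFinD.
  rewrite ge0_integralD//.
  + by rewrite EFinD leeD.
  + by move=> x _; rewrite lee_fin.
  + exact/measurable_EFinP.
  + by move=> x _; rewrite lee_fin.
  + exact/measurable_EFinP.
Qed.

Lemma mean_leZ m F c k : 0 <= k -> mean_le m F c ->
  mean_le m (fun w => k * F w) (k * c).
Proof.
move=> k0 [mF F0 Fc]; split.
- exact: measurable_funM.
- by move=> w; rewrite mulr_ge0.
- under eq_integral do rewrite EFinM.
  rewrite ge0_integralZl//.
  + by rewrite EFinM lee_wpmul2l.
  + exact/measurable_EFinP.
  + by move=> x _; rewrite lee_fin.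
Qed.

Lemma mean_le0 m : mean_le m (fun=> 0) 0.
Proof. by split=> //; rewrite integral0. Qed.

Lemma mean_le_cst (P : probability T R) k : 0 <= k -> mean_le P (fun=> k) k.
Proof.
move=> k0; split=> //.
by have := integral_cst P measurableT k%:E; rewrite /cst /= => ->; rewrite probability_setT mule1.
Qed.

Lemma mean_le_sum m (I : Type) (r : seq I) (F : I -> T -> R) (c : I -> R) :
  (forall i, mean_le m (F i) (c i)) ->
  mean_le m (fun w => \sum_(i <- r) F i w) (\sum_(i <- r) c i).
Proof.
move=> H; elim: r => [|i r IH].
  rewrite big_nil; under eq_fun do rewrite big_nil; exact: mean_le0.
rewrite big_cons; under eq_fun do rewrite big_cons; exact: mean_leD.
Qed.

Lemma mean_le_ge0 m F c : mean_le m F c -> 0 <= c.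
Proof.
move=> [mF F0 Fc]; rewrite -lee_fin; apply: (le_trans _ Fc).
by apply: integral_ge0 => x _; rewrite lee_fin.
Qed.

Lemma mean_le_integrable m X c : measurable_fun setT X ->
  mean_le m (fun w => `|X w|) c -> m.-integrable setT (EFin \o X).
Proof.
move=> mX [_ _ Xc]; apply/integrableP; split; first exact/measurable_EFinP.
by apply: (le_lt_trans _ (ltry c)); apply: le_trans Xc.
Qed.

Lemma integrable_mean_le m X : m.-integrable setT (EFin \o X) ->
  (forall w, 0 <= X w) -> mean_le m X (\int[m]_w X w).
Proof.
move=> /[dup] iX /integrableP[mX _] X0; split=> //; first exact/measurable_EFinP.
by rewrite /Rintegral fineK//; apply: integrable_fin_num.
Qed.

Lemma mean_le_Rintegral m X c : measurable_fun setT X ->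
  mean_le m (fun w => `|X w|) c -> `|\int[m]_w X w| <= c.
Proof.
move=> mX Xc; have iX := mean_le_integrable m X c mX Xc.
apply: (le_trans (le_normr_Rintegral _ iX)) => //.
case: Xc => _ _; rewrite -lee_fin => /(le_trans _); apply.
rewrite /Rintegral fineK//; have := integrable_norm iX => /(integrable_fin_num measurableT).
by [].
Qed.

Lemma mean_le_markov m F c a : 0 < a -> mean_le m F c ->
  (m [set w | (a <= F w)%R] <= (c / a)%:E)%E.
Proof.
move=> a0 [mF F0 Fc].
have mA : measurable [set w | a <= F w].
  have -> : [set w | a <= F w] = F @^-1` `[a, +oo[.
    by apply/seteqP; split=> w /=; rewrite in_itv/= andbT.
  by rewrite -[X in measurable X]setTI; apply: mF.
have : (a%:E * m [set w | (a <= F w)%R] <= c%:E)%E.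
  apply: (le_trans _ Fc).
  rewrite -[X in m X]setIT -integral_indic// -ge0_integralZl//; last 2 first.
    by apply/measurable_EFinP/measurable_indic.
    by rewrite lee_fin ltW.
  apply: ge0_le_integral => //.
  - by move=> x _; rewrite mule_ge0// lee_fin// ltW.
  - by apply: emeasurable_funM => //; apply/measurable_EFinP/measurable_indic.
  - exact/measurable_EFinP.
  - move=> w _; rewrite -EFinM lee_fin indicE; case: (boolP (w \in _)).
      by rewrite inE/= mulr1.
    by rewrite mulr0.
have ca : c = a * (c / a) by rewrite mulrCA divff ?mulr1 // gt_eqF.
by rewrite [in X in (_ <= X)%E]ca EFinM lee_pmul2l// lte_fin.
Qed.

Lemma bounded_integrable (P : probability T R) X k : measurable_fun setT X ->
  (forall w, `|X w| <= k) -> P.-integrable setT (EFin \o X).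
Proof.
move=> mX Xk; apply: (mean_le_integrable P X `|k|) => //.
apply: (mean_le_mono P _ (fun=> `|k|)); first exact: measurableT_comp.
  by move=> w; rewrite normr_ge0 (le_trans (Xk w))// ler_norm.
exact: mean_le_cst.
Qed.

End mean_bound.

(** * Densities, substitutions and laws for signed integrands *)

Section signed.
Context {R : realType}.
Local Open Scope ereal_scope.

Lemma integral_density {d} {T : measurableType d} (mu nu : {measure set T -> \bar R})
    (g : T -> R) (f : T -> \bar R) :
  measurable_fun setT g -> (forall x, 0 <= g x)%R ->
  (forall A, measurable A -> nu A = \int[mu]_(x in A) (g x)%:E) ->
  measurable_fun setT f ->
  \int[nu]_x f x = \int[mu]_x (f x * (g x)%:E).
Proof.
move=> mg g0 nuE mf; rewrite integralE [RHS]integralE.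
rewrite (ge0_integral_density mu nu g mg g0 nuE f^\+ (measurable_funepos mf))//.
rewrite (ge0_integral_density mu nu g mg g0 nuE f^\- (measurable_funeneg mf))//.
congr (_ - _); apply: eq_integral => x _.
- by rewrite !funeposE maxe_pMl ?mul0e// lee_fin.
- by rewrite !funenegE maxe_pMl ?mul0e ?mulNe// lee_fin.
Qed.

(** A strictly positive factor keeps infinities infinite, so the two sides agree even for oo - oo;
    this is what frees the substitution formulas below from integrability assumptions. *)
Lemma gt0_muleBr (h : R) (x y : \bar R) : (0 < h)%R ->
  h%:E * (x - y) = h%:E * x - h%:E * y.
Proof.
move=> h0; have [xy|] := boolP (x +? - y); first by rewrite muleDr// muleN.
by case: x => [x| |]; case: y => [y| |] //= _;
  rewrite ?addeNy ?gt0_mulye ?gt0_mulNye ?gt0_muley ?gt0_muleNy ?lte_fin.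
Qed.

Lemma gt0_integralZl {d} {T : measurableType d} (mu : {measure set T -> \bar R})
    (h : R) (f : T -> \bar R) : (0 < h)%R -> measurable_fun setT f ->
  \int[mu]_x (h%:E * f x) = h%:E * \int[mu]_x f x.
Proof.
move=> h0 mf; rewrite integralE [X in _ = _ * X]integralE [RHS]gt0_muleBr//.
rewrite -(ge0_integralZl mu measurableT (measurable_funepos mf))//; last exact: ltW.
rewrite -(ge0_integralZl mu measurableT (measurable_funeneg mf))//; last exact: ltW.
congr (_ - _); apply: eq_integral => x _.
- by rewrite !funeposE maxe_pMr ?mule0// lee_fin ltW.
- by rewrite !funenegE maxe_pMr ?mule0 ?muleN// lee_fin ltW.
Qed.

Lemma integral_affine (c h : R) (f : R -> \bar R) : (0 < h)%R ->
  measurable_fun setT f ->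
  \int[lebesgue_measure]_x f x = h%:E * \int[lebesgue_measure]_x f (c + h * x)%R.
Proof.
move=> h0 mf; rewrite integralE [X in _ = _ * X]integralE.
rewrite [RHS]gt0_muleBr//.
rewrite (ge0_integral_affine c h _ h0 (measurable_funepos mf))//.
rewrite (ge0_integral_affine c h _ h0 (measurable_funeneg mf))//.
congr (_ * _ - _ * _); apply: eq_integral => x _.
- by rewrite !funeposE.
- by rewrite !funenegE.
Qed.

Lemma integral_law {d} {T : measurableType d} (P : probability T R) (Y : T -> R)
    (nu : {measure set (measurableTypeR R) -> \bar R}) (f : R -> \bar R) :
  has_law P Y nu -> measurable_fun setT f ->
  \int[P]_w f (Y w) = \int[nu]_x f x.
Proof.
move=> [mY YE] mf.
have H g : measurable_fun setT g -> (forall x, 0 <= g x) ->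
    \int[P]_w g (Y w) = \int[nu]_x g x.
  move=> mg g0; rewrite -(@ge0_integral_pushforward _ _ T (measurableTypeR R) R Y mY P setT g measurableT mg)//.
  by apply: eq_measure_integral => A mA _; rewrite -YE.
rewrite integralE [RHS]integralE.
rewrite -(H _ (measurable_funepos mf))// -(H _ (measurable_funeneg mf))//.
by congr (_ - _); apply: eq_integral => x _; rewrite ?funeposE ?funenegE.
Qed.

End signed.

Lemma integral_mulr_indic {d} {T : measurableType d} (R : realType)
    (m : {measure set T -> \bar R}) (D : set T) (f : T -> R) :
  (\int[m]_x (f x * \1_D x)%:E = \int[m]_(x in D) (f x)%:E)%E.
Proof.
rewrite [RHS]integral_mkcond; apply: eq_integral => x _.
by rewrite patchE indicE; case: ifP => _; rewrite ?mulr1 ?mulr0.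
Qed.

Lemma cvg0_norm_le {R : realType} (u v : nat -> R) :
  (\forall n \near \oo, `|u n| <= v n) -> v @ \oo --> 0 -> u @ \oo --> 0.
Proof.
move=> uv v0; apply/cvgr0Pnorm_lt => e e0.
apply: filterS2 uv ((cvgr0Pnorm_lt v).1 v0 e e0) => n un vn.
by apply: le_lt_trans vn; apply: le_trans un (ler_norm _).
Qed.

Lemma integral_probability_cst {d} {T : measurableType d} {R : realType}
  (P : probability T R) (k : \bar R) : (\int[P]_w k = k)%E.
Proof.
have := integral_cst P measurableT k; rewrite /cst /= => ->.
by rewrite probability_setT mule1.
Qed.

Lemma Rintegral_sum {d} {T : measurableType d} {R : realType}
    (m : {measure set T -> \bar R}) (I : Type) (s : seq I) (F : I -> T -> R) :
  (forall i, m.-integrable setT (EFin \o F i)) ->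
  m.-integrable setT (EFin \o (fun x => \sum_(i <- s) F i x)) /\
  \int[m]_x (\sum_(i <- s) F i x) = \sum_(i <- s) \int[m]_x F i x.
Proof.
move=> iF; have E x : (\sum_(i <- s) F i x)%:E = (\sum_(i <- s) (F i x)%:E)%E.
  by rewrite sumEFin.
split.
  by rewrite /comp; under eq_fun do rewrite E; apply: integrable_sum => // i _; exact: iF.
rewrite /Rintegral; under eq_integral do rewrite E.
rewrite integral_sum// sum_fine// => i _.
exact: (integrable_fin_num measurableT (iF i)).
Qed.

Lemma mean_le_integrable_ge0 {d} {T : measurableType d} {R : realType}
    (m : {measure set T -> \bar R}) (F : T -> R) (c : R) :
  mean_le m F c -> m.-integrable setT (EFin \o F).
Proof.
move=> H; have [mF F0 _] := H; apply: (mean_le_integrable m F c) => //.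
have -> : (fun w => `|F w|) = F by apply/funext => w; rewrite ger0_norm.
exact: H.
Qed.

(** * The standard normal law: Stein identity, moments, characteristic function *)

Section gaussian_density.
Context {R : realType}.
Notation mu := (@lebesgue_measure R).
Notation p := (normal_pdf (0 : R) 1).

Lemma normal_pdf01E (x : R) : p x = normal_peak 1 * expR (- x ^+ 2 / 2).
Proof.
by rewrite normal_pdfE ?oner_eq0// /normal_fun subr0 expr1n.
Qed.

(** The fundamental theorem of calculus on growing symmetric intervals leaves only boundary terms,
    and these vanish; the integrals over the intervals converge by domination by |F'|. *)
Lemma Rintegral_derivative_eq0 (F F' : R -> R) :
  (forall x : R, is_derive x 1 F (F' x)) -> continuous F' ->
  mu.-integrable setT (EFin \o F') ->
  F n%:R @[n --> \oo] --> 0 -> F (- n%:R) @[n --> \oo] --> 0 ->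
  \int[mu]_x F' x = 0.
Proof.
move=> dF cF iF Fp Fm.
have mF' : measurable_fun setT F' by exact: continuous_measurable_fun.
pose D (n : nat) : set R := `[(- n.+1%:R)%R, n.+1%:R]%classic.
have FTC n : (\int[mu]_(x in D n) (F' x)%:E)%E = (F n.+1%:R - F (- n.+1%:R))%:E.
  rewrite EFinB; apply: continuous_FTC2.
  - by rewrite gtrN.
  - exact: continuous_subspaceT.
  - have cFF x : {for x, continuous F}.
      by apply: differentiable_continuous; apply/derivable1_diffP; apply: (@ex_derive _ _ _ _ _ _ _ (dF x)).
    split=> [x _||].
    + by apply: (@ex_derive _ _ _ _ _ _ _ (dF x)).
    + exact/cvg_at_right_filter/cFF.
    + exact/cvg_at_left_filter/cFF.
  - by move=> x _; rewrite derive1E; apply: derive_val.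
have := @dominated_convergence _ _ R mu setT measurableT
  (fun n x => (F' x * \1_(D n) x)%:E) (EFin \o F') (fun x => `|F' x|%:E).
case.
- move=> n; apply/measurable_EFinP; apply: measurable_funM => //.
  by apply: measurable_indic; apply: measurable_itv.
- exact/measurable_EFinP.
- apply: aeW => x _; apply: cvg_near_cst.
  exists (Num.bound `|x|) => // n /= xn; rewrite indicE mem_set ?mulr1//.
  rewrite /D/= in_itv/= -ler_norml ltW// (lt_le_trans (archi_boundP (normr_ge0 _)))//.
  by rewrite ler_nat leqW.
- exact: (integrable_norm iF).
- apply: aeW => x n _ /=; rewrite lee_fin normrM ler_piMr//.
  by rewrite indicE; case: (_ \in _); rewrite ?normr1 ?normr0.
move=> _ _ cv.
have cv0 : (\int[mu]_x (F' x * \1_(D n) x)%:E)%E @[n --> \oo] --> (0 : \bar R).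
  under eq_fun do rewrite integral_mulr_indic FTC.
  apply: cvg_EFin; first exact: nearW.
  rewrite -[X in _ --> X](subr0 0).
  apply: cvgB; first by rewrite (cvg_shiftS (fun n => F n%:R)).
  by rewrite (cvg_shiftS (fun n => F (- n%:R))).
by rewrite /Rintegral (cvg_unique _ cv cv0)//; exact: ereal_hausdorff.
Qed.

Lemma cvg_natr_decay (F : R -> R) (C : R) : (forall x, `|x * F x| <= C) ->
  F n%:R @[n --> \oo] --> 0 /\ F (- n%:R) @[n --> \oo] --> 0.
Proof.
move=> HF; have B : C * n.+1%:R^-1 @[n --> \oo] --> (0 : R).
  by rewrite -(mulr0 C); apply: cvgMr; exact: cvg_harmonic.
rewrite -(cvg_shiftS (fun n => F n%:R)) -(cvg_shiftS (fun n => F (- n%:R))).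
split; apply: (cvg0_norm_le _ _ _ B); apply: nearW => n; rewrite ler_pdivlMr//.
- by have := HF n.+1%:R; rewrite normrM mulrC normr_nat.
- by have := HF (- n.+1%:R); rewrite normrM mulrC normrN normr_nat.
Qed.

(** The exponential is the square of exp(x^2 / 8) >= 1 + x^2 / 8, whose leading term squared is x^4
    / 64. *)
Lemma quartic_expR (x : R) : 1 + x ^+ 4 <= 65 * expR (x ^+ 2 / 4).
Proof.
have E : expR (x ^+ 2 / 4) = expR (x ^+ 2 / 8) ^+ 2.
  by rewrite -expRM_natl; congr expR; field.
have x8 : 0 <= x ^+ 2 / 8 by rewrite divr_ge0// sqr_ge0.
have H : 1 + x ^+ 2 / 8 <= expR (x ^+ 2 / 8) by exact: expR_ge1Dx.
have : (1 + x ^+ 2 / 8) ^+ 2 <= expR (x ^+ 2 / 8) ^+ 2.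
  by rewrite ler_sqr ?nnegrE ?addr_ge0// expR_ge0.
rewrite -E => {}H; apply: (@le_trans _ _ (65 * (1 + x ^+ 2 / 8) ^+ 2)).
  have -> : x ^+ 4 = (x ^+ 2) ^+ 2 by rewrite -exprM.
  have := sqr_ge0 x; set y := x ^+ 2 => y0; nra.
by rewrite ler_pM2l.
Qed.

(** Half of the Gaussian exponent absorbs the polynomial; what is left, exp(-x^2 / 4), is a multiple
    of the normal density of variance 2. The first bound serves integrability, the second the
    boundary terms in Stein's identity. *)
Lemma quartic_normal_pdf : exists2 k : R, 0 < k & forall x : R,
  (1 + x ^+ 4) * p x <= k * normal_pdf 0 (Num.sqrt 2) x /\
  (1 + x ^+ 4) * p x <= k.
Proof.
have s20 : Num.sqrt (2 : R) != 0 by rewrite gt_eqF// sqrtr_gt0.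
pose c1 := normal_peak (1 : R); pose c2 := normal_peak (Num.sqrt (2 : R)).
have c10 : 0 < c1 by apply: normal_peak_gt0; rewrite oner_eq0.
have c20 : 0 < c2 by apply: normal_peak_gt0.
exists (65 * (c1 / c2) + 65 * c1) => [|x].
  by apply: addr_gt0; apply: mulr_gt0 => //; exact: divr_gt0.
have E : expR (- x ^+ 2 / 2) = (expR (x ^+ 2 / 4))^-1 * expR (- x ^+ 2 / 4).
  by rewrite -expRN -expRD; congr expR; field.
have B : (1 + x ^+ 4) * p x <= 65 * c1 * expR (- x ^+ 2 / 4).
  rewrite normal_pdf01E -/c1 E.
  have := quartic_expR x; have := expR_gt0 (x ^+ 2 / 4).
  set e := expR (x ^+ 2 / 4) => e0 H.
  have -> : (1 + x ^+ 4) * (c1 * (e^-1 * expR (- x ^+ 2 / 4))) =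
    (1 + x ^+ 4) / e * (c1 * expR (- x ^+ 2 / 4)) by field; rewrite gt_eqF.
  rewrite -[leRHS]mulrA ler_pM2r ?mulr_gt0 ?expR_gt0//.
  by rewrite ler_pdivrMr.
have q : normal_pdf 0 (Num.sqrt 2) x = c2 * expR (- x ^+ 2 / 4).
  rewrite normal_pdfE// /normal_fun subr0 sqr_sqrtr//.
  by congr (_ * expR (_ / _)); rewrite -[2]/(1 *+ 2) -mulrnA.
have e1 : 0 < expR (- x ^+ 2 / 4) <= 1.
  by rewrite expR_gt0 expR_le1 ?mulNr ?oppr_le0 ?divr_ge0 ?sqr_ge0.
split; apply: (le_trans B).
- rewrite q; move: e1; set e := expR _ => /andP[e0 _].
  have -> : (65 * (c1 / c2) + 65 * c1) * (c2 * e) = 65 * c1 * e + 65 * c1 * c2 * e.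
    by field; rewrite gt_eqF.
  by rewrite lerDl !mulr_ge0// ltW.
- apply: (@le_trans _ _ (65 * c1)).
    by case/andP: e1 => _ e1; rewrite ler_piMr// mulr_ge0 ?ltW.
  by rewrite lerDr mulr_ge0// divr_ge0 ?ltW.
Qed.

Notation N01 := (normal_prob (0 : R) 1).

Lemma integral_normal_prob (m s : R) (f : R -> \bar R) : measurable_fun setT f ->
  (\int[normal_prob m s]_x f x = \int[mu]_x (f x * (normal_pdf m s x)%:E))%E.
Proof.
move=> mf; apply: integral_density => //; first exact: measurable_normal_pdf.
by move=> x; exact: normal_pdf_ge0.
Qed.

Lemma normal_quartic_mean : exists k : R, mean_le N01 (fun x => 1 + x ^+ 4) k.
Proof.
have [k k0 H] := quartic_normal_pdf.
exists k; split.
- by apply: measurable_funD => //; exact: measurable_funX.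
- by move=> x; rewrite addr_ge0// -[4%N]/(2 * 2)%N exprM sqr_ge0.
rewrite integral_normal_prob; last first.
  by apply/measurable_EFinP; apply: measurable_funD => //; exact: measurable_funX.
have := integral_normal_pdf (0 : R) (Num.sqrt 2) => I.
apply: (@le_trans _ _ (\int[mu]_x (k%:E * (normal_pdf 0 (Num.sqrt 2) x)%:E))%E).
  apply: ge0_le_integral => //.
  - move=> x _; rewrite -EFinM lee_fin mulr_ge0 ?normal_pdf_ge0// addr_ge0//.
    by rewrite -[4%N]/(2 * 2)%N exprM sqr_ge0.
  - apply/measurable_EFinP/measurable_funM; last exact: measurable_normal_pdf.
    by apply: measurable_funD => //; exact: measurable_funX.
  - apply/measurable_EFinP/measurable_funM => //; exact: measurable_normal_pdf.
  - by move=> x _; rewrite -!EFinM lee_fin; case: (H x).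
rewrite ge0_integralZl//.
- by rewrite I mule1.
- by apply/measurable_EFinP; exact: measurable_normal_pdf.
- by move=> x _; rewrite lee_fin normal_pdf_ge0.
- by rewrite lee_fin ltW.
Qed.

Lemma normal_integrable (f : R -> R) (k : R) : measurable_fun setT f ->
  (forall x, `|f x| <= k * (1 + x ^+ 4)) -> N01.-integrable setT (EFin \o f).
Proof.
move=> mf fk; have [c Hc] := normal_quartic_mean.
have k0 : 0 <= k.
  by have := fk 0; rewrite expr0n/= addr0 mulr1; apply: le_trans.
apply: (mean_le_integrable N01 f (k * c)) => //.
apply: (mean_le_mono N01 _ (fun x => k * (1 + x ^+ 4))).
- exact: measurableT_comp.
- by move=> x; rewrite normr_ge0 fk.
- exact: mean_leZ.
Qed.

Lemma is_derive_gauss (x : R) c : is_derive x (1:R) (fun y : R => c * expR (- y ^+ 2 / 2)) (- x * (c * expR (- x ^+ 2 / 2))).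
Proof.
have dg : is_derive x (1:R) (fun y : R => - y ^+ 2 / 2) (- x).
  have -> : (fun y : R => - y ^+ 2 / 2) = (- 2^-1 : R) \*: (@idfun R ^+ 2).
    by apply/funext => y /=; rewrite /GRing.scale/= fctE /=; field.
  by apply: is_derive_eq; rewrite /GRing.scale/=; field.
have de : is_derive x (1:R) (fun y : R => expR (- y ^+ 2 / 2)) (- x * expR (- x ^+ 2 / 2)).
  apply: is_derive_eq; exact: mulrC.
have -> : (fun y : R => c * expR (- y ^+ 2 / 2)) = c \*: (fun y : R => expR (- y ^+ 2 / 2)) by [].
by apply: is_derive_eq; rewrite /GRing.scale/=; ring.
Qed.
Lemma is_derive1M (x : R) (a p : R -> R) a' p' : is_derive x (1:R) a a' -> is_derive x (1:R) p p' ->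
  is_derive x (1:R) (fun y => a y * p y) (a' * p x + a x * p').
Proof.
move=> da dp; have := is_deriveM da dp; rewrite /GRing.scale/= => H.
by apply: is_derive_eq; rewrite /=; ring.
Qed.

(** The integrand times the density [p] is the derivative of [a * p], because p' = -x p. The growth
    conditions make it integrable and make x a(x) p(x) bounded, so that [a * p] vanishes at
    infinity. *)
Lemma normal_stein (a a' : R -> R) (k : R) :
  (forall x : R, is_derive x 1 a (a' x)) -> continuous a' ->
  (forall x, `|x * a x| <= k * (1 + x ^+ 4)) ->
  (forall x, `|a' x| <= k * (1 + x ^+ 4)) ->
  \int[N01]_x (a' x - x * a x) = 0.
Proof.
move=> da ca' ak a'k.
have ca : continuous a.
  by move=> x; apply: differentiable_continuous; apply/derivable1_diffP;
    apply: (@ex_derive _ _ _ _ _ _ _ (da x)).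
have cb : continuous (fun x => a' x - x * a x).
  by move=> x; apply: cvgB; [exact: ca'|apply: cvgM => //; exact: ca].
have mb := continuous_measurable_fun cb.
have cp : continuous p by apply: continuous_normal_pdf; rewrite oner_eq0.
have [K K0 HK] := quartic_normal_pdf.
have B x : `|x * (a x * p x)| <= `|k| * K.
  rewrite mulrA normrM (ger0_norm (normal_pdf_ge0 _ _ _)).
  apply: (@le_trans _ _ (`|k| * ((1 + x ^+ 4) * p x))).
    rewrite mulrA ler_wpM2r ?normal_pdf_ge0//; apply: (le_trans (ak x)).
    by rewrite ler_wpM2r ?ler_norm// addr_ge0// -[4%N]/(2 * 2)%N exprM sqr_ge0.
  by rewrite ler_wpM2l//; case: (HK x).
have ib : N01.-integrable setT (EFin \o (fun x => a' x - x * a x)).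
  apply: (normal_integrable _ (k + k)) => // x.
  by rewrite (le_trans (ler_normB _ _))// mulrDl lerD.
have E : \int[N01]_x (a' x - x * a x) = \int[mu]_x ((a' x - x * a x) * p x).
  rewrite /Rintegral integral_normal_prob//; exact/measurable_EFinP.
rewrite E; apply: (Rintegral_derivative_eq0 (fun x => a x * p x)).
- move=> x; have dp : is_derive x 1 p (- x * p x).
    have -> : p = (fun x => normal_peak 1 * expR (- x ^+ 2 / 2)).
      by apply/funext => y; exact: normal_pdf01E.
    exact: is_derive_gauss.
  have := is_derive1M _ _ _ _ _ (da x) dp.
  by rewrite mulrBl [x * _]mulrC mulNr mulrN mulrA.
- by move=> x; apply: cvgM; [exact: cb|exact: cp].
- move/integrableP : ib => [_ ib]; apply/integrableP; split.
    apply/measurable_EFinP/measurable_funM => //; exact: measurable_normal_pdf.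
  rewrite integral_normal_prob in ib; last exact/measurableT_comp/measurable_EFinP.
  apply: le_lt_trans ib; rewrite le_eqVlt; apply/orP; left; apply/eqP.
  by apply: eq_integral => x _ /=; rewrite normrM EFinM (ger0_norm (normal_pdf_ge0 _ _ _)).
- by have [] := cvg_natr_decay _ _ B.
- by have [] := cvg_natr_decay _ _ B.
Qed.

Lemma normr_le_quartic (x : R) : `|x| <= 1 + x ^+ 4.
Proof.
have -> : x ^+ 4 = `|x| ^+ 2 ^+ 2 by rewrite real_normK ?num_real// -exprM.
set y := `|x|; have := sqr_ge0 (y ^+ 2 - 1); have := sqr_ge0 (y - 1); nra.
Qed.

Lemma sqr_le_quartic (x : R) : x ^+ 2 <= 1 + x ^+ 4.
Proof.
have -> : x ^+ 4 = x ^+ 2 ^+ 2 by rewrite -exprM.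
have := sqr_ge0 (x ^+ 2 - 1); nra.
Qed.

Lemma one_le_quartic (x : R) : 1 <= 1 + x ^+ 4.
Proof. by rewrite lerDl -[4%N]/(2 * 2)%N exprM sqr_ge0. Qed.

Lemma normal_mean : \int[N01]_x x = 0.
Proof.
have : \int[N01]_x (0 - x * (-1)) = 0.
  apply: (normal_stein (fun=> -1) (fun=> 0) 1).
  - by move=> x; exact: cvg_cst.
  - by move=> x; rewrite mulrN1 normrN mul1r normr_le_quartic.
  - by move=> x; rewrite normr0 mul1r (le_trans _ (one_le_quartic x)).
by under eq_Rintegral do rewrite mulrN1 sub0r opprK.
Qed.

Lemma normal_integrable_id : N01.-integrable setT (EFin \o (fun x : R => x)).
Proof.
by apply: (normal_integrable _ 1) => // x; rewrite mul1r normr_le_quartic.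
Qed.

Lemma normal_integrable_sqr : N01.-integrable setT (EFin \o (fun x : R => x ^+ 2)).
Proof.
apply: (normal_integrable _ 1); first exact: measurable_funX.
by move=> x; rewrite mul1r ger0_norm ?sqr_ge0// sqr_le_quartic.
Qed.

Lemma normal_sqr : \int[N01]_x (x ^+ 2) = 1.
Proof.
have : \int[N01]_x (1 - x * x) = 0.
  apply: (normal_stein (fun x => x) (fun=> 1) 1).
  - by move=> x; exact: cvg_cst.
  - by move=> x; rewrite mul1r -expr2 ger0_norm ?sqr_ge0// sqr_le_quartic.
  - by move=> x; rewrite normr1 mul1r one_le_quartic.
rewrite RintegralB//.
- rewrite Rintegral_cst//= probability_setT/= mul1r.
  by under eq_Rintegral do rewrite -expr2; move/eqP; rewrite subr_eq0 => /eqP <-.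
- exact: finite_measure_integrable_cst.
- by have := normal_integrable_sqr; under eq_fun do rewrite expr2.
Qed.

(** Differentiation under the integral and Stein's identity for sin(b x + c) give the equation phi'
    = -b phi for the left side phi as a function of b, so phi(b) exp(b^2 / 2) is constant. The phase
    [c] lets a single statement cover both parts of the characteristic function. *)
Lemma normal_cos (b c : R) :
  \int[N01]_x cos (b * x + c) = expR (- b ^+ 2 / 2) * cos c.
Proof.
have mlin (b1 : R) : measurable_fun setT (fun x : R => b1 * x + c).
  by apply: measurable_funD => //; exact: measurable_funM.
have mcos : measurable_fun setT (@cos R).
  by apply: continuous_measurable_fun; exact: continuous_cos.
have msin : measurable_fun setT (@sin R).
  by apply: continuous_measurable_fun; exact: continuous_sin.
pose f (b x : R) := cos (b * x + c).
have df (b1 x : R) : is_derive b1 (1 : R) (f ^~ x) (- (x * sin (b1 * x + c))).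
  have dl : is_derive b1 (1 : R) (fun b : R => b * x + c) x.
    have -> : (fun b : R => b * x + c) = (x \*: (@idfun R)) + cst c.
      by apply/funext => y; rewrite fctE /= /GRing.scale/= mulrC.
    by apply: is_derive_eq; rewrite /GRing.scale/=; ring.
  have := @is_derive1_comp _ cos (fun b : R => b * x + c) _ _ _ (is_derive_cos _) dl.
  by rewrite mulNr mulrC.
pose phi (b : R) := \int[N01]_x f b x.
have dphi (b0 : R) : is_derive b0 (1 : R) phi (- b0 * phi b0).
  have Ia : `]b0 - 1, b0 + 1[%classic b0 by rewrite /= in_itv/=; lra.
  have intf b1 : `]b0 - 1, b0 + 1[%classic b1 -> N01.-integrable setT (EFin \o f b1).
    move=> _; apply: (bounded_integrable N01 _ 1); first by apply: (measurableT_comp mcos); exact: mlin.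
    by move=> x; exact: cos_max.
  have iG := integrable_norm normal_integrable_id.
  have dom (b1 x : R) : `]b0 - 1, b0 + 1[%classic b1 -> setT x ->
      `|partial1of2 f b1 x| <= `|x|.
    move=> _ _; rewrite partial1of2E (@derive_val _ _ _ _ _ _ _ (df b1 x)).
    by rewrite normrN normrM ler_piMr// sin_max.
  have derf (b1 x : R) : `]b0 - 1, b0 + 1[%classic b1 -> setT x -> derivable (f^~ x) b1 1.
    by move=> _ _; apply: (@ex_derive _ _ _ _ _ _ _ (df b1 x)).
  have D := derivable_under_integral measurableT Ia intf derf (fun y => normr_ge0 y) iG dom.
  have E := differentiation_under_integral measurableT Ia intf derf (fun y => normr_ge0 y) iG dom.
  apply: DeriveDef => //; rewrite -derive1E E.
  under eq_Rintegral do rewrite partial1of2E (@derive_val _ _ _ _ _ _ _ (df b0 _)).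
  have S : \int[N01]_x (b0 * cos (b0 * x + c) - x * sin (b0 * x + c)) = 0.
    apply: (normal_stein (fun x => sin (b0 * x + c)) _ (1 + `|b0|)).
    - move=> x; have dl : is_derive x (1 : R) (fun x : R => b0 * x + c) b0.
        have -> : (fun x : R => b0 * x + c) = (b0 \*: (@idfun R)) + cst c by [].
        by apply: is_derive_eq; rewrite /GRing.scale/=; ring.
      have := @is_derive1_comp _ sin (fun x : R => b0 * x + c) _ _ _ (is_derive_sin _) dl.
      by rewrite mulrC.
    - move=> x; apply: cvgMr; apply: continuous_comp; last exact: continuous_cos.
      by apply: cvgD; [apply: cvgMr; exact: cvg_id|exact: cvg_cst].
    - move=> x; rewrite normrM (@le_trans _ _ `|x|)// ?ler_piMr// ?sin_max//.
      rewrite mulrDl mul1r (le_trans (normr_le_quartic x))// lerDl mulr_ge0//.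
      exact: le_trans (one_le_quartic x).
    - move=> x; rewrite normrM (@le_trans _ _ `|b0|)// ?ler_piMr// ?cos_max//.
      rewrite (@le_trans _ _ (1 + `|b0|))// ?lerDr// ler_peMr ?addr_ge0//.
      exact: one_le_quartic.
  have icos : N01.-integrable setT (EFin \o (fun x => cos (b0 * x + c))).
    by apply: intf; exact: Ia.
  have isin : N01.-integrable setT (EFin \o (fun x => x * sin (b0 * x + c))).
    apply: (normal_integrable _ 1).
      by apply: measurable_funM => //; apply: (measurableT_comp msin); exact: mlin.
    move=> x; rewrite normrM mul1r (le_trans _ (normr_le_quartic x))//.
    by rewrite ler_piMr// sin_max.
  move: S; rewrite RintegralB//; last exact: (integrableZl measurableT b0 icos).
  rewrite RintegralZl// => /eqP; rewrite subr_eq0 => /eqP S.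
  under eq_Rintegral do rewrite -mulN1r.
  by rewrite RintegralZl// -S mulN1r mulNr.
pose g (b : R) := phi b * expR (b ^+ 2 / 2).
have dg (b1 : R) : is_derive b1 (1 : R) g 0.
  have dh : is_derive b1 (1:R) (fun y : R => y ^+ 2 / 2) b1.
    have -> : (fun y : R => y ^+ 2 / 2) = (2^-1 : R) \*: (@idfun R ^+ 2).
      by apply/funext => y /=; rewrite /GRing.scale/= fctE /=; field.
    by apply: is_derive_eq; rewrite /GRing.scale/=; field.
  have de := @is_derive1_comp _ expR (fun y : R => y ^+ 2 / 2) _ _ _ (is_derive_expR _) dh.
  have := is_derive1M _ _ _ _ _ (dphi b1) de.
  suff -> : - b1 * phi b1 * expR (b1 ^+ 2 / 2) + phi b1 * (expR (b1 ^+ 2 / 2) * b1) = 0 by [].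
  by ring.
have := is_derive_0_is_cst b 0 dg.
rewrite /g expr0n/= mul0r expR0 mulr1 => H.
have p0 : phi 0 = cos c.
  rewrite /phi /f; under eq_Rintegral do rewrite mul0r add0r.
  by rewrite Rintegral_cst//= probability_setT/= mulr1.
rewrite -/(phi b) mulNr expRN -p0 -H.
by field; rewrite gt_eqF// expR_gt0.
Qed.

Lemma normal_pdf_affine (m s x : R) : 0 < s ->
  s * normal_pdf m s (m + s * x) = p x.
Proof.
move=> s0; rewrite normal_pdf01E normal_pdfE ?gt_eqF// mulrA; congr (_ * expR _).
- rewrite /normal_peak expr1n mul1r -mulrnAr sqrtrM ?sqr_ge0//.
  by rewrite sqrtr_sqr gtr0_norm// invfM mulrA divff ?gt_eqF// mul1r.
- by rewrite addrAC subrr add0r; field; rewrite gt_eqF.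
Qed.

Lemma integral_normal_affine (m s : R) (f : R -> \bar R) : 0 < s ->
  measurable_fun setT f ->
  (\int[normal_prob m s]_x f x = \int[N01]_x f (m + s * x)%R)%E.
Proof.
move=> s0 mf; rewrite integral_normal_prob// (integral_affine m s)//; last first.
  by apply: emeasurable_funM => //; apply/measurable_EFinP; exact: measurable_normal_pdf.
rewrite integral_normal_prob; last first.
  by apply: measurableT_comp => //; exact: (measurable_affine m s).
rewrite -gt0_integralZl//; last first.
  apply: emeasurable_funM; first exact: (measurableT_comp mf (measurable_affine m s)).
  apply/measurable_EFinP; apply: measurableT_comp (measurable_affine m s).
  exact: measurable_normal_pdf.
by apply: eq_integral => x _; rewrite muleCA -EFinM normal_pdf_affine.
Qed.

End gaussian_density.

(** * Gaussian variables, degenerate ones included *)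

Section gaussian_variable.
Context {d} {T : measurableType d} {R : realType} (P : probability T R).
Notation N01 := (normal_prob (0 : R) 1).

(** With s = 0 allowed, a Dirac mass and a proper normal law are both the law of m + s X for a
    standard normal X, so later arguments need no case distinction. *)
Lemma gaussian_law (Y : T -> R) : gaussian_variable P Y ->
  exists m s, [/\ measurable_fun setT Y, 0 <= s & forall f : R -> \bar R,
    measurable_fun setT f -> (\int[P]_w f (Y w) = \int[N01]_x f (m + s * x)%R)%E].
Proof.
case=> [[m H]|[m [s [s0 H]]]].
- exists m, 0; split=> // [|f mf]; first by case: H.
  have := integral_law P Y (@dirac _ (measurableTypeR R) m R) f H mf.
  have mf' : measurable_fun [set: measurableTypeR R] f by exact: mf.
  rewrite (@integral_dirac _ (measurableTypeR R) m R setT measurableT f mf').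
  rewrite diracT mul1e => ->.
  under eq_integral do rewrite mul0r addr0.
  by rewrite (integral_probability_cst N01).
- exists m, s; split; [by case: H|exact: ltW|move=> f mf].
  have E1 := integral_law P Y (normal_prob m s) f H mf.
  have E2 := integral_normal_affine m s f s0 mf.
  exact: (etrans E1 E2).
Qed.

(** The constant comes before the variable: one [K] controls the fourth moment of every Gaussian
    variable by the square of its second moment. The reason is (m + s x)^2 <= (m^2 + s^2) (1 + x^2),
    squared and integrated. *)
Lemma gaussian_moments : exists K : R, forall Y : T -> R, gaussian_variable P Y ->
  exists m s, [/\ measurable_fun setT Y,
    \int[P]_w Y w = m, \int[P]_w (Y w ^+ 2) = m ^+ 2 + s ^+ 2,
    mean_le P (fun w => Y w ^+ 4) (K * (\int[P]_w (Y w ^+ 2)) ^+ 2) &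
    forall b c, \int[P]_w cos (b * Y w + c) = expR (- (b * s) ^+ 2 / 2) * cos (b * m + c)].
Proof.
have [k Hk] := @normal_quartic_mean R.
exists (8 * k) => Y /gaussian_law [m [s [mY s0 H]]]; exists m, s.
have maff : measurable_fun setT (fun x : R => m + s * x).
  by apply: measurable_funD => //; exact: measurable_funM.
have HR (f : R -> R) : measurable_fun setT f ->
    \int[P]_w f (Y w) = \int[N01]_x f (m + s * x).
  move=> mf; have mEf : measurable_fun setT (EFin \o f) by exact/measurable_EFinP.
  by rewrite /Rintegral; congr fine; exact: (H _ mEf).
have i1 : N01.-integrable setT (EFin \o (fun x : R => s * x)).
  exact: (integrableZl measurableT s normal_integrable_id).
have im (r : R) : N01.-integrable setT (EFin \o (fun x : R => r)).
  exact: finite_measure_integrable_cst.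
have is2 : N01.-integrable setT (EFin \o (fun x : R => s ^+ 2 * x ^+ 2)).
  exact: (integrableZl measurableT (s ^+ 2) normal_integrable_sqr).
have c1 (r : R) : \int[N01]_x r = r.
  by rewrite /Rintegral (integral_probability_cst N01).
have E1 : \int[P]_w Y w = m.
  rewrite (HR (fun x => x))// RintegralD// c1 RintegralZl ?normal_mean ?mulr0 ?addr0//.
  exact: normal_integrable_id.
have E2 : \int[P]_w (Y w ^+ 2) = m ^+ 2 + s ^+ 2.
  rewrite (HR (fun x => x ^+ 2)); last exact: measurable_funX.
  have -> : (fun x : R => (m + s * x) ^+ 2) =
    (fun x => (m ^+ 2 + (2 * m) * (s * x)) + s ^+ 2 * x ^+ 2).
    by apply/funext => x; ring.
  rewrite RintegralD//; last first.
    have := integrableD measurableT (im (m ^+ 2)) (integrableZl measurableT (2 * m) i1).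
    by [].
  rewrite RintegralD//; last exact: (integrableZl measurableT (2 * m) i1).
  rewrite c1 RintegralZl// RintegralZl ?normal_mean ?mulr0 ?addr0//; last first.
    exact: normal_integrable_id.
  by rewrite RintegralZl ?normal_sqr ?mulr1//; exact: normal_integrable_sqr.
split=> //.
- split=> [|w|]; [exact: measurable_funX|by rewrite -[4%N]/(2 * 2)%N exprM sqr_ge0|].
  have mEf : measurable_fun setT (EFin \o (fun x : R => x ^+ 4)).
    by apply/measurable_EFinP; exact: measurable_funX.
  have E4 := H _ mEf; rewrite /= in E4.
  apply: (@le_trans _ _ (\int[N01]_x ((m + s * x) ^+ 4)%:E)%E).
    by rewrite E4.
  have kk : 0 <= 8 * (m ^+ 2 + s ^+ 2) ^+ 2 by rewrite mulr_ge0// sqr_ge0.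
  have [||_ _ G4] := mean_le_mono N01 (fun x => (m + s * x) ^+ 4) _ _ _ _
      (mean_leZ N01 _ _ _ kk Hk).
  + by apply: measurable_funX; exact: maff.
  + move=> x; apply/andP; split; first by rewrite -[4%N]/(2 * 2)%N exprM sqr_ge0.
    rewrite -[4%N]/(2 * 2)%N !exprM.
    have : (m + s * x) ^+ 2 <= (m ^+ 2 + s ^+ 2) * (1 + x ^+ 2).
      have := sqr_ge0 (m * x - s); nra.
    have := sqr_ge0 (m + s * x); set u := (m + s * x) ^+ 2.
    have : 0 <= m ^+ 2 + s ^+ 2 by rewrite addr_ge0// sqr_ge0.
    set v := m ^+ 2 + s ^+ 2 => v0 u0 uv.
    apply: (@le_trans _ _ ((v * (1 + x ^+ 2)) ^+ 2)).
      by rewrite ler_sqr ?nnegrE// (le_trans u0).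
    have -> : 8 * v ^+ 2 * (1 + x ^+ 2 ^+ 2) = v ^+ 2 * (8 * (1 + x ^+ 2 ^+ 2)) by ring.
    rewrite exprMn ler_wpM2l ?sqr_ge0//.
    have := sqr_ge0 x; set y := x ^+ 2 => y0; have := sqr_ge0 (y - 1); nra.
  + by rewrite E2 mulrAC.
- move=> b c; rewrite (HR (fun x => cos (b * x + c))); last first.
    apply: (@measurableT_comp _ _ _ _ _ _ cos).
      by apply: continuous_measurable_fun; exact: continuous_cos.
    by apply: measurable_funD => //; exact: measurable_funM.
  have -> : (fun x : R => cos (b * (m + s * x) + c)) = (fun x => cos ((b * s) * x + (b * m + c))).
    by apply/funext => x; congr cos; ring.
  exact: normal_cos.
Qed.

End gaussian_variable.

(** * Uniform continuity on squares, and expansiveness of the sine near 0 *)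

Section uniform_continuity.
Context {R : realType}.

(** Only the first point is confined to the square. The second may lie anywhere near it, which is
    convenient when it is the value of an unbounded random variable. *)
Lemma unif_continuous_square (psi : R * R -> R) (N e : R) :
  continuous psi -> 0 < e ->
  exists2 dl : R, 0 < dl & forall z s z' s' : R, `|z| <= N -> `|s| <= N ->
    `|z - z'| < dl -> `|s - s'| < dl -> `|psi (z, s) - psi (z', s')| <= e.
Proof.
move=> cpsi e0.
pose K : set (R * R) := `[-N, N] `*` `[-N, N].
have cK : compact K by apply: compact_setX; exact: segment_compact.
have /compact_near_coveringP ncK := cK.
have [] := ncK R (0^'+) (fun dl x => forall y, ball x dl y -> `|psi x - psi y| <= e) _.
- move=> x Kx.
  have /cvgrPdist_lt /(_ (e / 2)) := cpsi x; rewrite divr_gt0// => /(_ isT).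
  move=> /nbhs_ballP[r /= r0 H].
  exists (ball x (r / 2), [set dl : R | 0 < dl < r / 2]) => /=.
    split; first by apply: nbhsx_ballx; rewrite divr_gt0.
    near=> dl; apply/andP; split; [near: dl; exact: nbhs_right_gt|near: dl].
    by apply: nbhs_right_lt; rewrite divr_gt0.
  move=> [x' dl]/= [xx' /andP[dl0 dlr]] y x'y.
  rewrite (splitr e) -(subrKA (psi x)) (le_trans (ler_normD _ _))// lerD//.
  + rewrite distrC ltW//; apply: H; apply: le_ball xx'.
    by lra.
  + rewrite ltW//; apply: H; rewrite [r]splitr; apply: ball_triangle xx' _.
    by apply: le_ball x'y; exact: ltW.
- move=> r /= r0 H; exists (r / 2); first by rewrite divr_gt0.
  move=> z s z' s' zN sN zz' ss'; apply: (H (r / 2)) => //=.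
  + by rewrite sub0r normrN gtr0_norm ?divr_gt0//; lra.
  + by rewrite divr_gt0.
  + by split; rewrite /= in_itv/= -ler_norml.
Unshelve. all: by end_near. Qed.

(** By the mean value theorem the constant is the least value of the cosine on [-1, 1], namely cos
    1. *)
Lemma sin_expansive : exists2 k : R, 0 < k & forall x y : R, `|x| <= 1 -> `|y| <= 1 ->
  k * `|x - y| <= `|sin x - sin y|.
Proof.
exists (cos 1); first exact: cos1_gt0.
have H (x y : R) : -1 <= x -> x <= y -> y <= 1 -> cos 1 * `|y - x| <= `|sin y - sin x|.
  move=> x1 xy y1.
  have [c] := @MVT_segment R sin cos x y xy (fun z _ => is_derive_sin z)
    (continuous_subspaceT (@continuous_sin R)).
  rewrite in_itv/= => /andP[xc cy] ->; rewrite normrM ler_wpM2r//.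
  suff : cos 1 <= cos c by move=> /le_trans; apply; exact: ler_norm.
  have c1 : `|c| <= 1 by rewrite ler_norml (le_trans x1 xc) (le_trans cy y1).
  have -> : cos c = cos `|c| by case: (ger0P c) => _; rewrite ?cosN.
  have p1 : 1 <= (pi : R) by rewrite (le_trans _ (pi_ge2 R))// ler1n.
  rewrite leNgt ltr_cos ?in_itv/= ?normr_ge0 ?ler01 ?p1 ?(le_trans c1 p1)//.
  by rewrite -leNgt.
move=> x y; rewrite !ler_norml => /andP[x1 x2] /andP[y1 y2].
case: (leP x y) => xy.
  by rewrite distrC [leRHS]distrC; apply: H.
by apply: H => //; exact: ltW.
Qed.

End uniform_continuity.

(** * Bernstein approximation by trigonometric polynomials *)

Section bernstein.
Context {R : realType}.
Implicit Types (x : R) (f g : nat -> R).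

(* The expectation of f under the binomial law with parameters n and x. *)
Fixpoint bernstein n x f : R :=
  if n is m.+1 then x * bernstein m x (fun k => f k.+1) + (1 - x) * bernstein m x f
  else f 0%N.

Lemma bernstein_le n x f g : 0 <= x <= 1 -> (forall k, f k <= g k) ->
  bernstein n x f <= bernstein n x g.
Proof.
move=> /andP[x0 x1]; elim: n f g => [|n IH] f g fg /=; first exact: fg.
by apply: lerD; rewrite ler_wpM2l ?subr_ge0//; apply: IH => k; exact: fg.
Qed.

Lemma bernsteinD n x f g :
  bernstein n x (fun k => f k + g k) = bernstein n x f + bernstein n x g.
Proof. by elim: n f g => [|n IH] f g //=; rewrite !IH; ring. Qed.

Lemma bernsteinZ n x f (a : R) : bernstein n x (fun k => a * f k) = a * bernstein n x f.
Proof. by elim: n f => [|n IH] f //=; rewrite !IH; ring. Qed.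

Lemma bernstein_cst n x (a : R) : bernstein n x (fun=> a) = a.
Proof. by elim: n => [|n IH] //=; rewrite !IH; ring. Qed.

Lemma bernstein_ext n x f g : f =1 g -> bernstein n x f = bernstein n x g.
Proof. by move=> /funext ->. Qed.

(** Squared bias plus binomial variance. The centre [c] is arbitrary so that the induction applies
    to the shifted argument k + 1, which replaces [c] by c - 1. *)
Lemma bernstein_sqr n x (c : R) :
  bernstein n x (fun k => (k%:R - c) ^+ 2) = (n%:R * x - c) ^+ 2 + n%:R * (x * (1 - x)).
Proof.
elim: n c => [|n IH] c /=; first by ring.
rewrite IH (bernstein_ext _ _ _ (fun k => (k%:R - (c - 1)) ^+ 2)).
  by rewrite IH -natr1; ring.
by move=> k; rewrite -natr1; ring.
Qed.

Lemma bernstein_norm n x f : 0 <= x <= 1 ->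
  `|bernstein n x f| <= bernstein n x (fun k => `|f k|).
Proof.
move=> x01; rewrite ler_norml; apply/andP; split.
  rewrite -mulN1r -bernsteinZ; apply: bernstein_le => // k.
  by rewrite mulN1r lerNl -normrN ler_norm.
by apply: bernstein_le => // k; exact: ler_norm.
Qed.

Lemma bernstein_variance n x : 0 <= x <= 1 ->
  bernstein n.+1 x (fun k => (k%:R / n.+1%:R - x) ^+ 2) <= (n.+1%:R)^-1.
Proof.
move=> /andP[x0 x1].
rewrite (bernstein_ext _ _ _ (fun k => n.+1%:R ^- 2 * (k%:R - n.+1%:R * x) ^+ 2)).
  rewrite bernsteinZ bernstein_sqr subrr expr0n/= add0r.
  set m : R := n.+1%:R; have m0 : 0 < m by rewrite ltr0n.
  have -> : m ^- 2 * (m * (x * (1 - x))) = m^-1 * (x * (1 - x)) by field; rewrite gt_eqF.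
  by rewrite ler_piMr ?invr_ge0 ?ltW//; nra.
by move=> k; field; rewrite addrC natr1 pnatr_eq0.
Qed.

(** A chart of [-A, A] with values in [0, 1] on the whole line: a Bernstein polynomial in it is a
    trigonometric polynomial in z that keeps the bound of its coefficients everywhere. *)
Definition sine_coordinate (A z : R) : R := 1 / 2 + 1 / 2 * sin (z / A).

Lemma sine_coordinate01 (A z : R) : 0 <= sine_coordinate A z <= 1.
Proof.
have := sin_max (z / A); rewrite ler_norml /sine_coordinate => /andP[? ?].
by apply/andP; split; lra.
Qed.

(** Take for [t] a point of [-A, A] whose coordinate is nearest to y. The coordinates of [t] and z
    then differ by at most twice the distance from y to that of z, and the sine expands distances on
    [-1, 1]. *)
Lemma sine_coordinate_inv (A : R) : 0 < A -> exists k : R, 0 < k /\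
  forall y : R, exists2 t : R, `|t| <= A & forall z, `|z| <= A ->
    (t - z) ^+ 2 <= k * (y - sine_coordinate A z) ^+ 2.
Proof.
move=> A0; have [k k0 Hk] := @sin_expansive R.
exists ((4 * A / k) ^+ 2); split; first by rewrite exprn_gt0// divr_gt0// mulr_gt0.
move=> y.
have cf : continuous (fun z : R => `|y - sine_coordinate A z|).
  move=> z; apply: cvg_norm; apply: cvgB; first exact: cvg_cst.
  apply: cvgD; first exact: cvg_cst.
  apply: cvgMr; apply: continuous_comp; last exact: continuous_sin.
  by apply: cvgMl; exact: cvg_id.
have AA : - A <= A by rewrite lerNl (le_trans _ (ltW A0))// oppr_le0 ltW.
have [t tA Ht] := EVT_min AA (continuous_subspaceT cf).
move: tA; rewrite in_itv/= -ler_norml => tA; exists t => // z zA.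
have {}Ht : `|y - sine_coordinate A t| <= `|y - sine_coordinate A z|.
  by apply: Ht; rewrite in_itv/= -ler_norml.
have dA (x : R) : `|x| <= A -> `|x / A| <= 1.
  by move=> xA; rewrite normrM normfV (gtr0_norm A0) ler_pdivrMr// mul1r.
have := Hk _ _ (dA t tA) (dA z zA).
have -> : sin (t / A) - sin (z / A) =
    2 * ((y - sine_coordinate A z) - (y - sine_coordinate A t)).
  by rewrite /sine_coordinate; field.
rewrite -mulrBl !normrM normfV (gtr0_norm A0) (@ger0_norm _ 2)// => H.
have {}H : k * `|t - z| <= 4 * A * `|y - sine_coordinate A z|.
  have := ler_normB (y - sine_coordinate A z) (y - sine_coordinate A t).
  move: H; rewrite mulrA ler_pdivrMr// => H H2.
  apply: (le_trans H); move: Ht H2; set a := `|_|; set b := `|_|; set c := `|_|.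
  move=> Ht H2; have -> : 4 * A * b = 2 * (2 * b) * A by ring.
  by rewrite ler_pM2r// ler_pM2l//; move: a b c Ht H2 => a b c; lra.
rewrite -(real_normK (num_real (t - z))) -[in leRHS](real_normK (num_real (y - _))).
have q0 : 0 <= 4 * A / k by rewrite divr_ge0 ?mulr_ge0// ltW.
rewrite -exprMn ler_sqr ?nnegrE ?(mulr_ge0 q0)//.
have -> : 4 * A / k * `|y - sine_coordinate A z| = 4 * A * `|y - sine_coordinate A z| / k by ring.
by rewrite ler_pdivlMr// mulrC.
Qed.

(** Bernstein's proof of the Weierstrass theorem, in two sine coordinates. The approximation holds
    on the square only, but the bound [M] holds on the whole plane; this is what makes it usable
    under tightness. *)
Lemma bernstein_approx (psi : R -> R -> R) (M A e : R) :
  continuous (fun p : R * R => psi p.1 p.2) -> (forall z s, `|psi z s| <= M) ->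
  0 < A -> 0 < e ->
  exists n (v : nat -> nat -> R),
    let p z s := bernstein n (sine_coordinate A z)
      (fun j => bernstein n (sine_coordinate A s) (v j)) in
    (forall z s, `|p z s| <= M) /\
    (forall z s, `|z| <= A -> `|s| <= A -> `|psi z s - p z s| <= e).
Proof.
move=> cpsi Mpsi A0 e0.
have M0 : 0 <= M by apply: le_trans (Mpsi 0 0).
have e20 : 0 < e / 2 by rewrite divr_gt0.
have [dl dl0 Hdl] := unif_continuous_square _ A (e / 2) cpsi e20.
have [k [k0 /choice[th Hth]]] : exists k : R, 0 < k /\ forall y : R, exists t : R,
    `|t| <= A /\ forall z, `|z| <= A -> (t - z) ^+ 2 <= k * (y - sine_coordinate A z) ^+ 2.
  have [k [k0 H]] := sine_coordinate_inv A A0; exists k; split=> // y.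
  by have [t t1 t2] := H y; exists t.
(* Chebyshev's constant: where the sampled point is at distance at least [dl], the error 2 M is paid
   for by the squared deviation in the sine coordinate. *)
pose D := 2 * M / dl ^+ 2 * k.
have D0 : 0 <= D by rewrite !mulr_ge0// ?invr_ge0 ?sqr_ge0// ltW.
pose m := Num.bound (4 * D / e).
have Hm : 2 * D * m.+1%:R^-1 <= e / 2.
  rewrite ler_pdivrMr ?ltr0n//.
  have := archi_boundP (divr_ge0 (mulr_ge0 (ler0n R 4) D0) (ltW e0)).
  rewrite -/m ltr_pdivrMr// => H.
  have : m%:R <= m.+1%:R :> R by rewrite ler_nat.
  by move: (m%:R) H (m.+1%:R) => x H y xy; nra.
exists m.+1, (fun j k => psi (th (j%:R / m.+1%:R)) (th (k%:R / m.+1%:R))).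
split=> [z s|z s zA sA].
  apply: (le_trans (bernstein_norm _ _ _ (sine_coordinate01 _ _))).
  rewrite -[leRHS](bernstein_cst m.+1 (sine_coordinate A z)).
  apply: bernstein_le => [|j]; first exact: sine_coordinate01.
  apply: (le_trans (bernstein_norm _ _ _ (sine_coordinate01 _ _))).
  rewrite -[leRHS](bernstein_cst m.+1 (sine_coordinate A s)).
  by apply: bernstein_le => [|j']; first exact: sine_coordinate01.
set x := sine_coordinate A z; set y := sine_coordinate A s.
have x01 : 0 <= x <= 1 by exact: sine_coordinate01.
have y01 : 0 <= y <= 1 by exact: sine_coordinate01.
pose q j := (j%:R / m.+1%:R : R).
have ptw j l : `|psi (th (q j)) (th (q l)) - psi z s| <=
    e / 2 + (D * (q j - x) ^+ 2 + D * (q l - y) ^+ 2).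
  have [tj Hj] := Hth (q j); have [tl Hl] := Hth (q l).
  have Bj : 0 <= D * (q j - x) ^+ 2 by rewrite mulr_ge0// sqr_ge0.
  have Bl : 0 <= D * (q l - y) ^+ 2 by rewrite mulr_ge0// sqr_ge0.
  have far t r (w : R) : dl <= `|t - r| -> (t - r) ^+ 2 <= k * w -> 2 * M <= D * w.
    move=> tr Hw; have d2 : 0 < dl ^+ 2 by rewrite exprn_gt0.
    rewrite /D -mulrA -[leLHS]mulr1 -[X in _ <= X]mulrA ler_wpM2l ?mulr_ge0//.
    rewrite mulrC ler_pdivlMr// mul1r; apply: le_trans Hw.
    by rewrite -(real_normK (num_real (t - r))) ler_sqr ?nnegrE// ltW.
  have [H1|H1] := ltP `|th (q j) - z| dl; last first.
    have := far _ _ _ H1 (Hj z zA); rewrite -/x => H.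
    rewrite (le_trans (ler_normB _ _))//.
    by have := Mpsi (th (q j)) (th (q l)); have := Mpsi z s; lra.
  have [H2|H2] := ltP `|th (q l) - s| dl; last first.
    have := far _ _ _ H2 (Hl s sA); rewrite -/y => H.
    rewrite (le_trans (ler_normB _ _))//.
    by have := Mpsi (th (q j)) (th (q l)); have := Mpsi z s; lra.
  by rewrite (le_trans (Hdl _ _ z s tj tl H1 H2))//; lra.
have E : bernstein m.+1 x (fun j => bernstein m.+1 y (fun l => psi (th (q j)) (th (q l)))) - psi z s =
  bernstein m.+1 x (fun j => bernstein m.+1 y (fun l => psi (th (q j)) (th (q l)) - psi z s)).
  have -> : (fun j => bernstein m.+1 y (fun l => psi (th (q j)) (th (q l)) - psi z s)) =
    (fun j => bernstein m.+1 y (fun l => psi (th (q j)) (th (q l))) + - psi z s).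
    by apply/funext => j; rewrite bernsteinD bernstein_cst.
  by rewrite bernsteinD bernstein_cst.
rewrite distrC E (le_trans (bernstein_norm _ _ _ x01))//.
apply: (@le_trans _ _ (bernstein m.+1 x (fun j => e / 2 + (D * (q j - x) ^+ 2 + D * m.+1%:R^-1)))).
  apply: bernstein_le => // j; rewrite (le_trans (bernstein_norm _ _ _ y01))//.
  apply: (le_trans (bernstein_le _ _ _ _ y01 (fun l => ptw j l))).
  rewrite bernsteinD bernstein_cst lerD2l bernsteinD bernstein_cst lerD2l bernsteinZ.
  by rewrite ler_wpM2l// bernstein_variance.
rewrite bernsteinD bernstein_cst bernsteinD bernstein_cst bernsteinZ.
have V : bernstein m.+1 x (fun j => (q j - x) ^+ 2) <= m.+1%:R^-1.
  exact: bernstein_variance.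
have := ler_wpM2l D0 V; move: Hm; set u := D * bernstein _ _ _; set v := m.+1%:R^-1.
by rewrite -mulrA; lra.
Qed.

End bernstein.

(** * Distances between means, and tightness of one variable *)

Section rintegral_bounds.
Context {d} {T : measurableType d} {R : realType} (P : probability T R).

Lemma Rintegral_dist (X Y : T -> R) (kX kY c : R) :
  measurable_fun setT X -> measurable_fun setT Y ->
  (forall w, `|X w| <= kX) -> (forall w, `|Y w| <= kY) ->
  mean_le P (fun w => `|X w - Y w|) c ->
  `|\int[P]_w X w - \int[P]_w Y w| <= c.
Proof.
move=> mX mY bX bY H; rewrite -RintegralB//; last 2 first.
- exact: (bounded_integrable P X kX).
- exact: (bounded_integrable P Y kY).
by apply: mean_le_Rintegral => //; exact: measurable_funB.
Qed.

Lemma measurable_lt_norm (X : T -> R) (A : R) : measurable_fun setT X ->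
  measurable [set w | A < `|X w|].
Proof.
move=> mX; have -> : [set w | A < `|X w|] = (fun w => `|X w|) @^-1` `]A, +oo[.
  by apply/seteqP; split=> w /=; rewrite in_itv/= andbT.
by rewrite -[X in measurable X]setTI; apply: measurableT_comp.
Qed.

(** The sets |X| > n decrease to the empty set, and a finite measure is continuous from above. *)
Lemma tail_tight (X : T -> R) (e : R) : measurable_fun setT X -> 0 < e ->
  exists2 A : R, 0 < A & mean_le P (\1_[set w | A < `|X w|]) e.
Proof.
move=> mX e0; pose F n := [set w | n%:R < `|X w|].
have mF n : measurable (F n) by exact: measurable_lt_norm.
have Fcap : \bigcap_n F n = set0.
  rewrite -subset0 => w Fw.
  have := Fw (Num.bound `|X w|) I; rewrite /F/= => /lt_trans /(_ (archi_boundP (normr_ge0 _))).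
  by rewrite ltxx.
have := @nonincreasing_cvg_mu _ _ _ P F.
rewrite Fcap measure0 => /(_ _ mF measurable0) cv.
have {}cv : P (F n) @[n --> \oo] --> 0%E.
  apply: cv; first by rewrite (le_lt_trans (probability_le1 _ (mF _)))// ltry.
  move=> m n mn; apply/subsetPset => w; rewrite /F/=; apply: le_lt_trans.
  by rewrite ler_nat.
have [n _ Hn] : \forall n \near \oo, (P (F n) < e%:E)%E.
  have := cv [set x : \bar R | (x < e%:E)%E]; apply.
  by apply: open_ereal_lt'; rewrite lte_fin.
exists n.+1%:R => //; split=> [|w|]; [|by rewrite indicE|].
- by apply: measurable_indic; exact: mF.
- rewrite integral_indic// ?setIT; last exact: mF.
  apply: ltW; exact: (Hn n.+1 (leqW (leqnn n))).
Qed.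

End rintegral_bounds.

(** * From cosine test functions to convergence in distribution of a pair *)

Section joint_convergence.
Context {d d'} {T : measurableType d} {T' : measurableType d'} {R : realType}.
Context (P : probability T R) (P' : probability T' R).
Context (G : T -> R) (S : nat -> T -> R) (G' N : T' -> R).
Hypotheses (mG : measurable_fun setT G) (mS : forall n, measurable_fun setT (S n)).
Hypotheses (mG' : measurable_fun setT G') (mN : measurable_fun setT N).
Hypothesis trig_cvg : forall a b c : R,
  \int[P]_w cos (a * G w + b * S n w + c) @[n --> \oo] -->
  \int[P']_w cos (a * G' w + b * N w + c).

Let mean (F : R -> R -> R) n := \int[P]_w F (G w) (S n w).
Let mean' (F : R -> R -> R) := \int[P']_w F (G' w) (N w).
Let measurable2 (F : R -> R -> R) :=
  measurable_fun setT (fun p : R * R => F p.1 p.2).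

Let mcos : measurable_fun setT (@cos R).
Proof. by apply: continuous_measurable_fun; exact: continuous_cos. Qed.

Let measurable_GS F n : measurable2 F -> measurable_fun setT (fun w => F (G w) (S n w)).
Proof.
by move=> mF; have := measurableT_comp mF (measurable_fun_pair mG (mS n)).
Qed.

Let measurable_GN F : measurable2 F -> measurable_fun setT (fun w => F (G' w) (N w)).
Proof.
by move=> mF; have := measurableT_comp mF (measurable_fun_pair mG' mN).
Qed.

Let wave (a b c : R) : R -> R -> R := fun z s => cos (a * z + b * s + c).

Let measurable_wave a b c : measurable2 (wave a b c).
Proof.
apply: measurableT_comp => //; apply: measurable_funD => //.
by apply: measurable_funD; apply: measurable_funM => //.
Qed.

(** Convergence is required after multiplication by every wave. In this form the class is stable
    under multiplication by waves, hence contains all trigonometric polynomials. *)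
Let good (F : R -> R -> R) : Prop :=
  [/\ exists M, forall z s, `|F z s| <= M, measurable2 F &
      forall a b c, mean (fun z s => wave a b c z s * F z s) n @[n --> \oo] -->
                    mean' (fun z s => wave a b c z s * F z s)].

Let goodbound F : good F -> exists2 M, 0 <= M & forall z s, `|F z s| <= M.
Proof. by move=> [[M HM] _ _]; exists M => //; apply: le_trans (HM 0 0). Qed.

Let bmeas (F : R -> R -> R) := (exists M, forall z s, `|F z s| <= M) /\ measurable2 F.

Let mean_lin F1 F2 r1 r2 n : bmeas F1 -> bmeas F2 ->
  mean (fun z s => r1 * F1 z s + r2 * F2 z s) n = r1 * mean F1 n + r2 * mean F2 n.
Proof.
move=> [[M1 H1] m1] [[M2 H2] m2].
have i1 := bounded_integrable P _ M1 (measurable_GS _ n m1) (fun w => H1 (G w) (S n w)).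
have i2 := bounded_integrable P _ M2 (measurable_GS _ n m2) (fun w => H2 (G w) (S n w)).
rewrite /mean -!RintegralZl// -RintegralD//.
- exact: (integrableZl measurableT r1 i1).
- exact: (integrableZl measurableT r2 i2).
Qed.

Let mean'_lin F1 F2 r1 r2 : bmeas F1 -> bmeas F2 ->
  mean' (fun z s => r1 * F1 z s + r2 * F2 z s) = r1 * mean' F1 + r2 * mean' F2.
Proof.
move=> [[M1 H1] m1] [[M2 H2] m2].
have i1 := bounded_integrable P' _ M1 (measurable_GN _ m1) (fun w => H1 (G' w) (N w)).
have i2 := bounded_integrable P' _ M2 (measurable_GN _ m2) (fun w => H2 (G' w) (N w)).
rewrite /mean' -!RintegralZl// -RintegralD//.
- exact: (integrableZl measurableT r1 i1).
- exact: (integrableZl measurableT r2 i2).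
Qed.

Let mean_cvg_lin F F1 F2 r1 r2 : bmeas F1 -> bmeas F2 ->
  (forall z s, F z s = r1 * F1 z s + r2 * F2 z s) ->
  mean F1 n @[n --> \oo] --> mean' F1 -> mean F2 n @[n --> \oo] --> mean' F2 ->
  mean F n @[n --> \oo] --> mean' F.
Proof.
move=> b1 b2 FE c1 c2.
have -> : F = (fun z s => r1 * F1 z s + r2 * F2 z s).
  by apply/funext => z; apply/funext => s.
rewrite mean'_lin//; under eq_fun do rewrite mean_lin//.
by apply: cvgD; apply: cvgMr.
Qed.

Let wave_bmeas a b c F : good F -> bmeas (fun z s => wave a b c z s * F z s).
Proof.
move=> [[M HM] mF _]; split.
  exists M => z s.
  by rewrite normrM (le_trans _ (HM z s))// ler_piMl//; exact: cos_max.
by apply: measurable_funM => //; exact: measurable_wave.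
Qed.

Let good_lin F1 F2 r1 r2 : good F1 -> good F2 ->
  good (fun z s => r1 * F1 z s + r2 * F2 z s).
Proof.
move=> g1 g2; have [M1 M10 HM1] := goodbound F1 g1.
have [M2 M20 HM2] := goodbound F2 g2.
split=> [||a b c].
- exists (`|r1| * M1 + `|r2| * M2) => z s.
  by rewrite (le_trans (ler_normD _ _))// !normrM lerD// ler_wpM2l.
- by case: g1 => _ mF1 _; case: g2 => _ mF2 _;
    apply: measurable_funD; apply: measurable_funM.
apply: (mean_cvg_lin _ _ _ r1 r2 (wave_bmeas a b c F1 g1) (wave_bmeas a b c F2 g2)).
- by move=> z s; ring.
- by case: g1.
- by case: g2.
Qed.

Let good_ext F1 F2 : (forall z s, F1 z s = F2 z s) -> good F1 -> good F2.
Proof.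
move=> E; suff -> : F1 = F2 by [].
by apply/funext => z; apply/funext => s.
Qed.

(** A product of two cosines is half the sum of two cosines. *)
Let good_wave al be ga F : good F -> good (fun z s => wave al be ga z s * F z s).
Proof.
move=> gF; have [M M0 HM] := goodbound F gF.
case: (gF) => _ mF cF; split=> [||a b c].
- by exists M => z s; rewrite normrM (le_trans _ (HM z s))// ler_piMl// cos_max.
- by apply: measurable_funM => //; exact: measurable_wave.
apply: (mean_cvg_lin _ _ _ (1 / 2) (1 / 2)
  (wave_bmeas (a + al) (b + be) (c + ga) F gF)
  (wave_bmeas (a - al) (b - be) (c - ga) F gF)) => //.
move=> z s; rewrite /wave.
have -> : (a + al) * z + (b + be) * s + (c + ga) =
  (a * z + b * s + c) + (al * z + be * s + ga) by ring.
have -> : (a - al) * z + (b - be) * s + (c - ga) =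
  (a * z + b * s + c) - (al * z + be * s + ga) by ring.
move: (a * z + b * s + c) (al * z + be * s + ga) => A B.
by rewrite cosD cosB; field.
Qed.

Let good_phase al be ga F : good F ->
  good (fun z s => (1 / 2 + 1 / 2 * wave al be ga z s) * F z s).
Proof.
move=> gF; apply: (good_ext _ _ _ (good_lin F _ (1 / 2) (1 / 2) gF (good_wave al be ga F gF))).
by move=> z s; ring.
Qed.

(** The coefficients may be functions from the class, so the lemma can be applied twice, once for
    each coordinate. *)
Let good_bernstein n al be ga (F : nat -> R -> R -> R) : (forall k, good (F k)) ->
  good (fun z s => bernstein n (1 / 2 + 1 / 2 * wave al be ga z s) (fun k => F k z s)).
Proof.
elim: n F => [|n IH] F gF /=; first exact: gF.
have g1 := good_phase al be ga _ (IH (fun k => F k.+1) (fun k => gF k.+1)).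
have g2 := good_phase al be ga _ (IH F gF).
apply: (good_ext _ _ _ (good_lin _ _ 1 1 g1 (good_lin _ _ 1 (-1) (IH F gF) g2))).
by move=> z s; ring.
Qed.

Let good_cst k : good (fun _ _ => k).
Proof.
split=> [||a b c]; first by exists `|k|.
- exact: measurable_cst.
have bW : bmeas (wave a b c).
  by split; [exists 1 => z s; exact: cos_max|exact: measurable_wave].
apply: (mean_cvg_lin _ _ _ k 0 bW bW); [|exact: trig_cvg|exact: trig_cvg].
by move=> z s; ring.
Qed.

Let good_cvg F : good F -> mean F n @[n --> \oo] --> mean' F.
Proof.
move=> [_ _ /(_ 0 0 0)]; rewrite /wave /mean /mean'.
have E z s : cos (0 * z + 0 * s + 0) * F z s = F z s.
  by rewrite !mul0r !addr0 cos0 mul1r.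
by under eq_fun do under eq_Rintegral do rewrite E; under eq_Rintegral do rewrite E.
Qed.

Let good_poly n A (v : nat -> nat -> R) :
  good (fun z s => bernstein n (sine_coordinate A z)
    (fun j => bernstein n (sine_coordinate A s) (v j))).
Proof.
have sE (x : R) : sin x = cos (x + - (pi / 2)).
  by rewrite cosB cos_pihalf sin_pihalf; ring.
have gv j : good (fun z s => bernstein n (1 / 2 + 1 / 2 * wave 0 (1 / A) (- (pi / 2)) z s) (v j)).
  by apply: (good_bernstein n 0 (1 / A) _ (fun k _ _ => v j k)) => k; exact: good_cst.
apply: (good_ext _ _ _ (good_bernstein n (1 / A) 0 (- (pi / 2)) _ gv)) => z s.
rewrite /wave /sine_coordinate !sE !mul0r add0r addr0 !div1r.
by rewrite ![_ / A]mulrC.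
Qed.

(** On a large square [psi] is uniformly close to a trigonometric polynomial, for which the means
    converge; off the square both are bounded by [M] and tightness makes the contribution small. *)
Lemma cvg_joint (psi : R -> R -> R) (M : R) :
  continuous (fun p : R * R => psi p.1 p.2) ->
  measurable_fun setT (fun p : R * R => psi p.1 p.2) ->
  (forall z s, `|psi z s| <= M) ->
  (forall e : R, 0 < e -> exists2 A : R, 0 < A & forall n,
    mean_le P (\1_[set w | A < `|S n w|]) e) ->
  \int[P]_w psi (G w) (S n w) @[n --> \oo] --> \int[P']_w psi (G' w) (N w).
Proof.
move=> cpsi mpsi bpsi tightS.
have M0 : 0 <= M by apply: le_trans (bpsi 0 0).
apply/cvgrPdist_le => eps eps0.
pose e := eps / (4 + 8 * M).
have M8 : 0 < 4 + 8 * M by lra.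
have e0 : 0 < e by rewrite divr_gt0.
have [A1 A10 HA1] := tightS e e0.
have [A2 A20 HA2] := tail_tight P G e mG e0.
have [A3 A30 HA3] := tail_tight P' G' e mG' e0.
have [A4 A40 HA4] := tail_tight P' N e mN e0.
(* One square that contains, up to probability [e], each of the four variables involved. *)
pose A := A1 + A2 + A3 + A4.
have A0 : 0 < A by rewrite /A; lra.
have [m [v [pM0 pA0]]] := bernstein_approx psi M A e cpsi bpsi A0 e0.
pose p z s := bernstein m (sine_coordinate A z)
  (fun j => bernstein m (sine_coordinate A s) (v j)).
have pM z s : `|p z s| <= M by exact: pM0.
have pA z s : `|z| <= A -> `|s| <= A -> `|psi z s - p z s| <= e by exact: pA0.
have gp : good p by exact: good_poly.
have mp : measurable2 p by case: gp.
have key (Om : Type) (u1 u2 : Om -> R) a1 a2 : a1 <= A -> a2 <= A -> forall w,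
    0 <= `|psi (u1 w) (u2 w) - p (u1 w) (u2 w)| <=
    e + 2 * M * (\1_[set w | a1 < `|u1 w|] w + \1_[set w | a2 < `|u2 w|] w).
  move=> a1A a2A w; rewrite normr_ge0 /= !indicE.
  have far : `|psi (u1 w) (u2 w) - p (u1 w) (u2 w)| <= 2 * M.
    rewrite (le_trans (ler_normB _ _))//.
    by have := bpsi (u1 w) (u2 w); have := pM (u1 w) (u2 w); lra.
  have [|H1] := boolP (w \in [set w | a1 < `|u1 w|]).
    by case: (w \in [set w | a2 < `|u2 w|]) => _ /=; lra.
  have [_|H2] := boolP (w \in [set w | a2 < `|u2 w|]) => /=; first by lra.
  rewrite addr0 mulr0 addr0; apply: pA.
    by move: H1; rewrite notin_setE/= => /negP; rewrite -leNgt => /le_trans; apply.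
  by move: H2; rewrite notin_setE/= => /negP; rewrite -leNgt => /le_trans; apply.
have B1 n : `|mean psi n - mean p n| <= e + 2 * M * (e + e).
  apply: (Rintegral_dist P _ _ M M); [exact: measurable_GS|exact: measurable_GS| | |].
  - by move=> w; exact: bpsi.
  - by move=> w; exact: pM.
  apply: (mean_le_mono P _ _ _ _ (key T G (S n) A2 A1 _ _)).
  - by apply: measurableT_comp => //; apply: measurable_funB; exact: measurable_GS.
  - by rewrite /A; lra.
  - by rewrite /A; lra.
  apply: mean_leD; first by apply: mean_le_cst; exact: ltW.
  by apply: mean_leZ; [rewrite mulr_ge0|exact: mean_leD].
have B2 : `|mean' psi - mean' p| <= e + 2 * M * (e + e).
  apply: (Rintegral_dist P' _ _ M M); [exact: measurable_GN|exact: measurable_GN| | |].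
  - by move=> w; exact: bpsi.
  - by move=> w; exact: pM.
  apply: (mean_le_mono P' _ _ _ _ (key T' G' N A3 A4 _ _)).
  - by apply: measurableT_comp => //; apply: measurable_funB; exact: measurable_GN.
  - by rewrite /A; lra.
  - by rewrite /A; lra.
  apply: mean_leD; first by apply: mean_le_cst; exact: ltW.
  by apply: mean_leZ; [rewrite mulr_ge0|exact: mean_leD].
apply: filterS ((cvgrPdist_le _ _).1 (good_cvg p gp) e e0) => n B3.
have Ee : e * (4 + 8 * M) = eps by rewrite /e divfK// gt_eqF.
rewrite -/(mean' psi) -/(mean psi n).
have -> : mean' psi - mean psi n =
  (mean' psi - mean' p) + (mean' p - mean p n) - (mean psi n - mean p n) by ring.
rewrite (le_trans (ler_normB _ _))// (le_trans (lerD (ler_normD _ _) (lexx _)))//.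
by have := B1 n; move: B2 B3; rewrite -Ee; lra.
Qed.

(** A Slutsky argument: where [G] and [S n] are bounded, [k (G w) * S n w] lies in a compact set,
    near which [phi] is uniformly continuous, and mean closeness is needed only on |G| <= A because
    [G] is tight. The limit of [k (G w) * S n w] itself comes from [cvg_joint]. *)
Lemma cvg_mixture (Y : nat -> T -> R) (k phi : R -> R) (M : R) :
  (forall n, measurable_fun setT (Y n)) ->
  continuous k -> continuous phi -> (forall x, `|phi x| <= M) ->
  (forall e : R, 0 < e -> exists2 A : R, 0 < A & forall n,
    mean_le P (\1_[set w | A < `|S n w|]) e) ->
  (forall A e : R, 0 < A -> 0 < e -> \forall n \near \oo,
    mean_le P (fun w => \1_[set w | `|G w| <= A] w * `|Y n w - k (G w) * S n w|) e) ->
  \int[P]_w phi (Y n w) @[n --> \oo] --> \int[P']_w phi (k (G' w) * N w).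
Proof.
move=> mY ck cphi bphi tightS close.
have M0 : 0 <= M by apply: le_trans (bphi 0).
have mphi : measurable_fun setT phi by exact: continuous_measurable_fun.
have mk : measurable_fun setT k by exact: continuous_measurable_fun.
have c2 : continuous (fun p : R * R => phi (k p.1 * p.2)).
  move=> p; apply: (@continuous_comp _ _ _ (fun p : R * R => k p.1 * p.2) phi); last exact: cphi.
  apply: cvgM; last exact: cvg_snd.
  by apply: (@continuous_comp _ _ _ fst k); [exact: cvg_fst|exact: ck].
have m2 : measurable_fun setT (fun p : R * R => phi (k p.1 * p.2)).
  apply: (measurableT_comp mphi); apply: measurable_funM => //.
  exact: (measurableT_comp mk).
have C := cvg_joint (fun z s => phi (k z * s)) M c2 m2 (fun z s => bphi _) tightS.
apply/cvgrPdist_le => eps eps0.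
pose e := eps / (3 + 4 * M).
have M8 : 0 < 3 + 4 * M by lra.
have e0 : 0 < e by rewrite divr_gt0.
have Ee : e * (3 + 4 * M) = eps by rewrite /e divfK// gt_eqF.
have [A1 A10 HA1] := tightS e e0.
have [A2 A20 HA2] := tail_tight P G e mG e0.
pose A := A1 + A2; have A0 : 0 < A by rewrite /A addr_gt0.
have [B HB] : exists B, forall z, `|z| <= A -> `|k z| <= B.
  have AA : - A <= A by rewrite lerNl (le_trans _ (ltW A0))// oppr_le0 ltW.
  have ck' : {within `[- A, A], continuous (fun z => `|k z|)}.
    by apply: continuous_subspaceT => z; apply: cvg_norm; exact: ck.
  have [t tA Ht] := EVT_max AA ck'; exists `|k t| => z zA.
  by apply: Ht; rewrite in_itv/= -ler_norml.
have cphi2 : continuous (fun p : R * R => phi p.1).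
  by move=> p; apply: (@continuous_comp _ _ _ fst phi); [exact: cvg_fst|exact: cphi].
have [dl dl0 Hdl] := unif_continuous_square _ (B * A) e cphi2 e0.
(* By Markov's inequality the event that [Y n] is at distance at least [dl] costs 2 M / dl times
   this amount, which is at most [e]. *)
have ee0 : 0 < e * dl / (2 * M + 1).
  by apply: divr_gt0; [exact: mulr_gt0|lra].
have mind : measurable [set w | `|G w| <= A].
  have -> : [set w | `|G w| <= A] = ~` [set w | A < `|G w|].
    by apply/seteqP; split=> w /=; rewrite leNgt => /negP.
  by apply: measurableC; exact: measurable_lt_norm.
apply: filterS2 ((cvgrPdist_le _ _).1 C e e0) (close A _ A0 ee0) => n B3 Hn.
have mX : measurable_fun setT (fun w => k (G w) * S n w).
  by apply: measurable_funM => //; exact: (measurableT_comp mk).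
suff B1 : `|\int[P]_w phi (Y n w) - \int[P]_w phi (k (G w) * S n w)| <=
    e + (2 * M * (e + e) + (2 * M) / dl * (e * dl / (2 * M + 1))).
  have q : (2 * M) / dl * (e * dl / (2 * M + 1)) <= e.
    have -> : (2 * M) / dl * (e * dl / (2 * M + 1)) = e * (2 * M) / (2 * M + 1).
      by field; apply/andP; split; rewrite gt_eqF//; lra.
    by rewrite ler_pdivrMr; lra.
  rewrite -(subrKA (\int[P]_w phi (k (G w) * S n w))) (le_trans (ler_normD _ _))//.
  by move: B1 B3; rewrite -Ee [X in _ + X <= _]distrC; lra.
apply: (Rintegral_dist P _ _ M M).
- exact: (measurableT_comp mphi).
- exact: (measurableT_comp mphi).
- by move=> w; exact: bphi.
- by move=> w; exact: bphi.
apply: (mean_le_mono P _ (fun w => e + (2 * M * (\1_[set w | A2 < `|G w|] w +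
    \1_[set w | A1 < `|S n w|] w) +
   2 * M / dl * (\1_[set w | `|G w| <= A] w * `|Y n w - k (G w) * S n w|)))).
- by apply: measurableT_comp => //; apply: measurable_funB; exact: (measurableT_comp mphi).
- move=> w; rewrite normr_ge0 /=.
  have far : `|phi (Y n w) - phi (k (G w) * S n w)| <= 2 * M.
    rewrite (le_trans (ler_normB _ _))//.
    by have := bphi (Y n w); have := bphi (k (G w) * S n w); lra.
  set D := `|Y n w - _|; have D0 : 0 <= D by exact: normr_ge0.
  have D1 : 0 <= 2 * M / dl * (\1_[set w | `|G w| <= A] w * D).
    by rewrite !mulr_ge0// ?invr_ge0 ?ltW// indicE.
  move: D1; rewrite !indicE.
  have [_|H1] := boolP (w \in [set w | A2 < `|G w|]).
    by case: (w \in [set w | A1 < `|S n w|]) => /=; lra.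
  have [_|H2] := boolP (w \in [set w | A1 < `|S n w|]) => /=; first by lra.
  move: H1 H2; rewrite !notin_setE/= => /negP; rewrite -leNgt => H1 /negP.
  rewrite -leNgt => H2.
  have GA : `|G w| <= A by rewrite (le_trans H1)// /A lerDr ltW.
  have SA : `|S n w| <= A by rewrite (le_trans H2)// /A lerDl ltW.
  rewrite mem_set//= !mul1r addr0 mulr0 add0r => D1.
  have [Dd|Dd] := ltP D dl.
    rewrite (@le_trans _ _ e)//; last by lra.
    rewrite distrC; apply: (Hdl (k (G w) * S n w) 0 (Y n w) 0).
    - by rewrite normrM ler_pM//; exact: HB.
    - rewrite normr0; have := HB _ GA; have := normr_ge0 (k (G w)) => h1 h2.
      by apply: mulr_ge0; [exact: le_trans h1 h2|exact: ltW].
    - by rewrite distrC.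
    - by rewrite subrr normr0.
  apply: (le_trans far).
  have : 2 * M <= 2 * M / dl * D.
    by rewrite mulrAC ler_pdivlMr// ler_wpM2l// mulr_ge0.
  by lra.
apply: mean_leD; first by apply: mean_le_cst; exact: ltW.
apply: mean_leD; apply: mean_leZ => //.
- by rewrite mulr_ge0.
- by apply: mean_leD.
- by rewrite mulr_ge0 ?mulr_ge0// invr_ge0 ltW.
Qed.

End joint_convergence.

(** * Fubini estimates *)

Section product_integrals.
Context {d1 d2} {T1 : measurableType d1} {T2 : measurableType d2} {R : realType}.
Context (m1 : {sigma_finite_measure set T1 -> \bar R}).
Context (m2 : {sigma_finite_measure set T2 -> \bar R}).

Lemma mean_le_section_integrable (Phi : T1 -> T2 -> R) (b : T1 -> R) (c : R) :
  measurable_fun setT (fun p : T1 * T2 => Phi p.1 p.2) ->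
  (forall x, mean_le m2 (fun y => `|Phi x y|) (b x)) -> mean_le m1 b c ->
  (m1 \x m2)%E.-integrable setT (fun p => (Phi p.1 p.2)%:E).
Proof.
move=> mPhi HP [mb b0 Hb].
have mE : measurable_fun setT (fun p : T1 * T2 => (Phi p.1 p.2)%:E).
  exact/measurable_EFinP.
apply/(integrable12ltyP _ _ mE).
apply: (@le_lt_trans _ _ c%:E); last exact: ltry.
apply: (le_trans _ Hb); apply: ge0_le_integral => //.
- by move=> x _; exact: integral_ge0.
- have := @measurable_fun_fubini_tonelli_F _ _ T1 T2 R m2 (fun p => `|(Phi p.1 p.2)%:E|%E).
  by apply=> //; apply: measurableT_comp.
- exact/measurable_EFinP.
- by move=> x _; case: (HP x).
Qed.

(** The triangle inequality for integrals followed by Tonelli. It turns bounds in mean at each fixed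
    point of the first space (a kernel variable or a time) into a bound in mean on the integrated
    random variable. *)
Lemma mean_le_section (Phi : T1 -> T2 -> R) (b : T1 -> R) (c : R) :
  measurable_fun setT (fun p : T1 * T2 => Phi p.1 p.2) ->
  (forall x, mean_le m2 (fun y => `|Phi x y|) (b x)) -> mean_le m1 b c ->
  [/\ measurable_fun setT (fun y => \int[m1]_x Phi x y),
      {ae m2, forall y, m1.-integrable setT (fun x => (Phi x y)%:E)} &
      mean_le m2 (fun y => `|\int[m1]_x Phi x y|) c].
Proof.
move=> mPhi HP Hb.
have iPhi := mean_le_section_integrable Phi b c mPhi HP Hb.
have mG : measurable_fun setT (fun y => \int[m1]_x Phi x y).
  exact: (measurableT_comp (@fine_measurable R setT measurableT) (measurable_fubini_G iPhi)).
have aeI := ae_integrable2 iPhi.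
split=> //; split=> //; first exact: measurableT_comp.
have mAbs : measurable_fun setT (fun p : T1 * T2 => `|(Phi p.1 p.2)%:E|%E).
  by apply: measurableT_comp => //; exact/measurable_EFinP.
have mT := @measurable_fun_fubini_tonelli_G _ _ T1 T2 R m1 _ mAbs (fun p => abse_ge0 _).
apply: (@le_trans _ _ (\int[m2]_y \int[m1]_x `|(Phi x y)%:E|)%E).
  apply: ae_ge0_le_integral => //.
  - by apply/measurable_EFinP; exact: measurableT_comp.
  - by move=> y _; exact: integral_ge0.
  apply: filterS aeI => y iy _.
  by rewrite EFin_normr_Rintegral//; apply: le_abse_integral => //; case/integrableP: iy.
rewrite -(fubini_tonelli (fun p => `|(Phi p.1 p.2)%:E|%E) mAbs)//.
case: Hb => mb b0 Hb; apply: (le_trans _ Hb); apply: ge0_le_integral => //.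
- by move=> x _; exact: integral_ge0.
- exact: (@measurable_fun_fubini_tonelli_F _ _ T1 T2 R m2 _ mAbs (fun p => abse_ge0 _)).
- exact/measurable_EFinP.
- by move=> x _; case: (HP x).
Qed.

Lemma integrable_tensor (f : T1 -> R) (g : T2 -> R) :
  m1.-integrable setT (EFin \o f) -> m2.-integrable setT (EFin \o g) ->
  (m1 \x m2)%E.-integrable setT (fun p => (f p.1 * g p.2)%:E) /\
  \int[(m1 \x m2)%E]_p (f p.1 * g p.2) = (\int[m1]_x f x) * (\int[m2]_y g y).
Proof.
move=> if_ ig.
have mf : measurable_fun setT f by case/integrableP: if_ => /measurable_EFinP.
have mg : measurable_fun setT g by case/integrableP: ig => /measurable_EFinP.
have mfg : measurable_fun setT (fun p : T1 * T2 => f p.1 * g p.2).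
  by apply: measurable_funM; [exact: (measurableT_comp mf)|exact: (measurableT_comp mg)].
have ifn := integrable_norm if_; have ign := integrable_norm ig.
have bf := integrable_mean_le m1 (fun x => `|f x|) ifn (fun x => normr_ge0 _).
have bg := integrable_mean_le m2 (fun x => `|g x|) ign (fun x => normr_ge0 _).
have bfg := mean_leZ m1 _ _ (\int[m2]_y `|g y|) (mean_le_ge0 m2 _ _ bg) bf.
have ifg : (m1 \x m2)%E.-integrable setT (fun p => (f p.1 * g p.2)%:E).
  apply: (mean_le_section_integrable (fun x y => f x * g y) _ _ mfg _ bfg) => x.
  have := mean_leZ m2 _ _ `|f x| (normr_ge0 _) bg.
  by rewrite mulrC; under eq_fun do rewrite -normrM.
split=> //; rewrite {1}/Rintegral -(integral12_prod_meas1 ifg).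
have E x : fubini_F m2 (fun p => (f p.1 * g p.2)%:E) x = (f x * \int[m2]_y g y)%:E.
  rewrite /fubini_F /=; under eq_integral do rewrite EFinM.
  rewrite integralZl// EFinM /Rintegral fineK//.
  by have := integrable_fin_num measurableT ig.
under eq_integral do rewrite E.
by rewrite -/(Rintegral m1 setT (fun x => f x * \int[m2]_y g y)) RintegralZr.
Qed.

End product_integrals.

(** * An envelope for powers at nearby points *)

Section weight.
Context {R : realType} (gamma : R).
Hypothesis gamma0 : 0 < gamma.

(** This dominates |y|^gamma, |y|^(gamma/2) and, for gamma >= 1, |y| at every y with |y| <= |x| + 1,
    in particular at the left node of a cell of length at most 1 containing x. Against an admissible
    kernel it is integrable. *)
Definition weight (x : R) : R := 2 `^ gamma * (1 + `|x| `^ gamma).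

Lemma weight_ge1 x : 1 <= weight x.
Proof.
rewrite /weight mulr_ege1//; last by rewrite lerDl powR_ge0.
have : (2 : R) `^ 0 <= 2 `^ gamma by apply: ler_powR; [lra|exact: ltW].
by rewrite powRr0.
Qed.

Lemma weight_ge0 x : 0 <= weight x.
Proof. exact: le_trans (weight_ge1 x). Qed.

Lemma powR_shift_le_weight (x y : R) : `|y| <= `|x| + 1 -> `|y| `^ gamma <= weight x.
Proof.
move=> yx; have [x1|x1] := leP `|x| 1.
  apply: (@le_trans _ _ (2 `^ gamma)).
    by apply: ge0_ler_powR; rewrite ?nnegrE//; [exact: ltW|move: yx x1; move: `|x| `|y| => u v; lra].
  by rewrite /weight ler_peMr ?powR_ge0// lerDl powR_ge0.
apply: (@le_trans _ _ ((2 * `|x|) `^ gamma)).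
  by apply: ge0_ler_powR; rewrite ?nnegrE ?mulr_ge0//; [exact: ltW|move: yx x1; move: `|x| `|y| => u v; lra].
by rewrite powRM// /weight ler_wpM2l ?powR_ge0// lerDr.
Qed.

Lemma powR_half_shift_le_weight (x y : R) : `|y| <= `|x| + 1 ->
  `|y| `^ (gamma / 2) <= weight x.
Proof.
move=> yx; have [y1|y1] := leP 1 `|y|.
  apply: le_trans (powR_shift_le_weight x y yx).
  by apply: ler_powR => //; rewrite ler_pdivrMr// ler_pMr// ler1n.
apply: le_trans (weight_ge1 x).
apply: (@le_trans _ _ (1 `^ (gamma / 2))); last by rewrite powR1.
by apply: ge0_ler_powR; rewrite ?nnegrE//; [apply: divr_ge0 => //|]; exact: ltW.
Qed.

Lemma norm_shift_le_weight (x y : R) : 1 <= gamma -> `|y| <= `|x| + 1 -> `|y| <= weight x.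
Proof.
move=> g1 yx; have [y1|y1] := leP 1 `|y|.
  apply: le_trans (powR_shift_le_weight x y yx).
  by rewrite -[leLHS]powRr1// ler_powR.
by apply: le_trans (weight_ge1 x); exact: ltW.
Qed.

Lemma measurable_weight : measurable_fun setT weight.
Proof.
apply: measurable_funM => //; apply: measurable_funD => //.
apply: (measurableT_comp (measurable_powR gamma)); exact: (@normr_measurable R setT).
Qed.

End weight.

(** * Division of the kernel axis into cells *)

Section cells.
Context {R : realType} (rho : R) (M : nat).
Hypotheses (rho0 : 0 < rho) (M0 : (0 < M)%N).
Notation mu := (@lebesgue_measure R).

(** The origin is the node of index [M], so the time [tau] will itself be a grid time. *)
Definition node (i : nat) : R := - rho + i%:R * (rho / M%:R).
Definition cell (i : nat) : set R := `[node i, node i.+1[%classic.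

Let step0 : 0 < rho / M%:R.
Proof. by rewrite divr_gt0// ltr0n. Qed.

Lemma cellP i x : cell i x <-> node i <= x < node i + rho / M%:R.
Proof.
by rewrite /cell /= in_itv/= /node -natr1 mulrDl mul1r addrA.
Qed.

Lemma measurable_cell i : measurable (cell i).
Proof. exact: measurable_itv. Qed.

Lemma node_le i j : (i <= j)%N -> node i <= node j.
Proof. by move=> ij; rewrite lerD2l ler_wpM2r ?ler_nat// ltW. Qed.

Lemma node_mid : node M = 0.
Proof. by rewrite /node mulrCA divff ?mulr1 ?addNr// pnatr_eq0 -lt0n. Qed.

Lemma node_norm i : (i <= 2 * M)%N -> `|node i| <= rho.
Proof.
move=> iM; rewrite ler_norml /node; apply/andP; split.
  by rewrite lerDl mulr_ge0// ltW.
have H : i%:R * (rho / M%:R) <= (2 * M)%:R * (rho / M%:R).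
  by rewrite ler_wpM2r ?ler_nat// ltW.
have E : (2 * M)%:R * (rho / M%:R) = 2 * rho.
  by rewrite natrM; field; rewrite pnatr_eq0 -lt0n.
by move: H; rewrite E; lra.
Qed.

Lemma cell_norm i x : cell i x -> rho / M%:R <= 1 -> `|node i| <= `|x| + 1.
Proof.
move=> /cellP /andP[ix xi] m1.
have -> : node i = x - (x - node i) by ring.
rewrite (le_trans (ler_normB _ _))// lerD2l ger0_norm ?subr_ge0//.
by lra.
Qed.

Lemma cell_inj i j x : cell i x -> cell j x -> i = j.
Proof.
have H (k l : nat) : cell k x -> cell l x -> ~ (k < l)%N.
  move=> /cellP /andP[_ xk] /cellP /andP[lx _] kl.
  have := node_le _ _ kl; rewrite [node k.+1]/node -natr1 mulrDl mul1r addrA -/(node k).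
  by move=> H; have := le_lt_trans (le_trans H lx) xk; rewrite ltxx.
move=> ci cj; apply/eqP; rewrite eqn_leq; apply/andP; split; rewrite leqNgt; apply/negP.
- exact: H cj ci.
- exact: H ci cj.
Qed.

Lemma cell_ex x : - rho <= x -> x < rho -> exists2 i : nat, (i < 2 * M)%N & cell i x.
Proof.
move=> rx xr; pose y := (x + rho) / (rho / M%:R).
have y0 : 0 <= y by apply: divr_ge0; [lra|exact: ltW].
exists (Num.truncn y).
  rewrite -(ltr_nat R); have := truncn_itv y0 => /andP[H _].
  apply: (le_lt_trans H); rewrite /y ltr_pdivrMr//.
  have -> : (2 * M)%:R * (rho / M%:R) = 2 * rho.
    by rewrite natrM; field; rewrite pnatr_eq0 -lt0n.
  lra.
apply/cellP; rewrite /node; have := truncn_itv y0; rewrite -natr1.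
move: (Num.truncn y)%:R => k /andP[k1 k2].
have E : y * (rho / M%:R) = x + rho by rewrite /y divfK// gt_eqF.
have H1 : k * (rho / M%:R) <= y * (rho / M%:R) by rewrite ler_wpM2r// ltW.
have H2 : y * (rho / M%:R) < (k + 1) * (rho / M%:R) by rewrite ltr_pM2r.
by move: H1 H2; rewrite E mulrDl mul1r => H1 H2; apply/andP; split; lra.
Qed.

Definition step (a : nat -> R) (x : R) : R := \sum_(i < 2 * M) \1_(cell i) x * a i.

Lemma step_in a i x : (i < 2 * M)%N -> cell i x -> step a x = a i.
Proof.
move=> iM xi; rewrite /step (bigD1 (Ordinal iM))//= indicE mem_set// mul1r big1 ?addr0//.
move=> j jn; rewrite indicE; case: (boolP (x \in _)); rewrite ?mul0r//.
rewrite inE => xj; have := cell_inj _ _ _ xi xj => ij.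
by move: jn; rewrite -val_eqE/= ij eqxx.
Qed.

Lemma cell_lt_norm i x : (i < 2 * M)%N -> cell i x -> - rho <= x < rho.
Proof.
move=> iM; rewrite /cell/= in_itv/= => /andP[ix xi]; apply/andP; split.
  apply: le_trans ix; have := @node_le 0 i (leq0n _); apply: le_trans.
  by rewrite /node mul0r addr0.
apply: (lt_le_trans xi); have := node_le _ _ iM; move=> /le_trans; apply.
by have := node_norm (2 * M) (leqnn _); rewrite ler_norml => /andP[].
Qed.

Lemma step_out a x : ~~ (- rho <= x < rho) -> step a x = 0.
Proof.
move=> xo; rewrite /step big1// => i _; rewrite indicE memNset ?mul0r//.
by move=> /(cell_lt_norm _ _ (ltn_ord i)) H; move: xo; rewrite H.
Qed.

Lemma measurable_step a : measurable_fun setT (step a).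
Proof.
apply: measurable_sum => i; apply: measurable_funM => //.
by apply: measurable_indic; exact: measurable_cell.
Qed.

Lemma Rintegral_step (f : R -> R) (a : nat -> R) : mu.-integrable setT (EFin \o f) ->
  mu.-integrable setT (fun x => (f x * step a x)%:E) /\
  \int[mu]_x (f x * step a x) = \sum_(i < 2 * M) (\int[mu]_(x in cell i) f x) * a i.
Proof.
move=> if_.
have ic (i : nat) : mu.-integrable setT (fun x => (f x * \1_(cell i) x)%:E).
  have mc : measurable (cell i : set (measurableTypeR R)) by exact: measurable_cell.
  have : mu.-integrable (cell i) (EFin \o f) by apply: integrableS if_.
  rewrite (integrable_mkcond _ mc); apply: eq_integrable => // x _.
  by rewrite patchE indicE; case: ifP => _; rewrite ?mulr1 ?mulr0.
have ica (i : nat) : mu.-integrable setT (fun x => (a i * (f x * \1_(cell i) x))%:E).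
  by have := integrableZl measurableT (a i) (ic i).
have E : (fun x => f x * step a x) = (fun x => \sum_(i < 2 * M) a i * (f x * \1_(cell i) x)).
  by apply/funext => x; rewrite /step mulr_sumr; apply: eq_bigr => i _; ring.
have [i1 i2] := Rintegral_sum mu 'I_(2 * M) (index_enum _)
  (fun i x => a i * (f x * \1_(cell i) x)) (fun i => ica i).
split; first by rewrite -[X in _.-integrable _ X]/(EFin \o (fun x => f x * step a x)) E.
rewrite E i2; apply: eq_bigr => i _; rewrite RintegralZl//; last exact: ic.
by rewrite /Rintegral integral_mulr_indic mulrC.
Qed.

End cells.

(** * Rescaling of the kernel error *)

Section kernel_error_scaling.
Context {d} {Omega : measurableType d} {R : realType}.
Notation mu := (@lebesgue_measure R).
Context (T tau : R) (V : R -> Omega -> R).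
Hypotheses (htau : 0 < tau < T) (jV : jointly_measurable T V).

(** The factor cutting off outside [0, T] makes the increment jointly measurable on the whole line,
    so that after rescaling the kernel variable can range over all of R. *)
Definition increment (t : R) (w : Omega) : R :=
  (\1_(`[0, T]%classic) t) * (V t w - V tau w).

Let measurable_itvT : measurable (`[0, T] : set R).
Proof. exact: measurable_itv. Qed.

Lemma measurable_restricted : measurable_fun setT
  (fun z : R * Omega => \1_(`[0, T]%classic) z.1 * V z.1 z.2).
Proof.
have mD : measurable (`[0, T] `*` [set: Omega] : set (R * Omega)).
  by apply: measurableX.
have := (measurable_restrictT (fun z : R * Omega => V z.1 z.2) mD).1 jV.
suff -> : (fun z : R * Omega => V z.1 z.2) \_ (`[0, T] `*` [set: Omega]) =
  (fun z : R * Omega => \1_(`[0, T]%classic) z.1 * V z.1 z.2) by [].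
apply/funext => -[t w]; rewrite patchE /= indicE.
have [tT|tT] := boolP (t \in `[0, T]%classic).
  by rewrite mem_set ?mul1r//; split => //=; rewrite inE in tT.
by rewrite memNset ?mul0r// => -[/= tT' _]; rewrite notin_setE in tT.
Qed.

Lemma measurable_path (t : R) : 0 <= t <= T -> measurable_fun setT (V t).
Proof.
move=> t0T; have := measurable_fun_pair2 t measurable_restricted.
rewrite /= indicE mem_set; last by rewrite /= in_itv.
by under eq_fun do rewrite mul1r.
Qed.

Lemma measurable_increment :
  measurable_fun setT (fun z : R * Omega => increment z.1 z.2).
Proof.
have -> : (fun z : R * Omega => increment z.1 z.2) =
    (fun z => \1_(`[0, T]%classic) z.1 * V z.1 z.2 - \1_(`[0, T]%classic) z.1 * V tau z.2).
  by apply/funext => z; rewrite /increment mulrBr.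
apply: measurable_funB; first exact: measurable_restricted.
apply: measurable_funM.
  by apply: (measurableT_comp (measurable_indic _)).
apply: (measurableT_comp (measurable_path tau _)) => //.
by case/andP: htau => a b; rewrite (ltW a) (ltW b).
Qed.

Lemma increment_in t w : 0 <= t <= T -> increment t w = V t w - V tau w.
Proof. by move=> tT; rewrite /increment indicE mem_set ?mul1r//= in_itv. Qed.

(** The substitution t = tau + h x, carried out on extended integrals, so it holds at every sample
    point whether or not the path is integrable against the kernel. *)
Lemma kernel_error_scaled (K : R -> R) (h : R) (w : Omega) :
  measurable_fun setT K -> 0 < h ->
  kernel_error K T tau V h w = \int[mu]_x (K x * increment (tau + h * x) w).
Proof.
move=> mK h0; rewrite /kernel_error /Rintegral; congr fine.
have mu_ : measurable_fun setT (fun t => increment t w).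
  exact: (measurable_fun_pair1 w measurable_increment).
transitivity (\int[mu]_t (K ((t - tau) / h) / h * increment t w)%:E)%E.
  rewrite integral_mkcond; apply: eq_integral => t _.
  rewrite patchE /increment indicE; case: ifP => _; rewrite ?mul1r//.
  by rewrite mul0r mulr0.
rewrite (integral_affine tau h)//; last first.
  apply/measurable_EFinP; apply: measurable_funM => //; apply: measurable_funM => //.
  by apply: (measurableT_comp mK); apply: measurable_funM => //; apply: measurable_funB.
rewrite -gt0_integralZl//.
  apply: eq_integral => x _; rewrite -EFinM; congr (_%:E).
  have -> : (tau + h * x - tau) / h = x by field; rewrite gt_eqF.
  by field; rewrite gt_eqF.
apply/measurable_EFinP; apply: measurable_funM.
  apply: measurable_funM => //; apply: (measurableT_comp mK).
  by apply: measurable_funM => //; apply: measurable_funB => //; exact: (measurable_affine tau h).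
exact: (measurableT_comp mu_ (measurable_affine tau h)).
Qed.

End kernel_error_scaling.

(** * Discretization of the kernel integral *)

Section discretization.
Context {d} {Omega : measurableType d} {R : realType} (P : probability Omega R).
Notation mu := (@lebesgue_measure R).
Context (T tau : R) (V : R -> Omega -> R) (K : R -> R) (gamma kap M0 : R).
Hypotheses (htau : 0 < tau < T) (jV : jointly_measurable T V).
Hypotheses (g0 : 0 < gamma) (mK : measurable_fun setT K).
Hypothesis iK : mean_le mu (fun x => `|K x| * weight gamma x) kap.
Hypothesis V_bound : forall t, 0 <= t <= T -> mean_le P (fun w => `|V t w - V tau w|) M0.
Context (dl : R) (m : nat).
Hypotheses (dl0 : 0 < dl) (m0 : (0 < m)%N) (mesh1 : dl^-1 / m%:R <= 1).
Hypotheses (dltau : dl <= tau) (dlT : tau + dl <= T).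

Let h := dl ^+ 2.
Let rho := dl^-1.
Let q := dl `^ gamma.

(** With bandwidth dl^2 and kernel variable cut at 1/dl, the grid times fill a window of half-width
    [dl]: it shrinks to [tau] while the range of the kernel variable grows to the whole line. *)
Definition grid_time (i : nat) : R := tau + dl ^+ 2 * node dl^-1 m i.
Definition grid_weight (i : nat) : R :=
  (dl `^ gamma)^-1 * \int[mu]_(x in cell dl^-1 m i) K x.

Let h0 : 0 < h. Proof. by rewrite exprn_gt0. Qed.
Let rho0 : 0 < rho. Proof. by rewrite invr_gt0. Qed.
Let q0 : 0 < q. Proof. by rewrite powR_gt0. Qed.

Let hrho : h * rho = dl.
Proof. by rewrite /h /rho expr2 mulfK// gt_eqF. Qed.

Lemma normalizer_sqr : (dl ^+ 2) `^ (- (gamma / 2)) = (dl `^ gamma)^-1.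
Proof.
rewrite powRN -powR_mulrn; last exact: ltW.
by rewrite -powRrM; congr ((_ `^ _)^-1); field.
Qed.

Let K_le_weight x : `|K x| <= `|K x| * weight gamma x.
Proof. by rewrite ler_peMr// weight_ge1. Qed.

Let norm_K_bound : mean_le mu (fun x => `|K x|) kap.
Proof.
apply: (mean_le_mono mu _ _ kap _ _ iK); first exact: measurableT_comp.
by move=> x; rewrite normr_ge0 K_le_weight.
Qed.

Let K_integrable : mu.-integrable setT (EFin \o K).
Proof. exact: (mean_le_integrable mu K kap mK norm_K_bound). Qed.

Let normK_integrable : mu.-integrable setT (EFin \o (fun x => `|K x|)).
Proof. exact: integrable_norm K_integrable. Qed.

Lemma grid_time_norm i : (i <= 2 * m)%N -> `|grid_time i - tau| <= dl.
Proof.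
move=> im; rewrite /grid_time addrAC subrr add0r normrM gtr0_norm//.
by rewrite -[leRHS]hrho ler_pM2l//; apply: node_norm.
Qed.

Lemma grid_time_itv i : (i <= 2 * m)%N -> 0 <= grid_time i <= T.
Proof.
move=> /grid_time_norm; rewrite ler_norml => /andP[a b].
have := dltau; have := dlT; move: (grid_time i) a b => t a b c e.
by apply/andP; split; lra.
Qed.

Lemma grid_time_dist i x : cell rho m i x ->
  `|tau + h * x - grid_time i| <= dl / m%:R.
Proof.
move=> /(cellP rho m) /andP[ix xi].
rewrite /grid_time -/h -/rho.
have -> : tau + h * x - (tau + h * node rho m i) = h * (x - node rho m i) by ring.
rewrite normrM gtr0_norm// ger0_norm ?subr_ge0//.
apply: (@le_trans _ _ (h * (rho / m%:R))); last by rewrite mulrA hrho.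
by rewrite ler_pM2l// lerBlDl ltW.
Qed.

(** The sum is at most 1/q times the integral of |K| against the step function of the [a i], and
    this step function lies below b times the envelope. *)
Lemma cell_weight_sum (a : nat -> R) (b : R) : (forall i, 0 <= a i) -> 0 <= b ->
  (forall i x, (i < 2 * m)%N -> cell rho m i x -> a i <= b * weight gamma x) ->
  \sum_(i < 2 * m) `|grid_weight i| * a i <= q^-1 * (b * kap).
Proof.
move=> a0 b0 ab.
have [i1 i2] := Rintegral_step rho m (fun x => `|K x|) a normK_integrable.
apply: (@le_trans _ _ (q^-1 * \int[mu]_x (`|K x| * step rho m a x))).
  rewrite i2 mulr_sumr; apply: ler_sum => i _.
  rewrite /grid_weight normrM -mulrA gtr0_norm ?invr_gt0// ler_wpM2l ?invr_ge0 ?(ltW q0)//.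
  rewrite ler_wpM2r//; apply: le_normr_Rintegral; first exact: measurable_cell.
  by apply: integrableS K_integrable => //; exact: measurable_cell.
rewrite ler_pM2l ?invr_gt0//.
have S0 x : 0 <= step rho m a x.
  by apply: sumr_ge0 => i _; rewrite mulr_ge0// indicE.
have H : mean_le mu (fun x => `|K x| * step rho m a x) (b * kap).
  apply: (mean_le_mono mu _ _ (b * kap) _ _ (mean_leZ mu _ _ b b0 iK)).
    apply: measurable_funM; first exact: measurableT_comp.
    exact: measurable_step.
  move=> x; rewrite mulr_ge0//= mulrCA ler_wpM2l//.
  have [xr|xr] := boolP (- rho <= x < rho).
    case/andP: xr => x1 x2; have [i im xi] := cell_ex rho m rho0 m0 x x1 x2.
    by rewrite (step_in rho m rho0 m0 a i x im xi) ab.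
  by rewrite (step_out rho m rho0 m0 a x xr) mulr_ge0// weight_ge0.
have := mean_le_Rintegral mu (fun x => `|K x| * step rho m a x) (b * kap).
rewrite ger0_norm; last by apply: Rintegral_ge0 => x _; rewrite mulr_ge0.
apply; first by case: H.
by under eq_fun do rewrite ger0_norm ?mulr_ge0//.
Qed.

(** Since |t_i - tau|^(gamma/2) is q times |node_i|^(gamma/2), the factor q cancels the normaliser
    1/q in the weights. The bound does not depend on [dl] or on the number of cells. *)
Lemma grid_weight_times (A : Omega -> R) (D : nat -> Omega -> R) (eta : R) : 0 <= eta ->
  (forall w, 0 <= A w) -> measurable_fun setT A ->
  (forall i, (i < 2 * m)%N -> measurable_fun setT (D i) /\
    mean_le P (fun w => A w * `|D i w|) (eta * `|grid_time i - tau| `^ (gamma / 2))) ->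
  mean_le P (fun w => A w * `|\sum_(i < 2 * m) grid_weight i * D i w|) (eta * kap).
Proof.
move=> eta0 A0 mA HD.
have H : mean_le P (fun w => \sum_(i < 2 * m) `|grid_weight i| * (A w * `|D i w|))
    (\sum_(i < 2 * m) `|grid_weight i| * (eta * `|grid_time i - tau| `^ (gamma / 2))).
  by apply: mean_le_sum => i; apply: mean_leZ => //; case: (HD i (ltn_ord i)).
apply: (mean_leW P _ _ (eta * kap) (mean_le_mono P _ _ _ _ _ H)).
- apply: measurable_funM => //; apply: measurableT_comp => //.
  by apply: measurable_sum => i; apply: measurable_funM => //; case: (HD i (ltn_ord i)).
- move=> w; rewrite mulr_ge0//=; apply: (@le_trans _ _ (A w * \sum_(i < 2 * m) `|grid_weight i * D i w|)).
    by rewrite ler_wpM2l//; exact: ler_norm_sum.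
  by rewrite mulr_sumr; apply: ler_sum => i _; rewrite normrM mulrCA.
apply: (@le_trans _ _ (q^-1 * (eta * q * kap))); last first.
  by rewrite le_eqVlt; apply/orP; left; apply/eqP; field; rewrite gt_eqF.
apply: (cell_weight_sum (fun i => eta * `|grid_time i - tau| `^ (gamma / 2)) (eta * q)).
- by move=> i; rewrite mulr_ge0// powR_ge0.
- by rewrite mulr_ge0// ltW.
- move=> i x im xi; rewrite -mulrA ler_wpM2l//.
  rewrite /grid_time addrAC subrr add0r normrM gtr0_norm// powRM ?normr_ge0 ?(ltW h0)//.
  have -> : (dl ^+ 2) `^ (gamma / 2) = q.
    rewrite -powR_mulrn; last exact: ltW.
    by rewrite -powRrM; congr (_ `^ _); field.
  rewrite ler_pM2l//; apply: powR_half_shift_le_weight => //.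
  exact: (cell_norm rho m i x xi).
Qed.

(** The bound is dl^(2 - gamma) times [kap]. It makes biases linear in |t - tau| negligible when
    gamma < 2. *)
Lemma grid_weight_time_sum : 1 <= gamma ->
  \sum_(i < 2 * m) `|grid_weight i| * `|grid_time i - tau| <= q^-1 * (dl ^+ 2 * kap).
Proof.
move=> g1; apply: (cell_weight_sum (fun i => `|grid_time i - tau|) (dl ^+ 2)) => //; first exact: ltW.
move=> i x im xi; rewrite /grid_time addrAC subrr add0r normrM gtr0_norm//.
rewrite ler_pM2l//; apply: norm_shift_le_weight => //.
exact: (cell_norm rho m i x xi).
Qed.

Hypothesis V_mesh : forall s t, `|s - tau| <= dl -> `|t - tau| <= dl ->
  `|s - t| <= dl / m%:R -> mean_le P (fun w => `|V s w - V t w|) (q * dl ^+ 2).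

(** For |x| < 1/dl the process is frozen at the left node of the cell, at a cost of q dl^2 per unit
    of |K| by the choice of mesh; for |x| >= 1/dl the crude bound [M0] is used. Division by q leaves
    the two terms of the estimate. *)
Lemma kernel_error_grid (tail : R) :
  mean_le mu (fun x => \1_[set x | rho <= `|x|] x * (`|K x| * `|x| `^ gamma)) tail ->
  measurable_fun setT (kernel_error K T tau V h) /\
  mean_le P (fun w => `|h `^ (- (gamma / 2)) * kernel_error K T tau V h w -
     \sum_(i < 2 * m) grid_weight i * (V (grid_time i) w - V tau w)|)
    (dl ^+ 2 * kap + M0 * tail).
Proof.
move=> Htail.
have M00 : 0 <= M0.
  by apply: mean_le_ge0 (V_bound tau _); case/andP: htau => a b; rewrite (ltW a) (ltW b).
have minc := measurable_increment T tau V htau jV.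
pose U x w := increment T tau V (tau + h * x) w.
have tauT : 0 <= tau <= T by case/andP: htau => a b; rewrite (ltW a) (ltW b).
have mU : measurable_fun setT (fun z : R * Omega => U z.1 z.2).
  have H : measurable_fun setT (fun z : R * Omega => (tau + h * z.1, z.2)).
    apply: measurable_fun_pair; last exact: measurable_snd.
    apply: measurable_funD => //; apply: measurable_funM => //; exact: measurable_fst.
  exact: (measurableT_comp minc H).
pose W x w := step rho m (fun i => V (grid_time i) w - V tau w) x.
have mincr i : (i < 2 * m)%N -> measurable_fun setT (fun w => V (grid_time i) w - V tau w).
  move=> im; apply: measurable_funB; apply: (measurable_path T V jV) => //.
  by apply: grid_time_itv; exact: ltnW.
have mW : measurable_fun setT (fun z : R * Omega => W z.1 z.2).
  apply: measurable_sum => i; apply: measurable_funM.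
    by apply: (measurableT_comp (measurable_indic (measurable_cell rho m i))); exact: measurable_fst.
  by apply: (measurableT_comp (mincr i (ltn_ord i))); exact: measurable_snd.
have U_bound x : mean_le P (fun w => `|U x w|) M0.
  have [xT|xT] := boolP (0 <= tau + h * x <= T).
    have E : U x = (fun w => V (tau + h * x) w - V tau w).
      by apply/funext => w; rewrite /U increment_in.
    by rewrite E; exact: V_bound.
  have E : U x = (fun=> 0).
    apply/funext => w; rewrite /U /increment indicE memNset ?mul0r//=.
    by rewrite in_itv/=; apply/negP.
  by rewrite E normr0; apply: (mean_leW P _ 0) => //; exact: mean_le0.
have mK1 : measurable_fun setT (fun z : R * Omega => K z.1).
  by apply: (measurableT_comp mK); exact: measurable_fst.
have KU_bound x : mean_le P (fun w => `|K x * U x w|) (M0 * `|K x|).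
  have H := mean_leZ P _ _ `|K x| (normr_ge0 _) (U_bound x).
  by rewrite (mulrC M0); under eq_fun do rewrite normrM; exact: H.
have [mKU aeKU _] := mean_le_section mu P (fun x w => K x * U x w) (fun x => M0 * `|K x|) _
   (measurable_funM mK1 mU) KU_bound (mean_leZ mu _ _ M0 M00 norm_K_bound).
pose far x := \1_[set x | rho <= `|x|] x * (`|K x| * `|x| `^ gamma).
have far0 x : 0 <= far x by case: Htail => _ /(_ x).
have Phi_bound x : mean_le P (fun w => `|K x * (U x w - W x w)|)
    ((q * dl ^+ 2) * `|K x| + (M0 * q) * far x).
  have qfar : 0 <= (M0 * q) * far x by rewrite !mulr_ge0// ltW.
  have mUW : measurable_fun setT (fun w => U x w - W x w).
    by apply: measurable_funB; [exact: (measurable_fun_pair2 x mU)|exact: (measurable_fun_pair2 x mW)].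
  have [xr|xr] := boolP (- rho <= x < rho).
    case/andP: (xr) => x1 x2; have [i im xi] := cell_ex rho m rho0 m0 x x1 x2.
    have hx : `|tau + h * x - tau| <= dl.
      rewrite addrAC subrr add0r normrM gtr0_norm// -[leRHS]hrho ler_pM2l//.
      by rewrite ler_norml x1 ltW.
    have hT : 0 <= tau + h * x <= T.
      move: hx; rewrite ler_norml => /andP[a b]; have := dltau; have := dlT.
      by move: (tau + h * x) a b => t a b c e; apply/andP; split; lra.
    have E : (fun w => `|K x * (U x w - W x w)|) =
        (fun w => `|K x| * `|V (tau + h * x) w - V (grid_time i) w|).
      apply/funext => w; rewrite -normrM /U increment_in// /W (step_in rho m rho0 m0 _ i x im xi).
      by rewrite opprB addrA subrK.
    rewrite E; apply: mean_leW (mean_leZ P _ _ `|K x| (normr_ge0 _)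
      (V_mesh _ _ hx (grid_time_norm i (ltnW im)) (grid_time_dist i x xi))) _.
    by rewrite mulrC lerDl.
  have Wx0 w : W x w = 0 by rewrite /W (step_out rho m rho0 m0).
  have rx : rho <= `|x|.
    rewrite leNgt; apply: contra xr; rewrite ltr_norml => /andP[a b].
    by rewrite (ltW a) b.
  have E : (fun w => `|K x * (U x w - W x w)|) = (fun w => `|K x| * `|U x w|).
    by apply/funext => w; rewrite Wx0 subr0 normrM.
  rewrite E; apply: mean_leW (mean_leZ P _ _ `|K x| (normr_ge0 _) (U_bound x)) _.
  rewrite /far indicE mem_set// mul1r.
  (* The cut at 1/dl is where q |x|^gamma equals 1; beyond it the moment |x|^gamma of the kernel
     pays for the normaliser 1/q. *)
  have q1 : 1 <= q * `|x| `^ gamma.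
    have <- : q * rho `^ gamma = 1.
      by rewrite -powRM ?invr_ge0 ?ltW// /rho divff ?powR1// gt_eqF.
    rewrite ler_pM2l//; apply: ge0_ler_powR; rewrite ?nnegrE//; exact: ltW.
  apply: (@le_trans _ _ (M0 * q * (`|K x| * `|x| `^ gamma))); last first.
    by rewrite lerDr mulr_ge0// mulr_ge0 ?sqr_ge0// ltW.
  have -> : M0 * q * (`|K x| * `|x| `^ gamma) = `|K x| * M0 * (q * `|x| `^ gamma) by ring.
  by rewrite ler_peMr// mulr_ge0.
have b_bound := mean_leD mu _ _ _ _
  (mean_leZ mu _ _ (q * dl ^+ 2) (mulr_ge0 (ltW q0) (sqr_ge0 _)) norm_K_bound)
  (mean_leZ mu _ _ (M0 * q) (mulr_ge0 M00 (ltW q0)) Htail).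
have [mD aeD D_bound] := mean_le_section mu P (fun x w => K x * (U x w - W x w)) _ _
   (measurable_funM mK1 (measurable_funB mU mW)) Phi_bound b_bound.
have kE w : kernel_error K T tau V h w = \int[mu]_x (K x * U x w).
  exact: kernel_error_scaled.
have mY : measurable_fun setT (kernel_error K T tau V h).
  by have -> : kernel_error K T tau V h = (fun w => \int[mu]_x (K x * U x w)) by apply/funext.
split=> //.
have qi0 : 0 <= q^-1 by rewrite invr_ge0 ltW.
have qle : q^-1 * (q * dl ^+ 2 * kap + M0 * q * tail) <= dl ^+ 2 * kap + M0 * tail.
  by rewrite le_eqVlt; apply/orP; left; apply/eqP; field; rewrite gt_eqF.
apply: (mean_le_ae P _ _ _ _ _ _ (mean_leW P _ _ _ (mean_leZ P _ _ q^-1 qi0 D_bound) qle)).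
- apply: measurableT_comp => //; apply: measurable_funB; first exact: measurable_funM.
  by apply: measurable_sum => i; apply: measurable_funM => //; exact: mincr.
- by move=> w; exact: normr_ge0.
apply: filterS aeKU => w iKU; rewrite kE normalizer_sqr -/q.
have [iKW KWE] := Rintegral_step rho m K (fun i => V (grid_time i) w - V tau w) K_integrable.
have -> : \sum_(i < 2 * m) grid_weight i * (V (grid_time i) w - V tau w) =
    q^-1 * \int[mu]_x (K x * W x w).
  by rewrite /W KWE mulr_sumr; apply: eq_bigr => i _; rewrite /grid_weight mulrA.
rewrite -mulrBr normrM ger0_norm// ler_wpM2l//.
rewrite -RintegralB//.
by under eq_Rintegral do rewrite -mulrBr.
Qed.

End discretization.

(** * Products of square-integrable variables *)

Section second_moments.
Context {d} {Omega : measurableType d} {R : realType} (P : probability Omega R).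
Implicit Types (X Y : Omega -> R).

(** Young's inequality with a free parameter, expanding (|X| - l |Y|)^2 >= 0. It plays the part of
    the Cauchy-Schwarz inequality; a suitable [l] recovers its order of magnitude without square
    roots. *)
Lemma mean_le_mul X Y (l a b : R) : 0 < l ->
  measurable_fun setT X -> measurable_fun setT Y ->
  mean_le P (fun w => X w ^+ 2) a -> mean_le P (fun w => Y w ^+ 2) b ->
  mean_le P (fun w => `|X w * Y w|) ((a / l + l * b) / 2).
Proof.
move=> l0 mX mY ha hb.
have il0 : 0 <= l^-1 by rewrite invr_ge0 ltW.
have h2 : 0 <= (2 : R)^-1 by rewrite invr_ge0.
have H := mean_leZ P _ _ 2^-1 h2 (mean_leD P _ _ _ _ (mean_leZ P _ _ _ il0 ha) (mean_leZ P _ _ _ (ltW l0) hb)).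
rewrite [X in mean_le _ _ X](_ : _ = 2^-1 * (l^-1 * a + l * b)); last first.
  by rewrite mulrC [a / l]mulrC.
apply: mean_le_mono H.
  by apply: measurableT_comp => //; apply: measurable_funM.
move=> w; rewrite normr_ge0/= normrM.
rewrite -(real_normK (num_real (X w))) -(real_normK (num_real (Y w))).
move: `|X w| `|Y w| (normr_ge0 (X w)) (normr_ge0 (Y w)) => x y x0 y0.
have : 0 <= (x - l * y) ^+ 2 / l by rewrite divr_ge0 ?sqr_ge0 ?ltW.
have -> : (x - l * y) ^+ 2 / l = l^-1 * x ^+ 2 + l * y ^+ 2 - 2 * (x * y).
  by field; rewrite gt_eqF.
by move=> H2; lra.
Qed.

Lemma integrable_mul X Y (a b : R) :
  measurable_fun setT X -> measurable_fun setT Y ->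
  mean_le P (fun w => X w ^+ 2) a -> mean_le P (fun w => Y w ^+ 2) b ->
  P.-integrable setT (EFin \o (fun w => X w * Y w)).
Proof.
move=> mX mY ha hb.
apply: (mean_le_integrable P _ ((a / 1 + 1 * b) / 2)); first exact: measurable_funM.
exact: mean_le_mul.
Qed.

(** X1 Y1 - X2 Y2 = (X1 - X2) Y1 + (Y1 - Y2) X2, and Young's inequality is applied to each
    product. *)
Lemma Rintegral_mul_dist X1 X2 Y1 Y2 (l e a b : R) : 0 < l ->
  measurable_fun setT X1 -> measurable_fun setT X2 ->
  measurable_fun setT Y1 -> measurable_fun setT Y2 ->
  mean_le P (fun w => (X1 w - X2 w) ^+ 2) e ->
  mean_le P (fun w => (Y1 w - Y2 w) ^+ 2) e ->
  mean_le P (fun w => X2 w ^+ 2) a -> mean_le P (fun w => Y1 w ^+ 2) b ->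
  P.-integrable setT (EFin \o (fun w => X1 w * Y1 w)) ->
  P.-integrable setT (EFin \o (fun w => X2 w * Y2 w)) ->
  `|\int[P]_w (X1 w * Y1 w) - \int[P]_w (X2 w * Y2 w)| <= e / l + l * ((a + b) / 2).
Proof.
move=> l0 mX1 mX2 mY1 mY2 hX hY ha hb i1 i2; rewrite -RintegralB//.
have mdX := measurable_funB mX1 mX2; have mdY := measurable_funB mY1 mY2.
apply: mean_le_Rintegral; first by apply: measurable_funB; apply: measurable_funM.
have H := mean_leD P _ _ _ _ (mean_le_mul _ _ l e b l0 mdX mY1 hX hb)
  (mean_le_mul _ _ l e a l0 mdY mX2 hY ha).
apply: mean_leW (mean_le_mono P _ _ _ _ _ H) _.
- apply: measurableT_comp => //.
  by apply: measurable_funB; apply: measurable_funM.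
- move=> w; rewrite normr_ge0/=.
  have -> : X1 w * Y1 w - X2 w * Y2 w = (X1 w - X2 w) * Y1 w + (Y1 w - Y2 w) * X2 w by ring.
  exact: ler_normD.
- by rewrite le_eqVlt; apply/orP; left; apply/eqP; field; rewrite gt_eqF.
Qed.

End second_moments.

(** * Second moments of grid sums *)

Section grid_variance.
Context {d} {Omega : measurableType d} {R : realType} (P : probability Omega R).
Notation mu := (@lebesgue_measure R).
Context (tau gamma kap kN : R) (K : R -> R) (N : R -> Omega -> R) (dl : R) (m : nat).
Hypotheses (g0 : 0 < gamma) (mK : measurable_fun setT K).
Hypothesis iK : mean_le mu (fun x => `|K x| * weight gamma x) kap.
Hypotheses (dl0 : 0 < dl) (m0 : (0 < m)%N) (mesh1 : dl^-1 / m%:R <= 1).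
Hypothesis mN : forall t, `|t - tau| <= dl -> measurable_fun setT (N t).
Hypothesis N_bound : forall t, `|t - tau| <= dl ->
  mean_le P (fun w => (N t w - N tau w) ^+ 2) (kN * `|t - tau| `^ gamma).

Let rho := dl^-1.
Let rho0 : 0 < rho. Proof. by rewrite invr_gt0. Qed.
Let q := dl `^ gamma.
Let q0 : 0 < q. Proof. by rewrite powR_gt0. Qed.
Let tt := grid_time tau dl m.
Let D i w := N (tt i) w - N tau w.
Let cov i j := \int[P]_w (D i w * D j w).

Definition grid_sum (w : Omega) : R := \sum_(i < 2 * m) grid_weight K gamma dl m i * D i w.

(** The normalised covariance of the increments of [N], frozen on cells in both variables. The
    second moment of [grid_sum] is its double integral against the kernel, so its limit becomes a
    matter of dominated convergence. *)
Definition grid_covariance (x y : R) : R :=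
  q ^- 2 * step rho m (fun i => step rho m (fun j => cov i j) y) x.

Let mD i : (i < 2 * m)%N -> measurable_fun setT (D i).
Proof.
move=> im; apply: measurable_funB; apply: mN.
  by apply: grid_time_norm => //; exact: ltnW.
by rewrite subrr normr0 ltW.
Qed.

Let D2 i : (i < 2 * m)%N ->
  mean_le P (fun w => D i w ^+ 2) (kN * `|tt i - tau| `^ gamma).
Proof. by move=> im; apply: N_bound; apply: grid_time_norm => //; exact: ltnW. Qed.

Lemma measurable_grid_sum : measurable_fun setT grid_sum.
Proof. by apply: measurable_sum => i; apply: measurable_funM => //; exact: mD. Qed.

Let K_integrable : mu.-integrable setT (EFin \o K).
Proof.
apply: (mean_le_integrable mu K kap mK).
apply: (mean_le_mono mu _ _ kap _ _ iK); first exact: measurableT_comp.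
by move=> x; rewrite normr_ge0 ler_peMr// weight_ge1.
Qed.

Lemma grid_sum_sqr :
  P.-integrable setT (EFin \o (fun w => grid_sum w ^+ 2)) /\
  \int[P]_w (grid_sum w ^+ 2) =
  \sum_(i < 2 * m) \sum_(j < 2 * m) grid_weight K gamma dl m i * grid_weight K gamma dl m j * cov i j.
Proof.
pose F (i j : 'I_(2 * m)) w := grid_weight K gamma dl m i * grid_weight K gamma dl m j * (D i w * D j w).
have iDD (i j : 'I_(2 * m)) : P.-integrable setT (EFin \o (fun w => D i w * D j w)).
  apply: (integrable_mul P (D i) (D j) _ _ (mD i _) (mD j _) (D2 i _) (D2 j _)) => //.
have iF i j : P.-integrable setT (EFin \o F i j).
  exact: (integrableZl measurableT _ (iDD i j)).
have iFi i := Rintegral_sum P 'I_(2 * m) (index_enum _) (F i) (iF i).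
have [i1 i2] := Rintegral_sum P 'I_(2 * m) (index_enum _)
  (fun i w => \sum_(j < 2 * m) F i j w) (fun i => (iFi i).1).
have E : (fun w => grid_sum w ^+ 2) = (fun w => \sum_(i < 2 * m) \sum_(j < 2 * m) F i j w).
  apply/funext => w; rewrite expr2 /grid_sum mulr_suml; apply: eq_bigr => i _.
  by rewrite mulr_sumr; apply: eq_bigr => j _; rewrite /F; ring.
rewrite E; split => //; rewrite i2; apply: eq_bigr => i _; rewrite (iFi i).2.
by apply: eq_bigr => j _; rewrite /F RintegralZl.
Qed.

Lemma grid_variance :
  (mu \x mu)%E.-integrable setT (fun p => (K p.1 * K p.2 * grid_covariance p.1 p.2)%:E) /\
  \int[(mu \x mu)%E]_p (K p.1 * K p.2 * grid_covariance p.1 p.2) =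
  \int[P]_w (grid_sum w ^+ 2).
Proof.
have ic (i : nat) : mu.-integrable setT (EFin \o (fun x => K x * \1_(cell rho m i) x)).
  have mc : measurable (cell rho m i : set (measurableTypeR R)) by exact: measurable_cell.
  have : mu.-integrable (cell rho m i) (EFin \o K) by apply: integrableS K_integrable.
  rewrite (integrable_mkcond _ mc); apply: eq_integrable => // x _.
  by rewrite patchE /= indicE; case: ifP => _; rewrite ?mulr1 ?mulr0.
have icE (i : nat) : \int[mu]_x (K x * \1_(cell rho m i) x) = \int[mu]_(x in cell rho m i) K x.
  by rewrite /Rintegral integral_mulr_indic.
pose F (i j : 'I_(2 * m)) (p : R * R) := (q ^- 2 * cov i j) *
   ((K p.1 * \1_(cell rho m i) p.1) * (K p.2 * \1_(cell rho m j) p.2)).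
have iF i j : (mu \x mu)%E.-integrable setT (EFin \o F i j).
  exact: (integrableZl measurableT _ (integrable_tensor mu mu _ _ (ic i) (ic j)).1).
have iFi i := Rintegral_sum (mu \x mu)%E 'I_(2 * m) (index_enum _) (F i) (iF i).
have [i1 i2] := Rintegral_sum (mu \x mu)%E 'I_(2 * m) (index_enum _)
  (fun i p => \sum_(j < 2 * m) F i j p) (fun i => (iFi i).1).
have E : (fun p : R * R => K p.1 * K p.2 * grid_covariance p.1 p.2) =
   (fun p => \sum_(i < 2 * m) \sum_(j < 2 * m) F i j p).
  apply/funext => p; rewrite /grid_covariance /step !mulr_sumr; apply: eq_bigr => i _.
  by rewrite !mulr_sumr; apply: eq_bigr => j _; rewrite /F; ring.
split.
  have -> : (fun p : R * R => (K p.1 * K p.2 * grid_covariance p.1 p.2)%:E) =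
    EFin \o (fun p => \sum_(i < 2 * m) \sum_(j < 2 * m) F i j p) by rewrite -E.
  exact: i1.
rewrite E i2 grid_sum_sqr.2; apply: eq_bigr => i _; rewrite (iFi i).2.
apply: eq_bigr => j _; have [t1 t2] := integrable_tensor mu mu _ _ (ic i) (ic j).
rewrite /F RintegralZl//.
rewrite [X in _ * X]t2 !icE /grid_weight -/rho -/q; field.
by rewrite gt_eqF.
Qed.

Let grid_time_scaled i : `|tt i - tau| `^ gamma = q ^+ 2 * `|node rho m i| `^ gamma.
Proof.
rewrite /tt /grid_time addrAC subrr add0r normrM gtr0_norm ?exprn_gt0//.
rewrite powRM ?normr_ge0 ?sqr_ge0//; congr (_ * _).
by rewrite expr2 powRM ?(ltW dl0)// expr2.
Qed.

Let kN0 : 0 <= kN.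
Proof.
have t1 : `|tau + dl - tau| <= dl by rewrite addrAC subrr add0r gtr0_norm.
have := mean_le_ge0 P _ _ (N_bound _ t1).
by rewrite addrAC subrr add0r gtr0_norm// pmulr_lge0.
Qed.

(** Each factor q^2 |node|^gamma coming from the second moments is divided by q^2, and u + v <= 2 u
    v for weights u, v >= 1 turns the sum into a product. This is the dominating function,
    independent of the mesh. *)
Lemma grid_covariance_bound x y :
  `|grid_covariance x y| <= kN * (weight gamma x * weight gamma y).
Proof.
have w1 := weight_ge1 gamma g0 x; have w2 := weight_ge1 gamma g0 y.
have b0 : 0 <= kN * (weight gamma x * weight gamma y).
  by rewrite !mulr_ge0// weight_ge0.
rewrite /grid_covariance.
have [xr|xr] := boolP (- rho <= x < rho); last first.
  by rewrite (step_out rho m rho0 m0 _ x xr) mulr0 normr0.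
case/andP: xr => x1 x2; have [i im xi] := cell_ex rho m rho0 m0 x x1 x2.
rewrite (step_in rho m rho0 m0 _ i x im xi).
have [yr|yr] := boolP (- rho <= y < rho); last first.
  by rewrite (step_out rho m rho0 m0 _ y yr) mulr0 normr0.
case/andP: yr => y1 y2; have [j jm yj] := cell_ex rho m rho0 m0 y y1 y2.
rewrite (step_in rho m rho0 m0 _ j y jm yj).
have H := mean_le_mul P (D i) (D j) 1 _ _ ltr01 (mD i im) (mD j jm) (D2 i im) (D2 j jm).
have := mean_le_Rintegral P _ _ (measurable_funM (mD i im) (mD j jm)) H.
rewrite -/(cov i j) divr1 mul1r !grid_time_scaled => {}H.
have ni := powR_shift_le_weight gamma g0 x _ (cell_norm rho m i x xi mesh1).
have nj := powR_shift_le_weight gamma g0 y _ (cell_norm rho m j y yj mesh1).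
have q20 : 0 < q ^+ 2 by rewrite exprn_gt0.
rewrite normrM ger0_norm ?invr_ge0 ?(ltW q20)// mulrC ler_pdivrMr//.
apply: (le_trans H).
move: ni nj w1 w2; move: (`|node rho m i| `^ gamma) (`|node rho m j| `^ gamma).
move: (weight gamma x) (weight gamma y) => u v a b au bv u1 v1.
have -> : (kN * (q ^+ 2 * a) + kN * (q ^+ 2 * b)) / 2 = kN * ((a + b) / 2) * q ^+ 2 by field.
rewrite ler_pM2r//; apply: ler_wpM2l => //.
have : 0 <= (u - 1) * (v - 1) by rewrite mulr_ge0// subr_ge0.
have : u + v <= 2 * (u * v) by nra.
by lra.
Qed.

Hypothesis N_mesh : forall s t, `|s - tau| <= dl -> `|t - tau| <= dl ->
  `|s - t| <= dl / m%:R -> mean_le P (fun w => (N s w - N t w) ^+ 2) ((q ^+ 2 * dl) ^+ 2).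
Hypothesis dl1 : dl <= 1.

(** With parameter l = q^2 dl in [Rintegral_mul_dist] and mesh errors of second moment l^2, the
    covariances differ by l (1 + kN); division by q^2 leaves a multiple of [dl]. *)
Lemma grid_covariance_close x y : `|x| < rho -> `|y| < rho ->
  `|grid_covariance x y - q ^- 2 *
     \int[P]_w ((N (tau + dl ^+ 2 * x) w - N tau w) * (N (tau + dl ^+ 2 * y) w - N tau w))|
  <= dl * (1 + kN).
Proof.
rewrite !ltr_norml => /andP[x1 x2] /andP[y1 y2].
have [i im xi] := cell_ex rho m rho0 m0 x (ltW x1) x2.
have [j jm yj] := cell_ex rho m rho0 m0 y (ltW y1) y2.
rewrite /grid_covariance (step_in rho m rho0 m0 _ i x im xi) (step_in rho m rho0 m0 _ j y jm yj).
have hr : dl ^+ 2 * rho = dl by rewrite expr2 mulfK// gt_eqF.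
have inI (z : R) : - rho < z -> z < rho -> `|tau + dl ^+ 2 * z - tau| <= dl.
  move=> z1 z2; rewrite addrAC subrr add0r normrM gtr0_norm ?exprn_gt0//.
  by rewrite -[leRHS]hr ler_pM2l ?exprn_gt0// ler_norml !ltW.
have q1 : q <= 1.
  apply: (@le_trans _ _ (1 `^ gamma)); last by rewrite powR1.
  by apply: ge0_ler_powR; rewrite ?nnegrE//; exact: ltW.
have inc (z : R) : - rho < z -> z < rho ->
   measurable_fun setT (fun w => N (tau + dl ^+ 2 * z) w - N tau w) /\
   mean_le P (fun w => (N (tau + dl ^+ 2 * z) w - N tau w) ^+ 2) kN.
  move=> z1 z2; split.
    by apply: measurable_funB; apply: mN; [exact: inI|rewrite subrr normr0 ltW].
  apply: (mean_leW P _ _ _ (N_bound _ (inI z z1 z2))).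
  rewrite ler_piMr//; apply: le_trans q1.
  by apply: ge0_ler_powR; rewrite ?nnegrE//; [exact: ltW|exact: ltW|exact: inI].
have [mx bx] := inc x x1 x2; have [my by_] := inc y y1 y2.
have bi k : (k < 2 * m)%N -> mean_le P (fun w => D k w ^+ 2) kN.
  move=> km; apply: mean_leW (D2 k km) _; rewrite ler_piMr//; apply: le_trans q1.
  apply: ge0_ler_powR; rewrite ?nnegrE//; [exact: ltW|exact: ltW|].
  by apply: grid_time_norm => //; exact: ltnW.
have close (z : R) k : (k < 2 * m)%N -> - rho < z -> z < rho -> cell rho m k z ->
    mean_le P (fun w => (D k w - (N (tau + dl ^+ 2 * z) w - N tau w)) ^+ 2) ((q ^+ 2 * dl) ^+ 2).
  move=> km z1 z2 kz.
  have -> : (fun w => (D k w - (N (tau + dl ^+ 2 * z) w - N tau w)) ^+ 2) =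
      (fun w => (N (tt k) w - N (tau + dl ^+ 2 * z) w) ^+ 2).
    by apply/funext => w; rewrite /D; congr (_ ^+ 2); ring.
  apply: N_mesh; [by apply: grid_time_norm => //; exact: ltnW|exact: inI|].
  by rewrite distrC; exact: grid_time_dist.
have l0 : 0 < q ^+ 2 * dl by rewrite mulr_gt0// exprn_gt0.
have := Rintegral_mul_dist P (D i) _ (D j) _ _ _ _ _ l0 (mD i im) mx (mD j jm) my
  (close x i im x1 x2 xi) (close y j jm y1 y2 yj) bx (bi j jm)
  (integrable_mul P _ _ _ _ (mD i im) (mD j jm) (bi i im) (bi j jm))
  (integrable_mul P _ _ _ _ mx my bx by_).
rewrite -/(cov i j); set c := \int[P]_w _ => H.
have q20 : 0 < q ^+ 2 by rewrite exprn_gt0.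
rewrite -mulrBr normrM ger0_norm ?invr_ge0 ?(ltW q20)// mulrC ler_pdivrMr//.
apply: (le_trans H); rewrite le_eqVlt; apply/orP; left; apply/eqP.
by field; rewrite !gt_eqF.
Qed.

End grid_variance.

(** * Integrals over a product with a normal factor *)

Section bounded_product.
Context {d1 d2} {T1 : measurableType d1} {T2 : measurableType d2} {R : realType}.
Context (P1 : probability T1 R) (P2 : probability T2 R).

Lemma Rintegral_product (Phi : T1 -> T2 -> R) (M : R) :
  measurable_fun setT (fun p : T1 * T2 => Phi p.1 p.2) ->
  (forall x y, `|Phi x y| <= M) ->
  \int[(P1 \x P2)%E]_p Phi p.1 p.2 = \int[P1]_x (\int[P2]_y Phi x y).
Proof.
move=> mPhi bPhi.
have iPhi : (P1 \x P2)%E.-integrable setT (fun p : T1 * T2 => (Phi p.1 p.2)%:E).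
  exact: (bounded_integrable (P1 \x P2)%E (fun p : T1 * T2 => Phi p.1 p.2) M mPhi (fun p => bPhi _ _)).
rewrite {1}/Rintegral -(integral12_prod_meas1 iPhi) /Rintegral; congr fine.
apply: eq_integral => x _; rewrite /fubini_F/= fineK//.
apply: (integrable_fin_num measurableT).
apply: (bounded_integrable P2 (Phi x) M) => //.
exact: (measurable_fun_pair2 x mPhi).
Qed.

Lemma integral_product_fst (f : T1 -> \bar R) : measurable_fun setT f ->
  (\int[(P1 \x P2)%E]_p f p.1 = \int[P1]_x f x)%E.
Proof.
move=> mf.
have H (g : T1 -> \bar R) : measurable_fun setT g -> (forall x, 0 <= g x)%E ->
    (\int[(P1 \x P2)%E]_p g p.1 = \int[P1]_x g x)%E.
  move=> mg g0.
  rewrite (@fubini_tonelli1 _ _ _ _ R P1 P2 (fun p => g p.1))//; last exact: (measurableT_comp mg).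
  apply: eq_integral => x _; rewrite /fubini_F /=.
  exact: (integral_probability_cst P2 (g x)).
rewrite integralE [RHS]integralE; congr (_ - _)%E.
- have := H _ (measurable_funepos mf) (fun x => funepos_ge0 f x).
  by move=> <-; apply: eq_integral => p _; rewrite !funeposE.
- have := H _ (measurable_funeneg mf) (fun x => funeneg_ge0 f x).
  by move=> <-; apply: eq_integral => p _; rewrite !funenegE.
Qed.

End bounded_product.

(** Fubini, then the normal characteristic function in the second coordinate with the first one
    fixed. *)
Lemma Rintegral_cos_normal {d} {T : measurableType d} {R : realType}
    (P : probability T R) (A B : T -> R) :
  measurable_fun setT A -> measurable_fun setT B ->
  let nu := (normal_prob 0 1 : probability (measurableTypeR R) R) in
  \int[(P \x nu)%E]_p cos (A p.1 + B p.1 * p.2) =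
  \int[P]_w (expR (- B w ^+ 2 / 2) * cos (A w)).
Proof.
move=> mA mB nu.
have mcos : measurable_fun setT (@cos R).
  by apply: continuous_measurable_fun; exact: continuous_cos.
have mPhi : measurable_fun setT (fun p : T * measurableTypeR R => cos (A p.1 + B p.1 * p.2)).
  apply: (measurableT_comp mcos); apply: measurable_funD; first exact: (measurableT_comp mA).
  by apply: measurable_funM; [exact: (measurableT_comp mB)|exact: measurable_snd].
have bcos x y : `|cos (A x + B x * y)| <= 1 by rewrite ler_norml cos_geN1 cos_le1.
have E := Rintegral_product P nu (fun x y => cos (A x + B x * y)) 1 mPhi bcos.
apply: (etrans E); apply: eq_Rintegral => w _.
have E2 := normal_cos (B w) (A w).
apply: (etrans _ E2); apply: eq_Rintegral => x _; by rewrite addrC.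
Qed.

(** * The limit theorem under a first-order expansion and a mixing hypothesis *)

Section discretization_limit.
Context {d} {Omega : measurableType d} {R : realType} (P : probability Omega R).
Notation mu := (@lebesgue_measure R).
Context (T tau gamma kap M0 kN e0 L : R) (K k : R -> R) (C : R -> R -> R).
Context (V N : R -> Omega -> R) (G : Omega -> R).
Hypotheses (htau : 0 < tau < T) (jV : jointly_measurable T V).
Hypotheses (g0 : 0 < gamma) (mK : measurable_fun setT K).
Hypothesis iK : mean_le mu (fun x => `|K x| * weight gamma x) kap.
Hypothesis V_bound : forall t, 0 <= t <= T -> mean_le P (fun w => `|V t w - V tau w|) M0.
Hypotheses (e00 : 0 < e0) (e01 : e0 <= 1) (e0tau : e0 <= tau) (e0T : tau + e0 <= T).
Hypotheses (mG : measurable_fun setT G) (ck : continuous k).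
Hypothesis mN : forall t, `|t - tau| <= e0 -> measurable_fun setT (N t).
Hypothesis N_bound : forall t, `|t - tau| <= e0 ->
  mean_le P (fun w => (N t w - N tau w) ^+ 2) (kN * `|t - tau| `^ gamma).
Hypothesis V_cont : forall e, 0 < e -> exists2 eta, 0 < eta & forall s t,
  `|s - tau| <= e0 -> `|t - tau| <= e0 -> `|s - t| <= eta ->
  mean_le P (fun w => `|V s w - V t w|) e.
Hypothesis N_cont : forall e, 0 < e -> exists2 eta, 0 < eta & forall s t,
  `|s - tau| <= e0 -> `|t - tau| <= e0 -> `|s - t| <= eta ->
  mean_le P (fun w => (N s w - N t w) ^+ 2) e.
Hypothesis N_cov : forall e, 0 < e -> exists2 eta, 0 < eta & forall r s : R,
  `|r| <= eta -> `|s| <= eta ->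
  `|\int[P]_w ((N (tau + r) w - N tau w) * (N (tau + s) w - N tau w)) - L * C r s| <=
  e * (r ^+ 2 + s ^+ 2) `^ (gamma / 2).
Hypothesis C_hom : forall a r s, 0 < a -> C (a * r) (a * s) = a `^ gamma * C r s.
Hypothesis V_approx : forall A e, 0 < A -> 0 < e -> exists2 eta, 0 < eta & forall t,
  `|t - tau| <= eta -> mean_le P (fun w => \1_[set w | `|G w| <= A] w *
    `|V t w - V tau w - k (G w) * (N t w - N tau w)|) (e * `|t - tau| `^ (gamma / 2)).

Section mesh_sequence.
Context (dl : nat -> R).
Hypotheses (dl0 : forall n, 0 < dl n) (dle0 : forall n, dl n <= e0).
Hypothesis dl_cvg : dl @ \oo --> 0.

(** The number of cells is chosen after [dl n], from moduli of continuity in mean of [V] and [N]; no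
    rate relating the two is involved. The integer exceeds the sum of the three requirements. *)
Lemma mesh_exists n : exists m : nat, [/\ (0 < m)%N, (dl n)^-1 / m%:R <= 1,
  forall s t, `|s - tau| <= dl n -> `|t - tau| <= dl n -> `|s - t| <= dl n / m%:R ->
    mean_le P (fun w => `|V s w - V t w|) (dl n `^ gamma * dl n ^+ 2) &
  forall s t, `|s - tau| <= dl n -> `|t - tau| <= dl n -> `|s - t| <= dl n / m%:R ->
    mean_le P (fun w => (N s w - N t w) ^+ 2) ((dl n `^ gamma ^+ 2 * dl n) ^+ 2)].
Proof.
have q0 : 0 < dl n `^ gamma by rewrite powR_gt0.
have [eV eV0 HV] := V_cont (dl n `^ gamma * dl n ^+ 2) (mulr_gt0 q0 (exprn_gt0 _ (dl0 n))).
have l0 : 0 < dl n `^ gamma ^+ 2 * dl n by rewrite mulr_gt0// exprn_gt0.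
have [eN eN0 HN] := N_cont ((dl n `^ gamma ^+ 2 * dl n) ^+ 2) (exprn_gt0 _ l0).
pose a := (dl n)^-1 + dl n / eV + dl n / eN.
have a1 : 0 < (dl n)^-1 by rewrite invr_gt0.
have a2 : 0 < dl n / eV by rewrite divr_gt0.
have a3 : 0 < dl n / eN by rewrite divr_gt0.
have a0 : 0 <= a by rewrite /a; lra.
have am := archi_boundP a0; set m := Num.bound a in am.
have m0 : 0 < m%:R :> R by apply: le_lt_trans am.
exists m; split.
- by rewrite -(ltr_nat R).
- by rewrite ler_pdivrMr// mul1r ltW// (le_lt_trans _ am)// /a; lra.
- move=> s t st tt dst; apply: HV; [exact: le_trans st _|exact: le_trans tt _|].
  apply: (le_trans dst); rewrite ler_pdivrMr// mulrC -ler_pdivrMr//.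
  by rewrite ltW// (le_lt_trans _ am)// /a; lra.
- move=> s t st tt dst; apply: HN; [exact: le_trans st _|exact: le_trans tt _|].
  apply: (le_trans dst); rewrite ler_pdivrMr// mulrC -ler_pdivrMr//.
  by rewrite ltW// (le_lt_trans _ am)// /a; lra.
Qed.

Let far n (x : R) : R := \1_[set x | (dl n)^-1 <= `|x|] x * (`|K x| * `|x| `^ gamma).

Let near_dl (c : R) : 0 < c -> \forall n \near \oo, dl n < c.
Proof.
move=> c0; apply: filterS ((cvgr0Pnorm_lt dl).1 dl_cvg c c0) => n.
by rewrite gtr0_norm.
Qed.

Let near_rho (x : R) : \forall n \near \oo, `|x| < (dl n)^-1.
Proof.
have x1 : 0 < `|x| + 1 by rewrite ltr_wpDl.
have c0 : 0 < (`|x| + 1)^-1 by rewrite invr_gt0.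
apply: filterS (near_dl _ c0) => n.
rewrite -ltf_pV2 ?posrE// invrK; apply: lt_trans.
by rewrite ltrDl.
Qed.

Let far_bound n : mean_le mu (far n) kap /\ forall x, 0 <= far n x <= `|K x| * weight gamma x.
Proof.
have B x : 0 <= far n x <= `|K x| * weight gamma x.
  rewrite /far indicE; case: (x \in _) => /=; last first.
    by rewrite mul0r lexx mulr_ge0// weight_ge0.
  rewrite mul1r mulr_ge0 ?powR_ge0//= ler_wpM2l//.
  by apply: powR_shift_le_weight => //; rewrite lerDl.
split=> //; apply: (mean_le_mono mu _ _ _ _ B iK).
apply: measurable_funM.
  apply: measurable_indic.
  have -> : [set x : R | (dl n)^-1 <= `|x|] = (fun x => `|x|) @^-1` `[(dl n)^-1, +oo[.
    by apply/seteqP; split=> w /=; rewrite in_itv/= andbT.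
  by rewrite -[X in measurable X]setTI; apply: (@normr_measurable R setT).
apply: measurable_funM; first exact: measurableT_comp.
by apply: (measurableT_comp (measurable_powR gamma)); exact: (@normr_measurable R setT).
Qed.

(** At each x the integrand vanishes as soon as 1/dl exceeds |x|, and it is dominated by |K| times
    the envelope. *)
Lemma tail_cvg : \int[mu]_x far n x @[n --> \oo] --> 0.
Proof.
have mf n : measurable_fun setT (far n) by case: (far_bound n) => -[].
have := @dominated_convergence _ _ R mu setT measurableT
  (fun n x => (far n x)%:E) (fun=> 0%E) (fun x => (`|K x| * weight gamma x)%:E).
case.
- by move=> n; apply/measurable_EFinP; exact: mf.
- exact: measurable_cst.
- apply: aeW => x _; apply: cvg_near_cst; apply: filterS (near_rho x) => n H.
  by rewrite /far indicE memNset ?mul0r//= leNgt H.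
- exact: mean_le_integrable_ge0 iK.
- apply: aeW => x n _; case: (far_bound n) => _ /(_ x) /andP[h1 h2].
  by rewrite /= lee_fin ger0_norm.
move=> _ _; rewrite integral0 => H.
have {}H : (\int[mu]_x (far n x)%:E)%E @[n --> \oo] --> (0 : R)%:E := H.
exact: (fine_cvg H).
Qed.

Section chosen_mesh.
Context (m : nat -> nat).
Hypothesis m_mesh : forall n, [/\ (0 < m n)%N, (dl n)^-1 / (m n)%:R <= 1,
  forall s t, `|s - tau| <= dl n -> `|t - tau| <= dl n -> `|s - t| <= dl n / (m n)%:R ->
    mean_le P (fun w => `|V s w - V t w|) (dl n `^ gamma * dl n ^+ 2) &
  forall s t, `|s - tau| <= dl n -> `|t - tau| <= dl n -> `|s - t| <= dl n / (m n)%:R ->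
    mean_le P (fun w => (N s w - N t w) ^+ 2) ((dl n `^ gamma ^+ 2 * dl n) ^+ 2)].

Let m0 n : (0 < m n)%N. Proof. by case: (m_mesh n). Qed.
Let mesh1 n : (dl n)^-1 / (m n)%:R <= 1. Proof. by case: (m_mesh n). Qed.
Let mN' n t : `|t - tau| <= dl n -> measurable_fun setT (N t).
Proof. by move=> H; apply: mN; exact: le_trans H _. Qed.
Let N_bound' n t : `|t - tau| <= dl n ->
  mean_le P (fun w => (N t w - N tau w) ^+ 2) (kN * `|t - tau| `^ gamma).
Proof. by move=> H; apply: N_bound; exact: le_trans H _. Qed.

Notation S n := (grid_sum tau gamma K N (dl n) (m n)).
Notation Y n := (fun w => (dl n ^+ 2) `^ (- (gamma / 2)) * kernel_error K T tau V (dl n ^+ 2) w).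

Let far_mean n : mean_le mu (far n) (\int[mu]_x far n x).
Proof.
apply: integrable_mean_le; first exact: mean_le_integrable_ge0 (far_bound n).1.
by move=> x; case: (far_bound n) => _ /(_ x) /andP[].
Qed.

Let kernel_grid n := kernel_error_grid P T tau V K gamma kap M0 htau jV g0 mK iK V_bound
  (dl n) (m n) (dl0 n) (m0 n) (le_trans (dle0 n) e0tau)
  (le_trans (lerD (lexx tau) (dle0 n)) e0T) (let: And4 _ _ H _ := m_mesh n in H)
  _ (far_mean n).

Lemma measurable_normalized_kernel_error n : measurable_fun setT (Y n).
Proof. by apply: measurable_funM => //; exact: (kernel_grid n).1. Qed.

Lemma measurable_grid_sums n : measurable_fun setT (S n).
Proof. exact: (measurable_grid_sum tau gamma K N (dl n) (m n) (dl0 n) (m0 n) (mN' n)). Qed.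

(** Two errors: the discretization of [V], which tends to 0 by [kernel_error_grid] and [tail_cvg],
    and the replacement of each grid increment of [V] by its first-order term, at most [eta * kap]
    by [grid_weight_times]. *)
Lemma kernel_error_approx (A e : R) : 0 < A -> 0 < e -> \forall n \near \oo,
  mean_le P (fun w => \1_[set w | `|G w| <= A] w * `|Y n w - k (G w) * S n w|) e.
Proof.
move=> A0 ee0.
have kap0 : 0 <= kap := mean_le_ge0 _ _ _ iK.
have M00 : 0 <= M0.
  by apply: mean_le_ge0 (V_bound tau _); case/andP: htau => a b; rewrite (ltW a) (ltW b).
have B : dl n ^+ 2 * kap + M0 * \int[mu]_x far n x @[n --> \oo] --> 0.
  rewrite [X in _ --> X](_ : 0 = 0 ^+ 2 * kap + M0 * 0); last by rewrite expr0n/= mul0r mulr0 addr0.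
  apply: cvgD; last by apply: cvgMr; exact: tail_cvg.
  apply: cvgMl; under eq_fun do rewrite expr2; rewrite expr2.
  exact: cvgM.
have e20 : 0 < e / 2 by rewrite divr_gt0.
have k10 : 0 < kap + 1 by rewrite ltr_wpDl.
pose eta := e / 2 / (kap + 1).
have eta0 : 0 < eta by rewrite divr_gt0.
have [ep ep0 HV] := V_approx A eta A0 eta0.
have mA : measurable [set w | `|G w| <= A].
  have -> : [set w | `|G w| <= A] = ~` [set w | A < `|G w|].
    by apply/seteqP; split=> w /=; rewrite leNgt => /negP.
  by apply: measurableC; exact: measurable_lt_norm.
have mk : measurable_fun setT k by exact: continuous_measurable_fun.
have mkG : measurable_fun setT (fun w => k (G w)) by exact: (measurableT_comp mk).
have m1 : measurable_fun setT (\1_[set w | `|G w| <= A] : Omega -> R) by exact: measurable_indic.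
apply: filterS2 (near_dl ep ep0) ((cvgr0Pnorm_lt _).1 B (e / 2) e20) => n dn Bn.
set t := grid_time tau (dl n) (m n).
pose D i w := V (t i) w - V tau w - k (G w) * (N (t i) w - N tau w).
have HD i : (i < 2 * m n)%N -> measurable_fun setT (D i) /\
    mean_le P (fun w => \1_[set w | `|G w| <= A] w * `|D i w|)
      (eta * `|t i - tau| `^ (gamma / 2)).
  move=> im; have it : `|t i - tau| <= dl n by apply: grid_time_norm => //; exact: ltnW.
  split; last by apply: HV; rewrite (le_trans it)// ltW.
  apply: measurable_funB; first apply: measurable_funB.
  - apply: (measurable_path T V jV); apply: (grid_time_itv T) => //; last exact: ltnW.
      exact: le_trans (dle0 n) e0tau.
    exact: (le_trans (lerD (lexx tau) (dle0 n)) e0T).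
  - by apply: (measurable_path T V jV); case/andP: htau => a b; rewrite (ltW a) (ltW b).
  - apply: measurable_funM => //; apply: measurable_funB; apply: (mN' n) => //.
    by rewrite subrr normr0 ltW.
have ind0 (w : Omega) : 0 <= \1_[set w | `|G w| <= A] w :> R by rewrite indicE.
have H1 := grid_weight_times P tau K gamma kap g0 mK iK (dl n) (m n) (dl0 n) (m0 n) (mesh1 n)
  (\1_[set w | `|G w| <= A]) D eta (ltW eta0) ind0 m1 HD.
have H2 := (kernel_grid n).2.
apply: mean_le_mono (mean_leW P _ _ e (mean_leD P _ _ _ _ H2 H1) _).
- apply: measurable_funM => //; apply: measurableT_comp => //.
  apply: measurable_funB; first exact: measurable_normalized_kernel_error.
  by apply: measurable_funM => //; exact: measurable_grid_sums.
- move=> w; rewrite mulr_ge0//=.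
  set SV := \sum_(i < 2 * m n) grid_weight K gamma (dl n) (m n) i * (V (t i) w - V tau w).
  have E : \sum_(i < 2 * m n) grid_weight K gamma (dl n) (m n) i * D i w = SV - k (G w) * S n w.
    rewrite /SV /grid_sum mulr_sumr -sumrB; apply: eq_bigr => i _.
    by rewrite /D; ring.
  rewrite E indicE; case: (w \in _); rewrite ?mul0r ?mul1r ?addr0//.
  have -> : Y n w - k (G w) * S n w = (Y n w - SV) + (SV - k (G w) * S n w) by ring.
  exact: ler_normD.
- have : eta * kap <= e / 2.
    rewrite /eta -mulrA ler_piMr ?(ltW e20)// mulrC ler_pdivrMr// mul1r.
    by rewrite lerDl.
  by move: Bn; rewrite ltr_norml => /andP[_]; lra.
Qed.

(** Homogeneity turns C at (dl^2 x, dl^2 y) into q^2 C(x, y), and the remainder of the covariance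
    expansion scales by the same q^2, which the normalisation removes. *)
Lemma scaled_covariance_cvg (x y : R) :
  grid_covariance P tau gamma N (dl n) (m n) x y @[n --> \oo] --> L * C x y.
Proof.
have kN0 : 0 <= kN.
  have t1 : `|tau + e0 - tau| <= e0 by rewrite addrAC subrr add0r gtr0_norm.
  have := mean_le_ge0 P _ _ (N_bound _ t1).
  by rewrite addrAC subrr add0r gtr0_norm// pmulr_lge0// powR_gt0.
apply/cvgrPdist_le => e ee0.
pose z := (x ^+ 2 + y ^+ 2) `^ (gamma / 2).
have z0 : 0 <= z by exact: powR_ge0.
pose eta := e / 2 / (z + 1).
have eta0 : 0 < eta by rewrite divr_gt0 ?divr_gt0// ltr_wpDl.
have [ep ep0 HN] := N_cov eta eta0.
have c1 : 0 < e / 2 / (1 + kN) by rewrite divr_gt0 ?divr_gt0// ltr_wpDr.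
have smallx (u : R) : \forall n \near \oo, `|dl n ^+ 2 * u| <= ep.
  have c2 : 0 < ep / (`|u| + 1) by rewrite divr_gt0// ltr_wpDl.
  apply: filterS (near_dl _ c2) => n H.
  rewrite normrM ger0_norm ?sqr_ge0//.
  have d1 : dl n ^+ 2 <= dl n by rewrite expr2 ler_piMr ?(ltW (dl0 n))// (le_trans (dle0 n)).
  apply: (@le_trans _ _ (dl n * `|u|)); first by rewrite ler_wpM2r.
  apply: (@le_trans _ _ (ep / (`|u| + 1) * `|u|)); first by rewrite ler_wpM2r// ltW.
  rewrite -mulrA ler_piMr ?(ltW ep0)// mulrC ler_pdivrMr ?ltr_wpDl// mul1r.
  by rewrite lerDl.
near=> n.
have nx : `|x| < (dl n)^-1 by near: n; exact: near_rho.
have ny : `|y| < (dl n)^-1 by near: n; exact: near_rho.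
have sx : `|dl n ^+ 2 * x| <= ep by near: n; exact: smallx.
have sy : `|dl n ^+ 2 * y| <= ep by near: n; exact: smallx.
have sd : dl n < e / 2 / (1 + kN) by near: n; exact: near_dl.
have q0 : 0 < dl n `^ gamma by rewrite powR_gt0.
have [_ _ _ Nm] := m_mesh n.
have := grid_covariance_close P tau gamma kN N (dl n) (m n) g0 (dl0 n) (m0 n) (mN' n)
  (N_bound' n) Nm (le_trans (dle0 n) e01) x y nx ny.
have := HN _ _ sx sy; set c := \int[P]_w _; set gc := grid_covariance _ _ _ _ _ _ _ _.
have h0 : 0 < dl n ^+ 2 by rewrite exprn_gt0.
rewrite (C_hom _ _ _ h0) !exprMn -mulrDr.
have hq : (dl n ^+ 2) `^ gamma = dl n `^ gamma ^+ 2.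
  by rewrite expr2 powRM ?(ltW (dl0 n))// expr2.
have -> : (dl n ^+ 2 ^+ 2 * (x ^+ 2 + y ^+ 2)) `^ (gamma / 2) = dl n `^ gamma ^+ 2 * z.
  rewrite powRM ?sqr_ge0//; last by rewrite addr_ge0 ?sqr_ge0.
  congr (_ * _); rewrite -hq -[in LHS]powR_mulrn ?sqr_ge0// -powRrM.
  by congr (_ `^ _); field.
rewrite hq; set q := dl n `^ gamma in q0 * => H1 H2.
have q20 : 0 < q ^+ 2 by rewrite exprn_gt0.
have {}H1 : `|q ^- 2 * c - L * C x y| <= eta * z.
  have -> : q ^- 2 * c - L * C x y = q ^- 2 * (c - L * (q ^+ 2 * C x y)).
    by field; rewrite gt_eqF.
  rewrite normrM ger0_norm ?invr_ge0 ?(ltW q20)// mulrC ler_pdivrMr//.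
  by rewrite (le_trans H1)// mulrCA mulrC.
have {}H2 : `|gc - q ^- 2 * c| <= e / 2.
  rewrite (le_trans H2)// -ler_pdivlMr ?ltr_wpDr// ltW//.
have ez : eta * z <= e / 2.
  rewrite /eta -mulrA ler_piMr ?divr_ge0 ?(ltW ee0)// mulrC ler_pdivrMr ?ltr_wpDl// mul1r.
  by rewrite lerDl.
have -> : L * C x y - gc = - ((gc - q ^- 2 * c) + (q ^- 2 * c - L * C x y)) by ring.
by rewrite normrN (le_trans (ler_normD _ _))//; lra.
Unshelve. all: by end_near. Qed.

(** Dominated convergence on the product space, with pointwise limit from [scaled_covariance_cvg]
    and envelope from [grid_covariance_bound]. *)
Lemma grid_sum_variance_cvg :
  \int[P]_w (S n w ^+ 2) @[n --> \oo] --> L * kernel_form K C.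
Proof.
pose F n (p : R * R) := K p.1 * K p.2 * grid_covariance P tau gamma N (dl n) (m n) p.1 p.2.
have gv n := grid_variance P tau gamma kap kN K N (dl n) (m n) g0 mK iK (dl0 n) (m0 n) (mN' n) (N_bound' n).
have iK' := mean_le_integrable_ge0 mu _ _ iK.
have [ig _] := integrable_tensor mu mu _ _ iK' iK'.
have mF n : measurable_fun setT (F n).
  by case: (gv n) => /integrableP[/measurable_EFinP].
have cF p : F n p @[n --> \oo] --> K p.1 * K p.2 * (L * C p.1 p.2).
  by apply: cvgMr; exact: scaled_covariance_cvg.
have mlim : measurable_fun setT (fun p : R * R => K p.1 * K p.2 * (L * C p.1 p.2)).
  exact: (measurable_fun_cvg mF (fun p _ => cF p)).
have := @dominated_convergence _ _ R (mu \x mu)%E setT measurableT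
  (fun n p => (F n p)%:E) (fun p => (K p.1 * K p.2 * (L * C p.1 p.2))%:E)
  (fun p => (kN * ((`|K p.1| * weight gamma p.1) * (`|K p.2| * weight gamma p.2)))%:E).
case.
- by move=> n; apply/measurable_EFinP; exact: mF.
- exact/measurable_EFinP.
- by apply: aeW => p _; apply: cvg_EFin; [exact: nearW|exact: cF].
- exact: (integrableZl measurableT kN ig).
- apply: aeW => p n _ /=; rewrite lee_fin /F (normrM (K p.1 * K p.2)) (normrM (K p.1)).
  have B := grid_covariance_bound P tau gamma kN N (dl n) (m n) g0 (dl0 n) (m0 n) (mesh1 n) (mN' n) (N_bound' n) p.1 p.2.
  apply: (le_trans (ler_wpM2l (mulr_ge0 (normr_ge0 (K p.1)) (normr_ge0 (K p.2))) B)).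
  by rewrite le_eqVlt; apply/orP; left; apply/eqP; ring.
move=> ilim _ cv.
have E : \int[(mu \x mu)%E]_p (K p.1 * K p.2 * (L * C p.1 p.2)) = L * kernel_form K C.
  (* Domination gives integrability of K K (L C), from which that of K K C follows on dividing by
     [L]; for L = 0 both sides are zero. *)
  have [->|L0] := eqVneq L 0.
    rewrite mul0r; under eq_Rintegral do rewrite mul0r mulr0.
    by rewrite /Rintegral integral0.
  have iKC : (mu \x mu)%E.-integrable setT (fun p => (K p.1 * K p.2 * C p.1 p.2)%:E).
    have := integrableZl measurableT L^-1 ilim.
    apply: eq_integrable => // p _; rewrite -EFinM; congr (_%:E).
    by field.
  rewrite /kernel_form -RintegralZl//; apply: eq_Rintegral => p _; ring.
rewrite -E; under eq_fun do rewrite -(gv _).2.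
apply: (fine_cvg (f := fun n => (\int[(mu \x mu)%E]_p (F n p)%:E)%E)).
rewrite fineK//; exact: (integrable_fin_num measurableT ilim).
Qed.

End chosen_mesh.
End mesh_sequence.

Notation S dl m n := (grid_sum tau gamma K N (dl n) (m n)).
Notation Y h := (fun w => h `^ (- (gamma / 2)) * kernel_error K T tau V h w)%R.
Notation v := (L * kernel_form K C).
Notation nu := (normal_prob 0 1 : probability (measurableTypeR R) R).
Notation P' := (P \x nu)%E.

Hypothesis trig : forall (dl : nat -> R) (m : nat -> nat) (a b c : R),
  (forall n, 0 < dl n) -> (forall n, dl n <= e0) -> dl @ \oo --> 0 ->
  (forall n, (0 < m n)%N) -> (forall n, (dl n)^-1 / (m n)%:R <= 1) ->
  \int[P]_w (S dl m n w ^+ 2) @[n --> \oo] --> v ->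
  \int[P]_w cos (a * G w + b * S dl m n w + c) @[n --> \oo] -->
  \int[P]_w cos (a * G w + c) * expR (- (b ^+ 2 * v) / 2).

(** The limit in the theorem is sqrt(k(G)^2 v) xi, with |k(G)| rather than k(G). Multiplying the
    normal variable by the sign of k(G) makes the two agree pointwise, and by symmetry leaves its
    conditional law unchanged. *)
Let sgk (w : Omega) : R := if k (G w) < 0 then -1 else 1.
Let Nlim (p : Omega * measurableTypeR R) : R := sgk p.1 * (Num.sqrt v * p.2).


Let m_sgk : measurable_fun setT sgk.
Proof.
have mkG : measurable_fun setT (fun w => k (G w)).
  by apply: (measurableT_comp _ mG); exact: continuous_measurable_fun.
apply: measurable_fun_ifT => //.
exact: (measurable_fun_ltr mkG (@measurable_cst _ _ _ _ setT (0 : R))).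
Qed.

(** The sign enters only through its square, so the conditional variance is b^2 v whatever [G]
    is. *)
Let cos_product (a b c : R) : 0 <= v ->
  \int[P']_p cos (a * G p.1 + b * Nlim p + c) =
  \int[P]_w cos (a * G w + c) * expR (- (b ^+ 2 * v) / 2).
Proof.
move=> v0; pose A w := a * G w + c; pose B w := b * sgk w * Num.sqrt v.
have mA : measurable_fun setT A by apply: measurable_funD => //; exact: measurable_funM.
have mB : measurable_fun setT B by apply: measurable_funM => //; exact: measurable_funM.
have E := Rintegral_cos_normal P A B mA mB.
have E1 : \int[P']_p cos (a * G p.1 + b * Nlim p + c) = \int[P']_p cos (A p.1 + B p.1 * p.2).
  apply: eq_Rintegral => p _; congr cos; rewrite /A /B /Nlim; ring.
have B2 w : B w ^+ 2 = b ^+ 2 * v.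
  rewrite /B !exprMn sqr_sqrtr//; congr (_ * _); rewrite /sgk.
  by case: ifP => _; rewrite ?sqrrN expr1n mulr1.
apply: (etrans E1); apply: (etrans E).
have mcos : measurable_fun setT (@cos R).
  by apply: continuous_measurable_fun; exact: continuous_cos.
rewrite -RintegralZr//; last first.
  apply: (bounded_integrable P _ 1); first exact: measurableT_comp.
  by move=> w; rewrite ler_norml cos_geN1 cos_le1.
by apply: eq_Rintegral => w _; rewrite B2 mulrC.
Qed.

(** The second moments converge, hence are bounded, and Chebyshev's inequality applies. *)
Lemma grid_sums_tight (dl : nat -> R) (m : nat -> nat) :
  (forall n, mean_le P (fun w => S dl m n w ^+ 2) (\int[P]_w (S dl m n w ^+ 2))) ->
  \int[P]_w (S dl m n w ^+ 2) @[n --> \oo] --> v ->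
  (forall n, measurable_fun setT (S dl m n)) ->
  forall e : R, 0 < e -> exists2 A : R, 0 < A & forall n,
    mean_le P (\1_[set w | A < `|S dl m n w|]) e.
Proof.
move=> HS cS mS e ee0.
have [D D0 HD] : exists2 D : R, 0 < D & forall n, \int[P]_w (S dl m n w ^+ 2) <= D.
  have /cvg_seq_bounded[D [_ HD]] : cvgn (fun n => \int[P]_w (S dl m n w ^+ 2)).
    by apply/cvg_ex; exists v.
  exists (`|D| + 1); first by rewrite ltr_wpDl.
  move=> n; apply: (le_trans (ler_norm _)); apply: HD => //.
  by rewrite (le_lt_trans (ler_norm D))// ltrDl.
(* The summand 1 gives A >= 1, so |S| > A implies S^2 >= |S| > A, and the indicator is at most S^2 /
   A. *)
pose A := D / e + 1.
have De : 0 < D / e by rewrite divr_gt0.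
have A0 : 0 < A by rewrite /A; lra.
exists A => // n.
have iA0 : 0 <= A^-1 by rewrite invr_ge0 ltW.
have Ae : A^-1 * \int[P]_w (S dl m n w ^+ 2) <= e.
  rewrite mulrC ler_pdivrMr//; apply: (le_trans (HD n)).
  by rewrite /A mulrDr mulr1 mulrC divfK ?gt_eqF// lerDl ltW.
apply: mean_le_mono (mean_leW P _ _ e (mean_leZ P _ _ A^-1 iA0 (HS n)) Ae).
  by apply: measurable_indic; exact: measurable_lt_norm.
move=> w; rewrite indicE; have [|_] := boolP (w \in _); last first.
  by rewrite lexx mulr_ge0// sqr_ge0.
rewrite inE /= => Sw; rewrite ler01/= mulrC ler_pdivlMr// mul1r.
rewrite -(real_normK (num_real (S dl m n w))).
have A1 : 1 <= A by rewrite /A; lra.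
apply: (le_trans (ltW Sw)); rewrite expr2 ler_peMl//.
by rewrite (le_trans A1)// ltW.
Qed.

(** The limit at 0 from the right is tested along sequences u of positive bandwidths, with [dl n]
    the square root of the bandwidth; the first [n0] terms are dropped so that the time window stays
    within distance [e0] of [tau]. Then [cvg_mixture] applies to the grid sums. *)
Lemma mixed_normal_limit phi M : continuous phi -> (forall x, `|phi x| <= M) ->
  \int[P]_w phi (Y h w) @[h --> 0^'+] -->
  \int[P']_p phi (Num.sqrt (k (G p.1) ^+ 2 * v) * p.2).
Proof.
move=> cphi bphi.
apply/cvg_at_rightP => u [u0 ucvg].
have su : Num.sqrt (u n) @[n --> \oo] --> 0.
  rewrite -[X in _ --> X](sqrtr0 R).
  have H := @sqrt_continuous R 0; exact: (cvg_comp _ _ ucvg H).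
have HN : \forall n \near \oo, Num.sqrt (u n) <= e0.
  apply: filterS ((cvgr0Pnorm_lt _).1 su e0 e00) => n.
  by rewrite ger0_norm ?sqrtr_ge0// => /ltW.
have [n0 _ Hn0] := HN.
rewrite -(cvg_shiftn n0).
pose dl n := Num.sqrt (u (n + n0)%N).
have dl0 n : 0 < dl n by rewrite sqrtr_gt0 u0.
have dle0 n : dl n <= e0 by apply: Hn0; rewrite /= leq_addl.
have dlu n : u (n + n0)%N = dl n ^+ 2 by rewrite sqr_sqrtr// ltW// u0.
have dlc : dl @ \oo --> 0 by rewrite -(cvg_shiftn n0) in su.
have /choice[m m_mesh] := mesh_exists dl dl0 dle0.
have vc := grid_sum_variance_cvg dl dl0 dle0 dlc m m_mesh.
have m0 n : (0 < m n)%N by case: (m_mesh n).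
have mesh1 n : (dl n)^-1 / (m n)%:R <= 1 by case: (m_mesh n).
have v0 : 0 <= v.
  apply: (cvgr_to_ge vc); apply: nearW => n.
  by apply: Rintegral_ge0 => w _; exact: sqr_ge0.
have mS := measurable_grid_sums dl dl0 dle0 m m_mesh.
have HS n : mean_le P (fun w => S dl m n w ^+ 2) (\int[P]_w (S dl m n w ^+ 2)).
  apply: integrable_mean_le; last by move=> w; exact: sqr_ge0.
  have mN' t : `|t - tau| <= dl n -> measurable_fun setT (N t).
    by move=> H; apply: mN; exact: le_trans H _.
  have N_bound' t : `|t - tau| <= dl n ->
      mean_le P (fun w => (N t w - N tau w) ^+ 2) (kN * `|t - tau| `^ gamma).
    by move=> H; apply: N_bound; exact: le_trans H _.
  by case: (grid_sum_sqr P tau gamma kN K N (dl n) (m n) (dl0 n) (m0 n) mN' N_bound').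
have trig' (a b c : R) : \int[P]_w cos (a * G w + b * S dl m n w + c) @[n --> \oo] -->
    \int[P']_p cos (a * G p.1 + b * Nlim p + c).
  have -> := cos_product a b c v0; exact: trig.
have mNlim : measurable_fun setT Nlim.
  apply: measurable_funM; first exact: (measurableT_comp m_sgk).
  by apply: measurable_funM => //; exact: measurable_snd.
have cv := @cvg_mixture _ _ _ _ R P P' G (fun n => S dl m n) (fun p => G p.1) Nlim mG mS
  (measurableT_comp mG measurable_fst) mNlim trig'
  (fun n w => (dl n ^+ 2) `^ (- (gamma / 2)) * kernel_error K T tau V (dl n ^+ 2) w)
  k phi M (measurable_normalized_kernel_error dl dl0 dle0 m m_mesh) ck cphi bphi
  (grid_sums_tight dl m HS vc mS) (kernel_error_approx dl dl0 dle0 dlc m m_mesh).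
have -> : [sequence \int[P]_w phi (Y (u (n + n0)%N) w)]_n =
    (fun n => \int[P]_w phi ((dl n ^+ 2) `^ (- (gamma / 2)) *
      kernel_error K T tau V (dl n ^+ 2) w)).
  by apply/funext => n; rewrite /= dlu.
have E : \int[P']_p phi (Num.sqrt (k (G p.1) ^+ 2 * v) * p.2) =
    \int[P']_p phi (k (G p.1) * Nlim p).
  apply: eq_Rintegral => p _; congr phi; rewrite /Nlim sqrtrM ?sqr_ge0// sqrtr_sqr -mulrA [in RHS]mulrA.
  congr (_ * _); rewrite /sgk; case: ltP => h.
    by rewrite ltr0_norm// mulrN1.
  by rewrite ger0_norm// mulr1.
by rewrite E.
Qed.

(** The measurability already obtained along mesh sequences is applied to a constant sequence. *)
Lemma near_measurable_kernel_error :
  \forall h \near 0^'+, measurable_fun setT (Y h).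
Proof.
have e2 : 0 < e0 ^+ 2 by rewrite exprn_gt0.
near=> h.
have h0 : 0 < h by [].
have he : Num.sqrt h <= e0.
  rewrite -(ler_pXn2r (_ : (0 < 2)%N)) ?nnegrE ?sqrtr_ge0 ?(ltW e00)//.
  by rewrite sqr_sqrtr ?(ltW h0)//; near: h; exact: nbhs_right_le.
have dl0 (n : nat) : 0 < (fun=> Num.sqrt h) n by rewrite sqrtr_gt0.
have dle0 (n : nat) : (fun=> Num.sqrt h) n <= e0 by [].
have /choice[m m_mesh] := mesh_exists (fun=> Num.sqrt h) dl0 dle0.
have := measurable_normalized_kernel_error (fun=> Num.sqrt h) dl0 dle0 m m_mesh 0%N.
by rewrite sqr_sqrtr// ltW.
Unshelve. all: by end_near. Qed.

Lemma mixed_normal_cvg : cvg_in_distribution P'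
  (fun h p => Y h p.1) (fun p => Num.sqrt (k (G p.1) ^+ 2 * v) * p.2).
Proof.
move=> phi cphi [M bphi].
have mphi : measurable_fun setT phi by exact: continuous_measurable_fun.
have mlim : measurable_fun setT (fun p : Omega * measurableTypeR R =>
    phi (Num.sqrt (k (G p.1) ^+ 2 * v) * p.2)).
  apply: (measurableT_comp mphi); apply: measurable_funM; last exact: measurable_snd.
  apply: (@measurableT_comp _ _ _ _ _ _ (@Num.sqrt R)).
    by apply: continuous_measurable_fun; exact: sqrt_continuous.
  apply: measurable_funM => //; apply: measurable_funX.
  apply: (@measurableT_comp _ _ _ _ _ _ k); first exact: continuous_measurable_fun.
  exact: (measurableT_comp mG measurable_fst).
have lim := mixed_normal_limit phi M cphi bphi.
have Elim : 'E_P'[phi \o (fun p => (Num.sqrt (k (G p.1) ^+ 2 * v) * p.2)%R)]%E =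
    (\int[P']_p phi (Num.sqrt (k (G p.1) ^+ 2 * v) * p.2))%:E.
  rewrite unlock /Rintegral fineK//; apply: (integrable_fin_num measurableT).
  exact: (bounded_integrable P' _ M mlim (fun p => bphi _)).
rewrite Elim.
have Enear : \forall h \near 0^'+,
    (\int[P]_w phi (Y h w))%:E = 'E_P'[phi \o (fun p => (Y h p.1)%R)]%E.
  apply: filterS near_measurable_kernel_error => h mY.
  have mY' : measurable_fun setT (fun w => phi (Y h w)) by exact: measurableT_comp.
  rewrite unlock; have E := integral_product_fst P nu (fun w => (phi (Y h w))%:E).
  apply/esym; apply: (etrans (E _)); first exact/measurable_EFinP.
  rewrite /Rintegral fineK//; apply: (integrable_fin_num measurableT).
  exact: (bounded_integrable P _ M).
apply: cvg_trans; first apply: (near_eq_cvg Enear).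
by apply: cvg_EFin; [exact: nearW|exact: lim].
Qed.

End discretization_limit.

(** * Admissible kernels: measurability and weighted integrability *)

Section kernel_facts.
Context {R : realType}.
Notation mu := (@lebesgue_measure R).

(** The kernel is Lipschitz, hence continuous, on the open interval, and zero off its closure; the
    end points contribute at most two singletons. *)
Lemma measurable_kernel (gamma : R) C (K : R -> R) :
  admissible_kernel gamma C K -> measurable_fun setT K.
Proof.
case=> _ [A [B [/andP[A0 B0] supp [k lipK] _]]] _ _.
pose I := [set x : R | (A < x%:E < B)%E].
have oI : open I.
  have -> : I = [set x | (A < x%:E)%E] `&` [set x | (x%:E < B)%E].
    by apply/seteqP; split=> x /andP.
  by apply: openI; [exact: open_ereal_gt|exact: open_ereal_lt].
have mI : measurable (I : set (measurableTypeR R)) by exact: open_measurable.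
(* For an infinite end point [fine] returns 0, and excluding that point too does no harm. *)
have K0 x : ~ I x -> x != fine A -> x != fine B -> K x = 0.
  move=> nIx xA xB; apply/eqP; apply: contrapT => /negP Kx.
  have clx : closure I x by rewrite -supp; exact: subset_closure.
  have [U [oU Ux UI]] : exists U : set R, [/\ open U, U x & forall y, U y -> ~ I y].
    have [Ax|Ax] := leP x%:E A.
      exists [set y | (y%:E < A)%E]; split; first exact: open_ereal_lt.
        rewrite /= lt_neqAle Ax andbT; move: A0 Ax xA; case: (A) => [a _ _ xa| |//]; first by rewrite eqe.
          by rewrite ltNge leey.
      by move=> y /= yA /andP[/(lt_trans yA)]; rewrite ltxx.
    exists [set y | (B < y%:E)%E]; split; first exact: open_ereal_gt.
      have Bx : (B <= x%:E)%E by rewrite leNgt; apply/negP => xB'; apply: nIx; rewrite /I/= Ax.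
      rewrite /= lt_neqAle Bx andbT; move: B0 Bx xB; case: (B) => [b _ _ xb|//|].
        by rewrite eqe eq_sym.
      by rewrite ltNge leNye.
    by move=> y /= yB /andP[_ /(lt_trans yB)]; rewrite ltxx.
  by have [y [/UI]] := clx U (open_nbhs_nbhs (conj oU Ux)).
have m1 (a : R) : measurable ([set a] : set (measurableTypeR R)) by exact: measurable_set1.
pose D : set R := I `|` ([set fine A] `|` [set fine B]).
have mD : measurable (D : set (measurableTypeR R)).
  by apply: measurableU => //; exact: measurableU.
have -> : [set: R] = D `|` ~` D by rewrite setUv.
apply/measurable_funU => //; first exact: measurableC.
split; last first.
  have E : {in ~` D, cst 0 =1 K}.
    move=> x; rewrite inE /D /= => /not_orP[nI /not_orP[xA xB]].
    by rewrite K0//; apply/eqP.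
  exact: (eq_measurable_fun _ E).
apply/measurable_funU => //; first exact: measurableU.
split; last by apply/measurable_funU => //; split; exact: measurable_fun_set1.
apply: open_continuous_measurable_fun => // x; rewrite inE => Ix.
apply/cvgrPdist_le => e e0.
have k1 : 0 < `|k| + 1 by rewrite ltr_wpDl.
have ek : 0 < e / (`|k| + 1) by rewrite divr_gt0.
near=> y.
have Iy : I y by near: y; exact: (open_nbhs_nbhs (conj oI Ix)).
have xy : `|x - y| <= e / (`|k| + 1).
  by near: y; apply/nbhs_ballP; exists (e / (`|k| + 1)) => // z; rewrite /ball/= => /ltW.
apply: (le_trans (lipK _ _ Ix Iy)).
apply: (@le_trans _ _ ((`|k| + 1) * `|x - y|)).
  by rewrite ler_wpM2r// (le_trans (ler_norm k))// lerDl.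
by rewrite mulrC -ler_pdivlMr.
Unshelve. all: by end_near. Qed.

(** In the extended reals the positive and negative parts cannot differ by 1 if either of them is
    infinite, oo - oo included. *)
Lemma integrable_of_integral_eq1 (K : R -> R) : measurable_fun setT K ->
  (\int[mu]_x (K x)%:E = 1)%E -> mu.-integrable setT (EFin \o K).
Proof.
move=> mK; rewrite integralE => K1.
have mKE : measurable_fun setT (EFin \o K) by exact/measurable_EFinP.
apply/integrableP; split => //.
have -> : (\int[mu]_x `|(EFin \o K) x| =
    \int[mu]_x (EFin \o K)^\+ x + \int[mu]_x (EFin \o K)^\- x)%E.
  rewrite -ge0_integralD//; [|exact: measurable_funepos|exact: measurable_funeneg].
  by apply: eq_integral => x _; exact: (congr1 (fun g => g x) (fune_abse (EFin \o K))).
have p0 : (0 <= \int[mu]_x (EFin \o K)^\+ x)%E by exact: integral_ge0.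
have n0 : (0 <= \int[mu]_x (EFin \o K)^\- x)%E by exact: integral_ge0.
have {}K1 : (\int[mu]_x (EFin \o K)^\+ x - \int[mu]_x (EFin \o K)^\- x = 1)%E := K1.
move: K1 p0 n0; move: (\int[mu]_x _)%E (\int[mu]_x (EFin \o K)^\- x)%E.
by move=> [p| |] [n| |] //= _ _ _; rewrite ltry.
Qed.

Lemma kernel_weight_mean (gamma : R) C (K : R -> R) :
  admissible_kernel gamma C K -> exists kap, mean_le mu (fun x => `|K x| * weight gamma x) kap.
Proof.
move=> hK; have mK := measurable_kernel _ _ _ hK.
case: hK => /(integrable_of_integral_eq1 _ mK) iK _ [Kg _ _ _ _] _.
have mg : measurable_fun setT (fun x : R => `|x| `^ gamma).
  by apply: (measurableT_comp (measurable_powR gamma)); exact: (@normr_measurable R setT).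
have mnK : measurable_fun setT (fun x => `|K x|) by exact: measurableT_comp.
have mKg : measurable_fun setT (fun x => `|K x| * `|x| `^ gamma) by exact: measurable_funM.
have H1 := integrable_mean_le mu _ (integrable_norm iK) (fun w => normr_ge0 _).
have iKg : mu.-integrable setT (EFin \o (fun x => `|K x| * `|x| `^ gamma)).
  apply/integrableP; split; first exact/measurable_EFinP.
  apply: le_lt_trans Kg; rewrite le_eqVlt; apply/orP; left; apply/eqP.
  by apply: eq_integral => x _; rewrite /= ger0_norm// mulr_ge0// powR_ge0.
have H2 := integrable_mean_le mu _ iKg (fun w => mulr_ge0 (normr_ge0 _) (powR_ge0 _ _)).
have H := mean_leZ mu _ _ (2 `^ gamma) (powR_ge0 _ _) (mean_leD mu _ _ _ _ H1 H2).
eexists; apply: mean_le_mono H.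
  by apply: measurable_funM => //; exact: measurable_weight.
move=> x; rewrite mulr_ge0//=; last by rewrite mulr_ge0 ?addr_ge0 ?powR_ge0.
by rewrite /weight le_eqVlt; apply/orP; left; apply/eqP; ring.
Qed.

End kernel_facts.

(** * Extension by an independent standard normal coordinate *)

Section normal_extension.
Context {d} {Omega : measurableType d} {R : realType} (P : probability Omega R).
Notation nu := (normal_prob 0 1 : probability (measurableTypeR R) R).
Notation P' := (P \x nu)%E.

Let productE (A : set Omega) (B : set (measurableTypeR R)) :
  measurable A -> measurable B -> P' (A `*` B) = (P A * nu B)%E.
Proof. by move=> mA mB; exact: (product_measure1E P nu mA mB). Qed.

Let fstE (A : set Omega) : measurable A -> P' (fst @^-1` A) = P A.
Proof.
move=> mA; have -> : fst @^-1` A = A `*` [set: measurableTypeR R].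
  by apply/seteqP; split=> p //= [].
have E := productE A setT mA measurableT; apply: (etrans E).
have T1 : nu setT = 1%E by exact: probability_setT.
by apply: (etrans (congr1 (fun x => (P A * x)%E) T1)); rewrite mule1.
Qed.

Let sndE (B : set (measurableTypeR R)) : measurable B -> P' (snd @^-1` B) = nu B.
Proof.
move=> mB; have -> : snd @^-1` B = [set: Omega] `*` B.
  by apply/seteqP; split=> p //= [].
have E := productE setT B measurableT mB; apply: (etrans E).
by apply: (etrans (congr1 (fun x => (x * nu B)%E) (probability_setT P))); exact: mul1e.
Qed.

Lemma normal_extension : extension_of P P' fst.
Proof. by split; [exact: measurable_fst|exact: fstE]. Qed.

Lemma normal_extension_law : has_law P' (snd : Omega * measurableTypeR R -> R) (normal_prob 0 1).
Proof. by split; [exact: measurable_snd|exact: sndE]. Qed.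

Lemma normal_extension_independent (S : set_system (Omega * measurableTypeR R)) :
  S `<=` preimage_set_system setT fst measurable ->
  independent P' (sigma_var (snd : Omega * measurableTypeR R -> R)) S.
Proof.
move=> Sfst _ B [A mA <-] /Sfst[D mD <-]; rewrite !setTI.
have -> : snd @^-1` A `&` fst @^-1` D = D `*` A.
  by apply/seteqP; split=> p /= [].
have E := productE D A mD mA; apply: (etrans E).
have EA := sndE A mA; have ED := fstE D mD.
by apply: (etrans (muleC _ _)); exact: (esym (f_equal2 (fun x y => (x * y)%E) EA ED)).
Qed.

Lemma sigma_var_fst (Y : Omega -> R) : measurable_fun setT Y ->
  sigma_var (Y \o fst : Omega * measurableTypeR R -> R) `<=` preimage_set_system setT fst measurable.
Proof.
move=> mY _ [A mA <-]; exists (Y @^-1` A); last by rewrite comp_preimage.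
by rewrite -[X in measurable X]setTI; exact: mY.
Qed.

Lemma sigma_process_fst (Z : R -> Omega -> R) :
  (forall t, 0 <= t -> measurable_fun setT (Z t)) ->
  sigma_process (fun t => Z t \o fst : Omega * measurableTypeR R -> R)
    `<=` preimage_set_system setT fst measurable.
Proof.
move=> mZ; apply: smallest_sub.
  by apply: sigma_algebra_preimage; exact: sigma_algebra_measurable.
move=> A [t]; rewrite /= in_itv/= andbT => t0; exact: (sigma_var_fst _ (mZ t t0)).
Qed.

End normal_extension.

(** * Moments of the squared volatility *)

Section squared_volatility.
Context {d} {Omega : measurableType d} {R : realType} (P : probability Omega R).
Context (T : R) (mu sigma : R -> Omega -> R).
Hypothesis sigma_meas : jointly_measurable T sigma.

Lemma jointly_measurable_sqr : jointly_measurable T (fun t w => sigma t w ^+ 2).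
Proof. by rewrite /jointly_measurable; apply: measurable_funX. Qed.

Hypothesis mu_meas : jointly_measurable T mu.
Hypothesis moments : moment_bound P T mu sigma.

Lemma volatility_moment : exists M : R, 0 < M /\ forall t, 0 <= t <= T -> mean_le P (fun w => sigma t w ^+ 4) M.
Proof.
have [M [M1 HM]] := moments; exists M; split; first by rewrite (lt_trans _ M1).
move=> t tT.
have ms := measurable_path T sigma sigma_meas t tT.
have mm := measurable_path T mu mu_meas t tT.
have p4 (x : R) : 0 <= x ^+ 4 by rewrite (exprM x 2 2) sqr_ge0.
split; [exact: measurable_funX|by []|].
apply: (le_trans _ (ltW (HM t tT))); rewrite unlock.
apply: ge0_le_integral => //.
- by move=> w _; rewrite lee_fin.
- by apply/measurable_EFinP; exact: measurable_funX.
- by apply/measurable_EFinP; apply: measurable_funD; exact: measurable_funX.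
- by move=> w _; rewrite lee_fin lerDr.
Qed.

Lemma squared_volatility_bound (tau : R) : 0 <= tau <= T ->
  exists M0 : R, forall t, 0 <= t <= T ->
    mean_le P (fun w => `|sigma t w ^+ 2 - sigma tau w ^+ 2|) M0.
Proof.
move=> tauT; have [M [M0 HM]] := volatility_moment.
exists ((1 + M) + (1 + M)) => t tT.
have ms s (sT : 0 <= s <= T) := measurable_path T sigma sigma_meas s sT.
have c1 := mean_le_cst P 1 ler01.
apply: mean_le_mono (mean_leD P _ _ _ _ (mean_leD P _ _ _ _ c1 (HM t tT))
  (mean_leD P _ _ _ _ c1 (HM tau tauT))).
  apply: measurableT_comp => //; apply: measurable_funB; apply: measurable_funX; exact: ms.
move=> w; rewrite normr_ge0/=; apply: (le_trans (ler_normB _ _)).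
by rewrite !ger0_norm ?sqr_ge0// lerD// sqr_le_quartic.
Qed.

End squared_volatility.

(** * Factorization of means for independent variables *)

Section independence.
Context {d} {T : measurableType d} {R : realType} (P : probability T R).
Implicit Types (X D : T -> R).
Notation mR := (measurableTypeR R).

(** Independence says that the law of the pair agrees with the product measure on rectangles, and
    this determines it. *)
Lemma independent_joint_law X D (nu : probability mR R) : measurable_fun setT X ->
  has_law P D nu -> independent P (sigma_var X) (sigma_var D) ->
  exists Q : probability mR R, has_law P X Q /\
    forall f : R * R -> \bar R, measurable_fun setT f ->
      (\int[P]_w f (X w, D w) = \int[(Q \x nu)%E]_z f z)%E.
Proof.
move=> mX [mD lawD] ind.
have X_mfun : (X : T -> mR) \in (mfun : {pred T -> mR}) by rewrite inE; exact: mX.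
pose Q := distribution P (mfun_Sub X_mfun).
have QE (A : set mR) : Q A = P (X @^-1` A) by [].
exists Q; split => // f mf.
have mXD : measurable_fun setT (fun w => (X w, D w) : mR * mR) by apply: measurable_fun_pair.
have H (A : set (mR * mR)) : measurable A -> (Q \x nu)%E A = pushforward P (fun w => (X w, D w) : mR * mR) A.
  move=> mA.
  pose M : {measure set (mR * mR) -> \bar R} :=
    measure_function_pushforward__canonical__measure_function_Measure P mXD.
  have := @product_measure_unique _ _ mR mR R Q nu M; apply => //.
  move=> A1 B mA1 mB; rewrite /M /= /pushforward -lawD//; apply: ind.
    by exists A1 => //; rewrite setTI.
  by exists B => //; rewrite setTI.
have H0 (g : mR * mR -> \bar R) : measurable_fun setT g -> (forall z, (0 <= g z)%E) ->
    (\int[P]_w g (X w, D w) = \int[(Q \x nu)%E]_z g z)%E.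
  move=> mg g0.
  have E := @ge0_integral_pushforward _ _ T (mR * mR)%type R (fun w => (X w, D w) : mR * mR) mXD P setT g measurableT mg.
  have {}E := E (fun z _ => g0 z); apply: (etrans (esym E)).
  by apply: eq_measure_integral => A mA _; exact: (esym (H A mA)).
rewrite integralE [RHS]integralE; congr (_ - _)%E.
- have := H0 _ (measurable_funepos mf) (fun x => funepos_ge0 f x).
  by move=> <-; apply: eq_integral => p _; rewrite !funeposE.
- have := H0 _ (measurable_funeneg mf) (fun x => funeneg_ge0 f x).
  by move=> <-; apply: eq_integral => p _; rewrite !funenegE.
Qed.

Lemma centered_normal_law D (s : R) : 0 < s -> has_law P D (normal_prob 0 s) ->
  [/\ \int[P]_w D w = 0, mean_le P (fun w => D w ^+ 2) (s ^+ 2),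
      \int[P]_w (D w ^+ 2) = s ^+ 2 &
      forall b c, \int[P]_w cos (b * D w + c) = expR (- (b * s) ^+ 2 / 2) * cos c].
Proof.
move=> s0 lawD; have mD := lawD.1.
have HR (f : R -> R) : measurable_fun setT f ->
    \int[P]_w f (D w) = \int[normal_prob 0 1]_x f (s * x).
  move=> mf; have mEf : measurable_fun setT (EFin \o f) by exact/measurable_EFinP.
  have E1 := integral_law P D (normal_prob 0 s) _ lawD mEf.
  have E2 := integral_normal_affine 0 s _ s0 mEf.
  rewrite /Rintegral; congr fine; apply: (etrans E1); apply: (etrans E2).
  by apply: eq_integral => x _; rewrite add0r.
have is2 : (normal_prob 0 1).-integrable setT (EFin \o (fun x : R => s ^+ 2 * x ^+ 2)).
  exact: (integrableZl measurableT (s ^+ 2) normal_integrable_sqr).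
have E2 : \int[P]_w (D w ^+ 2) = s ^+ 2.
  apply: (etrans (HR (fun x => x ^+ 2) (measurable_funX 2 (@measurable_id _ _ setT)))).
  under eq_Rintegral do rewrite exprMn.
  by rewrite RintegralZl ?normal_sqr ?mulr1//; exact: normal_integrable_sqr.
split=> //.
- apply: (etrans (HR (fun x => x) (@measurable_id _ _ setT))).
  by rewrite RintegralZl ?normal_mean ?mulr0//; exact: normal_integrable_id.
- split; [exact: measurable_funX|by move=> w; exact: sqr_ge0|].
  have mEf : measurable_fun setT (EFin \o (fun x : R => x ^+ 2)).
    by apply/measurable_EFinP; exact: measurable_funX.
  have F1 := integral_law P D (normal_prob 0 s) _ lawD mEf.
  have F2 := integral_normal_affine 0 s _ s0 mEf.
  have F3 : (\int[P]_w (D w ^+ 2)%:E = \int[normal_prob 0 1]_x (s ^+ 2 * x ^+ 2)%:E)%E.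
    apply: (etrans F1); apply: (etrans F2); apply: eq_integral => x _.
    by rewrite /= add0r exprMn.
  have fin := integrable_fin_num measurableT is2.
  have fin' : (\int[P]_w (D w ^+ 2)%:E)%E \is a fin_num by rewrite F3.
  by rewrite -(fineK fin') lee_fin -/(Rintegral P setT (fun w => D w ^+ 2)) E2.
- move=> b c; rewrite (HR (fun x => cos (b * x + c))); last first.
    apply: (@measurableT_comp _ _ _ _ _ _ cos).
      by apply: continuous_measurable_fun; exact: continuous_cos.
    by apply: measurable_funD => //; exact: measurable_funM.
  have -> : (fun x : R => cos (b * (s * x) + c)) = (fun x => cos ((b * s) * x + c)).
    by apply/funext => x; congr cos; ring.
  exact: normal_cos.
Qed.

Section independent_pair.
Context (X D : T -> R) (nu : probability mR R).
Hypotheses (mX : measurable_fun setT X) (lawD : has_law P D nu).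
Hypothesis ind : independent P (sigma_var X) (sigma_var D).

Lemma independent_integral_mul (f g : R -> R) :
  measurable_fun setT f -> measurable_fun setT g ->
  P.-integrable setT (EFin \o (fun w => f (X w))) ->
  P.-integrable setT (EFin \o (fun w => g (D w))) ->
  P.-integrable setT (EFin \o (fun w => f (X w) * g (D w))) /\
  \int[P]_w (f (X w) * g (D w)) = \int[P]_w f (X w) * \int[P]_w g (D w).
Proof.
move=> mf mg iX iD.
have [Q [lawX H]] := independent_joint_law X D nu mX lawD ind.
have mD := lawD.1.
have law_int (Y : T -> R) (m : probability mR R) (h : R -> R) :
    measurable_fun setT h -> has_law P Y m ->
    P.-integrable setT (EFin \o (fun w => h (Y w))) ->
    m.-integrable setT (EFin \o h) /\ \int[P]_w h (Y w) = \int[m]_x h x.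
  move=> mh lawY /integrableP[_ iY].
  have mEh : measurable_fun setT (EFin \o h) by exact/measurable_EFinP.
  split; last by rewrite /Rintegral; congr fine; exact: (integral_law P Y m _ lawY mEh).
  apply/integrableP; split => //.
  have mnh : measurable_fun setT (fun x => `|(h x)%:E|%E) by exact: measurableT_comp.
  have E := integral_law P Y m _ lawY mnh.
  by apply: le_lt_trans iY; rewrite le_eqVlt; apply/orP; left; apply/eqP/esym; exact: E.
have [iQ EQ] := law_int X Q f mf lawX iX.
have [inu Enu] := law_int D nu g mg lawD iD.
have [iQn EQn] := integrable_tensor Q nu f g iQ inu.
have mp : measurable_fun setT (fun z : R * R => f z.1 * g z.2).
  by apply: measurable_funM; [exact: (measurableT_comp mf)|exact: (measurableT_comp mg)].
have mpE : measurable_fun setT (fun z : R * R => (f z.1 * g z.2)%:E) by exact/measurable_EFinP.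
have mpn : measurable_fun setT (fun z : R * R => `|(f z.1 * g z.2)%:E|%E) by exact: measurableT_comp.
split.
  apply/integrableP; split.
    apply/measurable_EFinP; apply: measurable_funM.
      exact: (measurableT_comp mf).
    exact: (measurableT_comp mg).
  have E := H _ mpn; apply: (@le_lt_trans _ _ (\int[(Q \x nu)%E]_z `|(f z.1 * g z.2)%:E|)%E).
    by rewrite le_eqVlt; apply/orP; left; apply/eqP; exact: E.
  by case/integrableP: iQn.
rewrite EQ Enu -EQn /Rintegral; congr fine; exact: (H _ mpE).
Qed.

End independent_pair.
End independence.

(** * Weighted sums of Brownian increments *)

Section brownian_sums.
Context {d} {Omega : measurableType d} {R : realType} (P : probability Omega R).
Context (F : R -> set_system Omega) (W : R -> Omega -> R).
Hypotheses (hF : complete_filtration P F) (hW : brownian_motion P F W).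

(** Measurability with respect to F_t, stated as ordinary measurability on the measurable space
    generated by [F t], so that closure under sums and products is inherited. *)
Definition known (t : R) (X : Omega -> R) : Prop :=
  measurable_fun [set: g_sigma_algebraType (F t)] X.

Let sF t : 0 <= t -> sigma_algebra setT (F t).
Proof. by case: hF => _ H _ _ _; exact: H. Qed.

Lemma knownE t X : 0 <= t -> known t X <-> sigma_var X `<=` F t.
Proof.
move=> t0; split=> [H _ [A mA <-]|H _ A mA].
  have := H measurableT A mA; rewrite /measurable/= sigma_algebra_id//; exact: sF.
by rewrite /measurable/= sigma_algebra_id; [apply: H; exists A|exact: sF].
Qed.

Lemma known_measurable t X : 0 <= t -> known t X -> measurable_fun setT X.
Proof.
move=> t0 /(knownE _ _ t0) H _ A mA.
by case: hF => _ _ Fm _ _; apply: (Fm t t0); apply: H; exists A.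
Qed.

Lemma known_mono s t X : 0 <= s -> s <= t -> known s X -> known t X.
Proof.
move=> s0 st; have t0 := le_trans s0 st; move=> /(knownE _ _ s0) H.
by apply/(knownE _ _ t0); case: hF => _ _ _ Fst _; apply: subset_trans H (Fst s t s0 st).
Qed.

Lemma known_cst t (k : R) : known t (fun=> k).
Proof. exact: measurable_cst. Qed.

Lemma knownD t X Y : known t X -> known t Y -> known t (fun w => X w + Y w).
Proof. exact: measurable_funD. Qed.

Lemma knownB t X Y : known t X -> known t Y -> known t (fun w => X w - Y w).
Proof. exact: measurable_funB. Qed.

Lemma knownM t X Y : known t X -> known t Y -> known t (fun w => X w * Y w).
Proof. exact: measurable_funM. Qed.

Lemma known_brownian t : 0 <= t -> known t (W t).
Proof. by move=> t0; apply/(knownE _ _ t0); case: hW => H _ _ _; exact: H. Qed.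

Section increment.
Context (s t : R) (s0 : 0 <= s) (st : s <= t).
Let D w := W t w - W s w.
Let t0 : 0 <= t := le_trans s0 st.

Lemma measurable_brownian_increment : measurable_fun setT D.
Proof.
by apply: measurable_funB; [apply: (known_measurable t)|apply: (known_measurable s)] => //;
  exact: known_brownian.
Qed.

Lemma brownian_increment_sqr :
  mean_le P (fun w => D w ^+ 2) (t - s) /\ \int[P]_w (D w ^+ 2) = t - s.
Proof.
move: st; rewrite le_eqVlt => /predU1P[E|lt].
  have -> : (fun w => D w ^+ 2) = fun=> 0.
    by apply/funext => w; rewrite /D E subrr expr0n.
  rewrite E subrr; split; first exact: mean_le0.
  by rewrite /Rintegral integral0.
have [_ _ _ H] := hW; have [lawD _] := H s t s0 lt.
have ts : 0 < t - s by rewrite subr_gt0.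
have q0 : 0 < Num.sqrt (t - s) by rewrite sqrtr_gt0.
have := centered_normal_law P D _ q0 lawD; rewrite sqr_sqrtr ?(ltW ts)//.
by case.
Qed.

Context (U : Omega -> R) (kU : known s U).
Let mU : measurable_fun setT U := known_measurable s U s0 kU.

Let indep : s < t -> independent P (sigma_var U) (sigma_var D).
Proof.
move=> lt; have [_ _ _ H] := hW; have [_ ind] := H s t s0 lt.
by move=> A B /((knownE _ _ s0).1 kU); exact: ind.
Qed.

(** The increment is independent of [U], so the cosine of the sum factors after applying the
    addition formula; the sine of a centred normal variable has mean zero. *)
Lemma brownian_increment_cos (b : R) :
  \int[P]_w cos (U w + b * D w) = expR (- (b ^+ 2 * (t - s)) / 2) * \int[P]_w cos (U w).
Proof.
move: st; rewrite le_eqVlt => /predU1P[E|lt].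
  rewrite E subrr mulr0 oppr0 mul0r expR0 mul1r; apply: eq_Rintegral => w _.
  by rewrite /D E subrr mulr0 addr0.
have [_ _ _ H] := hW; have [lawD _] := H s t s0 lt.
have ts : 0 < t - s by rewrite subr_gt0.
have q0 : 0 < Num.sqrt (t - s) by rewrite sqrtr_gt0.
have [_ _ _ Hcos] := centered_normal_law P D _ q0 lawD.
have mD := lawD.1.
have mcos : measurable_fun setT (@cos R).
  by apply: continuous_measurable_fun; exact: continuous_cos.
have maff (c : R) : measurable_fun setT (fun x : R => cos (b * x + c)).
  by apply: (measurableT_comp mcos); apply: measurable_funD => //; exact: measurable_funM.
have icos (f : R -> R) (Y : Omega -> R) : measurable_fun setT f -> measurable_fun setT Y ->
    (forall x, `|f x| <= 1) -> P.-integrable setT (EFin \o (fun w => f (Y w))).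
  move=> mf mY f1; apply: (bounded_integrable P (fun w => f (Y w)) 1) => //.
  exact: measurableT_comp.
have cos1 (x : R) : `|cos x| <= 1 by rewrite ler_norml cos_geN1 cos_le1.
have mshift : measurable_fun setT (fun x : R => cos (x - pi / 2)).
  by apply: (measurableT_comp mcos); exact: measurable_funB.
pose f (c : R) (x : R) := cos (x + c).
have mf c : measurable_fun setT (f c).
  by apply: (measurableT_comp mcos); exact: measurable_funD.
have i1 c := icos _ _ (mf c) mU (fun x => cos1 _).
have i2 c := icos _ _ (maff c) mD (fun x => cos1 _).
have [j1 E1] := independent_integral_mul P U D _ mU lawD (indep lt) _ _ (mf 0) (maff 0) (i1 0) (i2 0).
have [j2 E2] := independent_integral_mul P U D _ mU lawD (indep lt) _ _
  (mf (- (pi / 2))) (maff (- (pi / 2))) (i1 _) (i2 _).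
(* Sines are written as cosines shifted by pi/2, so that the phase in the normal characteristic
   function covers both terms. *)
have E w : cos (U w + b * D w) =
    f 0 (U w) * cos (b * D w + 0) - f (- (pi / 2)) (U w) * cos (b * D w - pi / 2).
  rewrite /f !addr0 cosD; congr (_ - _ * _).
    by rewrite cosB cos_pihalf sin_pihalf mulr0 mulr1 add0r.
  by rewrite cosB cos_pihalf sin_pihalf mulr0 mulr1 add0r.
under eq_Rintegral do rewrite E.
rewrite RintegralB// E1 E2 !Hcos cosN cos_pihalf mulr0 mulr0 subr0 cos0 mulr1 mulrC.
rewrite exprMn sqr_sqrtr ?(ltW ts)//; congr (_ * _); apply: eq_Rintegral => w _.
by rewrite /f addr0.
Qed.

Lemma brownian_increment_orthogonal : P.-integrable setT (EFin \o U) ->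
  P.-integrable setT (EFin \o (fun w => U w * D w)) /\ \int[P]_w (U w * D w) = 0.
Proof.
move=> iU; have mD := measurable_brownian_increment.
move: st; rewrite le_eqVlt => /predU1P[E|lt].
  have -> : (fun w => U w * D w) = fun=> 0.
    by apply/funext => w; rewrite /D E subrr mulr0.
  split; first exact: (mean_le_integrable_ge0 P _ _ (mean_le0 P)).
  by rewrite /Rintegral integral0.
have [_ _ _ H] := hW; have [lawD _] := H s t s0 lt.
have ts : 0 < t - s by rewrite subr_gt0.
have q0 : 0 < Num.sqrt (t - s) by rewrite sqrtr_gt0.
have [D0 D2 _ _] := centered_normal_law P D _ q0 lawD.
have iD : P.-integrable setT (EFin \o D).
  have m1 : mean_le P (fun=> 1 ^+ 2) 1 by rewrite expr1n; exact: (mean_le_cst P 1 ler01).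
  have := integrable_mul P D (fun=> 1) _ _ mD (@measurable_cst _ _ _ _ setT (1 : R)) D2 m1.
  by apply: eq_integrable => // w _; rewrite /= mulr1.
have [iUD ->] := independent_integral_mul P U D _ mU lawD (indep lt) id id
  (@measurable_id _ _ setT) (@measurable_id _ _ setT) iU iD.
by split => //; rewrite D0 mulr0.
Qed.

Context (a : R) (U2 : mean_le P (fun w => U w ^+ 2) a).

Lemma brownian_increment_product_sqr :
  P.-integrable setT (EFin \o (fun w => (U w * D w) ^+ 2)) /\
  \int[P]_w ((U w * D w) ^+ 2) = (t - s) * \int[P]_w (U w ^+ 2).
Proof.
have mD := measurable_brownian_increment.
move: st; rewrite le_eqVlt => /predU1P[E|lt].
  have -> : (fun w => (U w * D w) ^+ 2) = fun=> 0.
    by apply/funext => w; rewrite /D E subrr mulr0 expr0n.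
  rewrite E subrr mul0r; split; last by rewrite /Rintegral integral0.
  exact: (mean_le_integrable_ge0 P _ _ (mean_le0 P)).
have [_ _ _ H] := hW; have [lawD _] := H s t s0 lt.
have [D2 ED2] := brownian_increment_sqr.
have msq : measurable_fun setT (fun x : R => x ^+ 2) by exact: measurable_funX.
have [i E] := independent_integral_mul P U D _ mU lawD (indep lt) (fun x => x ^+ 2) (fun x => x ^+ 2)
  msq msq (mean_le_integrable_ge0 P _ _ U2) (mean_le_integrable_ge0 P _ _ D2).
split; first by apply: eq_integrable i => // w _; rewrite /= exprMn.
by under eq_Rintegral do rewrite exprMn; rewrite E ED2 mulrC.
Qed.

End increment.

Section partition_sums.
Context (b : nat -> R) (b0 : 0 <= b 0%N) (bS : forall j, b j <= b j.+1).
Notation D j := (fun w => W (b j.+1) w - W (b j) w).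

Let b_ge0 j : 0 <= b j.
Proof. by elim: j => // j /le_trans; apply. Qed.

(** Increments are peeled off from the last one: everything before it is known at its left end, and
    each contributes one Gaussian factor. *)
Lemma brownian_sum_cos (c : nat -> R) (Y : Omega -> R) (k : nat) : known (b 0%N) Y ->
  known (b k) (fun w => Y w + \sum_(j < k) c j * D j w) /\
  \int[P]_w cos (Y w + \sum_(j < k) c j * D j w) =
  expR (- (\sum_(j < k) c j ^+ 2 * (b j.+1 - b j)) / 2) * \int[P]_w cos (Y w).
Proof.
move=> kY; elim: k => [|k [IH1 IH2]].
  split; first by under eq_fun do rewrite big_ord0 addr0.
  rewrite big_ord0 oppr0 mul0r expR0 mul1r.
  by under eq_Rintegral do rewrite big_ord0 addr0.
split.
  under eq_fun do rewrite big_ord_recr addrA /=.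
  apply: knownD; first exact: known_mono (bS k) IH1.
  apply: knownM; first exact: known_cst.
  apply: knownB; first exact: known_brownian.
  by apply: known_mono (bS k) _ => //; exact: known_brownian.
under eq_Rintegral do rewrite big_ord_recr addrA /=.
rewrite (brownian_increment_cos (b k) (b k.+1) (b_ge0 k) (bS k) _ IH1) IH2 big_ord_recr /=.
by rewrite opprD mulrDl expRD mulrA [expR _ * expR _]mulrC.
Qed.

(** The discrete Ito isometry. In the square of the sum, the cross term with the last increment has
    mean zero since its coefficient is known at the left end. *)
Lemma brownian_sum_sqr (u : nat -> Omega -> R) (a : nat -> R) (k : nat) :
  (forall j, known (b j) (u j)) -> (forall j, mean_le P (fun w => u j w ^+ 2) (a j)) ->
  [/\ known (b k) (fun w => \sum_(j < k) u j w * D j w),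
      P.-integrable setT (EFin \o (fun w => (\sum_(j < k) u j w * D j w) ^+ 2)) &
      \int[P]_w ((\sum_(j < k) u j w * D j w) ^+ 2) =
      \sum_(j < k) (b j.+1 - b j) * \int[P]_w (u j w ^+ 2)].
Proof.
move=> ku u2; elim: k => [|k [IH1 IH2 IH3]].
  split.
  - by under eq_fun do rewrite big_ord0; exact: known_cst.
  - under eq_fun do rewrite big_ord0 expr0n; exact: (mean_le_integrable_ge0 P _ _ (mean_le0 P)).
  - rewrite big_ord0; under eq_Rintegral do rewrite big_ord0 expr0n.
    by rewrite /Rintegral integral0.
set M := (fun w => \sum_(j < k) u j w * D j w) in IH1 IH2 IH3.
have M2 := integrable_mean_le P _ IH2 (fun w => sqr_ge0 _).
have mM := known_measurable _ _ (b_ge0 k) IH1.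
have mu_ := known_measurable _ _ (b_ge0 k) (ku k).
have mD := measurable_brownian_increment _ _ (b_ge0 k) (bS k).
have [iuD EuD] := brownian_increment_product_sqr _ _ (b_ge0 k) (bS k) _ (ku k) _ (u2 k).
have uD2 := integrable_mean_le P _ iuD (fun w => sqr_ge0 _).
have kMu := knownM _ _ _ IH1 (ku k).
have iMu := integrable_mul P _ _ _ _ mM mu_ M2 (u2 k).
have [iMuD EMuD] := brownian_increment_orthogonal _ _ (b_ge0 k) (bS k) _ kMu iMu.
have E w : (\sum_(j < k.+1) u j w * D j w) ^+ 2 =
    M w ^+ 2 + (u k w * D k w) ^+ 2 + 2 * (M w * u k w * D k w).
  by rewrite big_ord_recr /= -/(M w); ring.
have i2 := integrableZl measurableT 2 iMuD.
have i1 := integrableD measurableT IH2 iuD.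
split.
- under eq_fun do rewrite big_ord_recr /=.
  apply: knownD; first exact: known_mono (bS k) IH1.
  apply: knownM; first exact: known_mono (bS k) (ku k).
  apply: knownB; first exact: known_brownian.
  by apply: known_mono (bS k) _ => //; exact: known_brownian.
- have := integrableD measurableT i1 i2.
  by apply: eq_integrable => // w _; rewrite /= E.
- under eq_Rintegral do rewrite E.
  rewrite RintegralD// RintegralD// RintegralZl// EMuD mulr0 addr0 IH3 EuD.
  by rewrite big_ord_recr.
Qed.

End partition_sums.
End brownian_sums.

(** * Mixing of Brownian grid sums with the coefficient at [tau] *)

Lemma cos_dist {R : realType} (x y : R) : `|cos x - cos y| <= `|x - y|.
Proof.
wlog xy : x y / x <= y.
  by move=> H; have [/H//|/ltW/H] := leP x y; rewrite distrC [leRHS]distrC.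
have [c] := @MVT_segment R cos (fun x => - sin x) x y xy (fun z _ => is_derive_cos z)
  (continuous_subspaceT (@continuous_cos R)).
move=> _ E; rewrite distrC E normrM [leRHS]distrC ler_piMl//.
by rewrite normrN ler_norml sin_geN1 sin_le1.
Qed.

Lemma abel_pivot {R : comRingType} (x w : nat -> R) (m n : nat) : (m <= n)%N ->
  \sum_(i < n) w i * (x i - x m) =
  \sum_(j < n) (\sum_(i < n) w i * ((j < i)%N%:R - (j < m)%N%:R)) * (x j.+1 - x j).
Proof.
move=> mn.
have tel (i : nat) : (i <= n)%N -> \sum_(j < n) (j < i)%N%:R * (x j.+1 - x j) = x i - x 0%N.
  move=> in_; rewrite (eq_bigr (fun j : 'I_n => if (j < i)%N then x j.+1 - x j else 0)); last first.
    by move=> j _; case: ifP; rewrite ?mul1r ?mul0r.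
  rewrite -big_mkcond /= -(big_ord_widen n (fun j => x j.+1 - x j) in_).
  by rewrite -(big_mkord xpredT (fun j => x j.+1 - x j)) telescope_sumr.
transitivity (\sum_(i < n) \sum_(j < n) w i * (((j < i)%N%:R - (j < m)%N%:R) * (x j.+1 - x j))).
  apply: eq_bigr => i _; rewrite -mulr_sumr; congr (_ * _).
  under eq_bigr do rewrite mulrBl.
  rewrite sumrB (tel i) ?(ltnW (ltn_ord i))// (tel m)//; ring.
rewrite exchange_big; apply: eq_bigr => j _; rewrite mulr_suml.
by apply: eq_bigr => i _; rewrite mulrA.
Qed.

Section brownian_trig.
Context {d} {Omega : measurableType d} {R : realType} (P : probability Omega R).
Context (F : R -> set_system Omega) (W : R -> Omega -> R).
Hypotheses (hF : complete_filtration P F) (hW : brownian_motion P F W).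
Context (tau gamma e0 v : R) (K : R -> R) (g : R -> Omega -> R).
Hypotheses (e0tau : e0 <= tau).
Hypothesis kg : forall t, `|t - tau| <= e0 -> known F t (g t).
Hypothesis g_cont : forall e, 0 < e -> exists2 eta, 0 < eta & forall t,
  `|t - tau| <= eta -> mean_le P (fun w => `|g t w - g tau w|) e.

(** The pivot [tau] lies in the middle of the window, so g at [tau] is not independent of the
    earlier increments. Moving it back to the left end of the window costs at most |a| times the
    mean of |g(s n) - g(tau)|, and for the moved variable [brownian_sum_cos] is an exact identity
    with the second moment of the grid sum in the exponent. *)
Lemma brownian_trig (dl : nat -> R) (m : nat -> nat) (a b c : R) :
  (forall n, 0 < dl n) -> (forall n, dl n <= e0) -> dl @ \oo --> 0 ->
  (forall n, (0 < m n)%N) -> 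
  \int[P]_w (grid_sum tau gamma K W (dl n) (m n) w ^+ 2) @[n --> \oo] --> v ->
  \int[P]_w cos (a * g tau w + b * grid_sum tau gamma K W (dl n) (m n) w + c) @[n --> \oo] -->
  \int[P]_w cos (a * g tau w + c) * expR (- (b ^+ 2 * v) / 2).
Proof.
move=> dl0 dle0 dlc m0 vc.
pose S n := grid_sum tau gamma K W (dl n) (m n).
pose s n := tau - dl n.
have s0 n : 0 <= s n by rewrite subr_ge0 (le_trans (dle0 n)).
have sdist n : `|s n - tau| = dl n by rewrite /s addrAC subrr add0r normrN gtr0_norm.
have ks n : known F (s n) (g (s n)) by apply: kg; rewrite sdist.
have e00 : 0 < e0 by exact: lt_le_trans (dle0 0%N).
have tau0 : 0 <= tau by rewrite (le_trans (ltW e00)).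
have mcos : measurable_fun setT (@cos R).
  by apply: continuous_measurable_fun; exact: continuous_cos.
have mgs n := known_measurable P F hF (s n) _ (s0 n) (ks n).
have mg : measurable_fun setT (g tau).
  by apply: (known_measurable P F hF tau) => //; apply: kg; rewrite subrr normr0 ltW.
have step n : measurable_fun setT (S n) /\
    \int[P]_w cos (a * g (s n) w + c + b * S n w) =
    expR (- (b ^+ 2 * \int[P]_w (S n w ^+ 2)) / 2) * \int[P]_w cos (a * g (s n) w + c).
  pose t := grid_time tau (dl n) (m n).
  have tS j : t j <= t j.+1.
    rewrite /t /grid_time lerD2l ler_wpM2l ?sqr_ge0// /node lerD2l ler_wpM2r//.
      by rewrite divr_ge0// invr_ge0 ltW.
    by rewrite ler_nat.
  have t00 : t 0%N = s n.
    rewrite /t /grid_time /node mul0r addr0 /s expr2 mulrN -mulrA divff ?mulr1//.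
    by rewrite gt_eqF.
  have tm : t (m n) = tau.
    rewrite /t /grid_time /node mulrC.
    have -> : (m n)%:R * ((dl n)^-1 / (m n)%:R) = (dl n)^-1.
      by rewrite mulrC divfK// pnatr_eq0 -lt0n.
    by rewrite addrC addNr mul0r add0r.
  (* Coefficients of consecutive increments obtained from [abel_pivot] at index [m n], the node of
     [tau]. *)
  pose cc j := \sum_(i < 2 * m n) grid_weight K gamma (dl n) (m n) i * ((j < i)%N%:R - (j < m n)%N%:R).
  have SE w : S n w = \sum_(j < 2 * m n) cc j * (W (t j.+1) w - W (t j) w).
    have mn : (m n <= 2 * m n)%N by rewrite mul2n -addnn leq_addr.
    by have := abel_pivot (fun i => W (t i) w) (grid_weight K gamma (dl n) (m n)) _ _ mn; rewrite tm.
  have kY : known F (t 0%N) (fun w => a * g (s n) w + c).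
    rewrite t00; apply: knownD; last exact: known_cst.
    by apply: knownM; [exact: known_cst|exact: ks].
  have t0 : 0 <= t 0%N by rewrite t00.
  have [k1 E1] := brownian_sum_cos P F W hF hW t t0 tS (fun j => b * cc j) _ (2 * m n)%N kY.
  have [k2 i2 E2] := brownian_sum_sqr P F W hF hW t t0 tS (fun j _ => cc j) (fun j => cc j ^+ 2)
    (2 * m n)%N (fun j => known_cst F _ _) (fun j => mean_le_cst P _ (sqr_ge0 _)).
  have t20 : 0 <= t (2 * m n)%N.
    by have : forall j, 0 <= t j; [elim=> // j /le_trans; apply|apply].
  have SE' : S n = (fun w => \sum_(j < 2 * m n) cc j * (W (t j.+1) w - W (t j) w)).
    by apply/funext.
  split; first by rewrite SE'; exact: (known_measurable P F hF _ _ t20 k2).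
  have -> : \int[P]_w (S n w ^+ 2) = \sum_(j < 2 * m n) cc j ^+ 2 * (t j.+1 - t j).
    rewrite SE' E2; apply: eq_bigr => j _; rewrite mulrC; congr (_ * _).
    by rewrite /Rintegral (integral_probability_cst P).
  have -> : b ^+ 2 * \sum_(j < 2 * m n) cc j ^+ 2 * (t j.+1 - t j) =
      \sum_(j < 2 * m n) (b * cc j) ^+ 2 * (t j.+1 - t j).
    by rewrite mulr_sumr; apply: eq_bigr => j _; rewrite exprMn mulrA.
  rewrite -E1; apply: eq_Rintegral => w _; congr (cos (_ + _)).
  by rewrite SE mulr_sumr; apply: eq_bigr => j _; rewrite mulrA.
have close e : 0 < e -> \forall n \near \oo, mean_le P (fun w => `|g (s n) w - g tau w|) e.
  move=> ee0; have [eta eta0 H] := g_cont e ee0.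
  apply: filterS ((cvgr0Pnorm_lt dl).1 dlc eta eta0) => n.
  by rewrite gtr0_norm// => /ltW dn; apply: H; rewrite sdist.
have cos1 (X : Omega -> R) w : `|cos (X w)| <= 1 by rewrite ler_norml cos_geN1 cos_le1.
have a1 : 0 < `|a| + 1 by rewrite ltr_wpDl.
have dist (X : nat -> Omega -> R) : (forall n, measurable_fun setT (X n)) ->
    \int[P]_w cos (a * g tau w + X n w) - \int[P]_w cos (a * g (s n) w + X n w) @[n --> \oo] --> 0.
  move=> mX; apply/cvgr0Pnorm_le => e ee0.
  have ea : 0 < e / (`|a| + 1) by rewrite divr_gt0.
  apply: filterS (close _ ea) => n H.
  have m1 : measurable_fun setT (fun w => a * g tau w + X n w).
    by apply: measurable_funD => //; exact: measurable_funM.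
  have m2 : measurable_fun setT (fun w => a * g (s n) w + X n w).
    by apply: measurable_funD => //; exact: measurable_funM.
  have mc1 := measurableT_comp mcos m1; have mc2 := measurableT_comp mcos m2.
  apply: (Rintegral_dist P _ _ 1 1 _ mc1 mc2 (cos1 _) (cos1 _)).
  apply: mean_le_mono (mean_leW P _ _ e (mean_leZ P _ _ `|a| (normr_ge0 a) H) _).
  - by apply: measurableT_comp => //; exact: measurable_funB.
  - move=> w; rewrite normr_ge0/=; apply: (le_trans (cos_dist _ _)).
    have -> : a * g tau w + X n w - (a * g (s n) w + X n w) = a * (g tau w - g (s n) w) by ring.
    by rewrite normrM distrC.
  - rewrite mulrCA ler_piMr ?(ltW ee0)// mulrC ler_pdivrMl// mulr1.
    by rewrite lerDl.
have mS n : measurable_fun setT (S n) by case: (step n).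
have d1 := dist (fun n w => c + b * S n w)
  (fun n => measurable_funD (measurable_cst _) (measurable_funM (measurable_cst _) (mS n))).
have d2 := dist (fun n _ => c) (fun n => measurable_cst _).
have ex : expR (- (b ^+ 2 * \int[P]_w (S n w ^+ 2)) / 2) @[n --> \oo] --> expR (- (b ^+ 2 * v) / 2).
  have H := @continuous_expR R (- (b ^+ 2 * v) / 2).
  have B : - (b ^+ 2 * \int[P]_w (S n w ^+ 2)) / 2 @[n --> \oo] --> - (b ^+ 2 * v) / 2.
    by apply: cvgMl; apply: cvgN; exact: cvgMr.
  exact: (cvg_comp _ _ B H).
have cs : \int[P]_w cos (a * g (s n) w + c) @[n --> \oo] --> \int[P]_w cos (a * g tau w + c).
  have -> : (fun n => \int[P]_w cos (a * g (s n) w + c)) =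
      (fun n => \int[P]_w cos (a * g tau w + c) -
        (\int[P]_w cos (a * g tau w + c) - \int[P]_w cos (a * g (s n) w + c))).
    by apply/funext => n; ring.
  rewrite -[X in _ --> X]subr0; apply: cvgB => //; exact: cvg_cst.
have -> : (fun n => \int[P]_w cos (a * g tau w + b * grid_sum tau gamma K W (dl n) (m n) w + c)) =
    (fun n => (\int[P]_w cos (a * g tau w + (c + b * S n w)) -
       \int[P]_w cos (a * g (s n) w + (c + b * S n w))) +
      expR (- (b ^+ 2 * \int[P]_w (S n w ^+ 2)) / 2) * \int[P]_w cos (a * g (s n) w + c)).
  apply/funext => n; have [_ <-] := step n.
  have E1 : \int[P]_w cos (a * g tau w + (c + b * S n w)) = \int[P]_w cos (a * g tau w + b * S n w + c).
    by apply: eq_Rintegral => w _; congr cos; ring.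
  have E2 : \int[P]_w cos (a * g (s n) w + (c + b * S n w)) = \int[P]_w cos (a * g (s n) w + c + b * S n w).
    by apply: eq_Rintegral => w _; congr cos; ring.
  by rewrite E1 E2 subrK.
by rewrite -[X in _ --> X]add0r mulrC; apply: cvgD d1 (cvgM ex cs).
Qed.

End brownian_trig.

(** * The Ito isometry for simple integrands *)

Lemma measurable_section_integral {d} {Omega : measurableType d} {R : realType}
    (D : set R) (Phi : R * Omega -> \bar R) :
  measurable (D : set (measurableTypeR R)) -> measurable_fun setT Phi -> (forall z, 0 <= Phi z)%E ->
  measurable_fun setT (fun w => \int[lebesgue_measure]_(r in D) Phi (r, w))%E.
Proof.
move=> mD mPhi Phi0.
have E : (fun w => \int[lebesgue_measure]_(r in D) Phi (r, w))%E =
    fubini_G (lebesgue_measure : {sigma_finite_measure set (measurableTypeR R) -> \bar R})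
      (fun z => (\1_D z.1)%:E * Phi z)%E.
  apply/funext => w; rewrite /fubini_G [LHS]integral_mkcond; apply: eq_integral => r _.
  by rewrite patchE indicE; case: ifP => _; rewrite ?mul1e ?mul0e.
rewrite E; apply: measurable_fun_fubini_tonelli_G.
- apply: emeasurable_funM => //; apply/measurable_EFinP.
  by apply: (measurableT_comp _ measurable_fst); exact: measurable_indic.
- by move=> z; rewrite mule_ge0// lee_fin indicE.
Qed.

Section simple_isometry.
Context {d} {Omega : measurableType d} {R : realType} (P : probability Omega R).
Notation mu := (@lebesgue_measure R).
Context (F : R -> set_system Omega) (W : R -> Omega -> R).
Hypotheses (hF : complete_filtration P F) (hW : brownian_motion P F W).
Context (T s t : R) (s0 : 0 <= s) (st : s <= t) (tT : t <= T).
Context (U : Omega -> R) (kU : known F s U) (a : R) (U2 : mean_le P (fun w => U w ^+ 2) a).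
Context (H : simple_process R Omega) (hH : simple_adapted F H).
Notation tm := (sp_time H).
Notation v := (sp_value H).
Notation N := (sp_size H).

Let tmS i : tm i <= tm i.+1. Proof. by case: hH. Qed.
Let tm_mono i j : (i <= j)%N -> tm i <= tm j.
Proof. by elim: j => [|j IH]; rewrite leq_eqVlt => /predU1P[->//|//]; rewrite ltnS => /IH /le_trans; apply. Qed.
Let tm_ge0 i : 0 <= tm i.
Proof. by case: hH => h _ _ _; apply: le_trans h (tm_mono _ _ _). Qed.
Let t0 : 0 <= t. Proof. exact: le_trans s0 st. Qed.

Lemma measurable_simple_value i : measurable_fun setT (v i).
Proof.
apply: (known_measurable P F hF (tm i)) => //.
by apply/(knownE P F hF (tm i)) => //; case: hH.
Qed.

Lemma measurable_simple_integral r : 0 <= r -> measurable_fun setT (simple_integral H W r).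
Proof.
move=> r0; rewrite /simple_integral.
have mW x : 0 <= x -> measurable_fun setT (W x).
  by move=> x0; apply: (known_measurable P F hF x) => //; exact: (known_brownian P F W).
apply: measurable_sum => i; apply: measurable_funM; first exact: measurable_simple_value.
by apply: measurable_funB; apply: mW; rewrite le_min tm_ge0.
Qed.

Lemma measurable_simple_eval :
  measurable_fun setT (fun z : R * Omega => simple_eval H z.1 z.2).
Proof.
apply: measurable_sum => i; apply: measurable_funM.
  exact: (measurableT_comp (measurable_simple_value i)).
by apply: (measurableT_comp _ measurable_fst); exact: measurable_indic.
Qed.

Lemma simple_eval_in i r w : (i < N)%N -> tm i < r <= tm i.+1 -> simple_eval H r w = v i w.
Proof.
move=> iN ri; rewrite /simple_eval (bigD1 (Ordinal iN)) //= [X in _ + X]big1; last first.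
  move=> j ji; rewrite indicE memNset ?mulr0//= in_itv/= => /andP[h1 h2].
  case/andP: ri => r1 r2; move: ji; rewrite -val_eqE /= neq_ltn => /orP[jl|jl].
    by have := le_lt_trans (le_trans h2 (tm_mono _ _ jl)) r1; rewrite ltxx.
  by have := lt_le_trans h1 (le_trans r2 (tm_mono _ _ jl)); rewrite ltxx.
by rewrite addr0 indicE mem_set ?mulr1//= in_itv.
Qed.

Lemma simple_eval_out r w : (r <= tm 0%N \/ tm N < r) -> simple_eval H r w = 0.
Proof.
move=> ro; rewrite /simple_eval big1// => i _; rewrite indicE memNset ?mulr0//= in_itv/=.
move=> /andP[h1 h2]; case: ro => ro.
  by have := lt_le_trans h1 (le_trans ro (tm_mono _ _ (leq0n i))); rewrite ltxx.
by have := le_lt_trans (le_trans h2 (tm_mono _ _ (ltn_ord i))) ro; rewrite ltxx.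
Qed.

(** The jump times clipped to [s, t]. *)
Let cl i := Num.max s (Num.min (tm i) t).
(** The clipped times, preceded by s and followed by t: N + 2 intervals, of which the first and the
    last lie outside the range of the simple process. *)
Let b j := if j is j'.+1 then (if (j' <= N)%N then cl j' else t) else s.
(** The simple process minus [U] on the interval starting at [b j]. A value fixed only after t is
    replaced by 0 to keep [u j] known at [b j]; its clipped interval is empty. *)
Let u j w := (if j is j'.+1 then (if (j' < N)%N && (tm j' <= t) then v j' w else 0) else 0) - U w.

Let cl_itv i : s <= cl i <= t.
Proof. by rewrite /cl le_max lexx/= ge_max st ge_min lexx orbT. Qed.

Let bS j : b j <= b j.+1.
Proof.
case: j => [|j] /=; first by case/andP: (cl_itv 0%N).
case: (leqP j N) => jN; last by rewrite ltnNge (ltnW jN) lexx.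
case: ifP => jN'; last by case/andP: (cl_itv j).
rewrite /cl ge_max !le_max lexx/= le_min; apply/orP; right.
by rewrite !ge_min lexx orbT andbT tmS.
Qed.

Let b_ge0 j : 0 <= b j.
Proof. by elim: j => [//|j IH]; exact: le_trans IH (bS j). Qed.

Let bs j : s <= b j.
Proof. by elim: j => [//|j IH]; exact: le_trans IH (bS j). Qed.

Let b_end : b N.+2 = t.
Proof. by rewrite /= ltnn. Qed.

Let ku j : known F (b j) (u j).
Proof.
apply: knownB; last by apply: (known_mono P F hF s).
case: j => [|j]; first exact: known_cst.
case: (boolP ((j < N)%N && (tm j <= t))) => [/andP[jN jt]|_]; last exact: known_cst.
have kv : known F (tm j) (v j) by apply/(knownE P F hF (tm j)) => //; case: hH.
apply: (known_mono P F hF _ _ _ _ _ kv) => //.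
by rewrite /= (ltnW jN) /cl (min_idPl jt) le_max lexx orbT.
Qed.

Let u2 j : exists c, mean_le P (fun w => u j w ^+ 2) c.
Proof.
have [_ _ _ [M HM]] := hH.
have M0 : 0 <= M ^+ 2 by exact: sqr_ge0.
exists (2 * (M ^+ 2) + 2 * a).
have H2 := mean_leD P _ _ _ _ (mean_leZ P _ _ 2 (ler0n _ _) (mean_le_cst P _ M0))
  (mean_leZ P _ _ 2 (ler0n _ _) U2).
apply: mean_le_mono H2.
  by apply: measurable_funX; exact: (known_measurable P F hF _ _ (b_ge0 j) (ku j)).
move=> w; rewrite sqr_ge0.
pose x := if j is j'.+1 then (if (j' < N)%N && (tm j' <= t) then v j' w else 0) else 0.
rewrite (_ : u j w = x - U w) //=.
have : x ^+ 2 <= M ^+ 2.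
  rewrite -real_normK ?num_real// lerXn2r ?nnegrE//.
    exact: le_trans (HM 0%N w).
  rewrite /x; case: (j) => [|i].
    by rewrite normr0 (le_trans _ (HM 0%N w)).
  by case: ifP => _; rewrite ?normr0 ?HM// (le_trans _ (HM 0%N w)).
have := sqr_ge0 (x + U w); move: x (U w) => x y; nra.
Qed.

Let sumE w : \sum_(j < N.+2) u j w * (W (b j.+1) w - W (b j) w) =
  simple_integral H W t w - simple_integral H W s w - U w * (W t w - W s w).
Proof.
rewrite /u; under eq_bigr do rewrite mulrBl.
rewrite sumrB -mulr_sumr -(big_mkord xpredT (fun j => W (b j.+1) w - W (b j) w)).
rewrite telescope_sumr// b_end; congr (_ - _).
rewrite big_ord_recl big_ord_recr /= mul0r add0r ltnn /= mul0r addr0.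
rewrite /simple_integral -sumrB; apply: eq_bigr => j _.
rewrite /bump /= ?add1n ?add0n /= ltn_ord/= (ltnW (ltn_ord j)).
have clip x : W (Num.min x t) w - W (Num.min x s) w = W (Num.max s (Num.min x t)) w - W s w.
  have [xs|sx] := leP x s.
    by rewrite (min_idPl (le_trans xs st)) (max_idPl xs) !subrr.
  by rewrite (max_idPr _)// le_min (ltW sx) st.
have E : W (cl j.+1) w - W (cl j) w =
    (W (Num.min (tm j.+1) t) w - W (Num.min (tm j.+1) s) w) -
    (W (Num.min (tm j) t) w - W (Num.min (tm j) s) w).
  by rewrite !clip /cl; ring.
case: (boolP (tm j <= t)) => [jt|]; first by rewrite E; ring.
rewrite -ltNge => tj; rewrite mul0r.
have h1 : t <= tm j.+1 by rewrite (le_trans (ltW tj)).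
have h2 : s <= tm j by rewrite (le_trans st (ltW tj)).
have h3 : s <= tm j.+1 by rewrite (le_trans st h1).
by rewrite (min_idPr h1) (min_idPr (ltW tj)) (min_idPr h2) (min_idPr h3) !subrr ?mulr0 ?subrr.
Qed.


Context (g : R -> Omega -> R) (jg : jointly_measurable T g).

Let mU : measurable_fun setT U := known_measurable P F hF s U s0 kU.

Let g' (r : R) (w : Omega) : R := \1_(`[0, T]%classic) r * g r w.

Let mg' : measurable_fun setT (fun z : R * Omega => g' z.1 z.2).
Proof. exact: (measurable_restricted T g jg). Qed.

Let err r w : R := 2 * (g' r w - simple_eval H r w) ^+ 2.
Let dev r w : R := 2 * (g' r w - U w) ^+ 2.

Let m_err : measurable_fun setT (fun z : R * Omega => (err z.1 z.2)%:E).
Proof.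
apply/measurable_EFinP; apply: measurable_funM => //; apply: measurable_funX.
by apply: measurable_funB mg' _; exact: measurable_simple_eval.
Qed.

Let m_dev : measurable_fun setT (fun z : R * Omega => (dev z.1 z.2)%:E).
Proof.
apply/measurable_EFinP; apply: measurable_funM => //; apply: measurable_funX.
by apply: measurable_funB mg' _; exact: (measurableT_comp mU).
Qed.

Let err_ge0 r w : (0 <= (err r w)%:E)%E.
Proof. by rewrite lee_fin mulr_ge0// sqr_ge0. Qed.

Let dev_ge0 r w : (0 <= (dev r w)%:E)%E.
Proof. by rewrite lee_fin mulr_ge0// sqr_ge0. Qed.

Let u_le j r w : (j < N.+2)%N -> b j < r <= b j.+1 -> u j w ^+ 2 <= err r w + dev r w.
Proof.
move=> jN rj; have -> : u j w = simple_eval H r w - U w.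
  rewrite /u; congr (_ - _); case: j jN rj => [_|j]/=.
    move=> /andP[sr]; rewrite /cl le_max leNgt sr/= le_min => /andP[r0 _].
    by rewrite simple_eval_out//; left.
  rewrite !ltnS => jN; rewrite jN => /andP[cr rb].
  have sr : s < r by case/andP: (cl_itv j) => sc _; exact: le_lt_trans cr.
  have rt : r <= t.
    apply: (le_trans rb); case: ifP => // _; by case/andP: (cl_itv j.+1).
  have tr : tm j < r.
    move: cr; rewrite /cl gt_max sr/= gt_min => /orP[//|].
    by rewrite ltNge rt.
  rewrite (le_trans (ltW tr) rt) andbT.
  move: rb; case: ltnP => jN' rb; last first.
    rewrite simple_eval_out//; right.
    by rewrite (_ : N = j)//; apply/eqP; rewrite eqn_leq jN' jN.
  rewrite (simple_eval_in j)// tr/=.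
  by move: rb; rewrite /cl le_max leNgt sr/= le_min => /andP[].
rewrite /err /dev.
have := sqr_ge0 ((g' r w - simple_eval H r w) + (g' r w - U w)).
move: (g' r w) (simple_eval H r w) (U w) => x y z; nra.
Qed.

Let mitv (x y : R) : measurable (`]x, y] : set (measurableTypeR R)).
Proof. exact: measurable_itv. Qed.

Let m_sec w : measurable_fun setT (fun r => (err r w + dev r w)%:E).
Proof.
have := measurable_fun_pair1 w (emeasurable_funD m_err m_dev).
by [].
Qed.

Let itv_cst (x y c : R) : x <= y ->
  (\int[mu]_(r in `]x, y]) c%:E = c%:E * (y - x)%:E)%E.
Proof.
move=> xy; rewrite integral_cst//= lebesgue_measure_itv/= lte_fin.
case: ltP => h; first by rewrite EFinB.
by rewrite (_ : y = x) ?subrr//; apply/eqP; rewrite eq_le h xy.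
Qed.

Let path_le w : (\sum_(j < N.+2) (u j w ^+ 2)%:E * (b j.+1 - b j)%:E <=
  \int[mu]_(r in `]s, t]) (err r w + dev r w)%:E)%E.
Proof.
have psi0 r : (0 <= (err r w + dev r w)%:E)%E by rewrite EFinD adde_ge0.
suff H0 k : (k <= N.+2)%N -> (\sum_(j < k) (u j w ^+ 2)%:E * (b j.+1 - b j)%:E <=
    \int[mu]_(r in `]s, b k]) (err r w + dev r w)%:E)%E.
  by have := H0 N.+2 (leqnn _); rewrite b_end.
elim: k => [_|k IH kN].
  by rewrite big_ord0; apply: integral_ge0.
rewrite big_ord_recr/=.
have -> : `]s, b k.+1]%classic = `]s, b k] `|` `]b k, b k.+1].
  by apply: itv_bndbnd_setU; rewrite bnd_simp ?bs ?bS.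
rewrite ge0_integral_setU//=; last first.
- apply/disj_setPS => r [] /=; rewrite !in_itv/= => /andP[_ h1] /andP[h2 _].
  by have := le_lt_trans h1 h2; rewrite ltxx.
- exact: (measurable_funTS (m_sec w)).
apply: leeD; first exact: IH (ltnW kN).
rewrite -(itv_cst (b k) (b k.+1) _ (bS k)).
apply: ge0_le_integral => //.
- by move=> r _; rewrite lee_fin sqr_ge0.
- exact: (measurable_funTS (m_sec w)).
- move=> r; rewrite /= in_itv/= => rk; rewrite lee_fin; exact: u_le.
Qed.

(** On the clipped partition the discrete isometry gives the mean integral of (H - U)^2 over ]s, t],
    and (H - U)^2 <= 2 (g - H)^2 + 2 (g - U)^2. The approximation error of H may be taken over all
    of [0, T]. *)
Lemma simple_isometry (A B : R) :
  (\int[P]_w \int[mu]_(r in `[0%R, T]) ((g r w - simple_eval H r w) ^+ 2)%R%:E <= A%:E)%E ->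
  (\int[P]_w \int[mu]_(r in `]s, t]) ((g r w - U w) ^+ 2)%R%:E <= B%:E)%E ->
  mean_le P (fun w => (simple_integral H W t w - simple_integral H W s w -
    U w * (W t w - W s w)) ^+ 2) (2 * A + 2 * B).
Proof.
move=> HA HB.
have /choice[cu Hu] := u2.
have [_ i E] := brownian_sum_sqr P F W hF hW b s0 bS u cu N.+2 ku Hu.
have M := integrable_mean_le P _ i (fun w => sqr_ge0 _).
rewrite E in M.
have -> : (fun w => (simple_integral H W t w - simple_integral H W s w -
    U w * (W t w - W s w)) ^+ 2) = (fun w => (\sum_(j < N.+2) u j w * (W (b j.+1) w - W (b j) w)) ^+ 2).
  by apply/funext => w; rewrite sumE.
apply: (mean_leW P _ _ _ M).
have iu j : P.-integrable setT (EFin \o (fun w => (b j.+1 - b j) * u j w ^+ 2)).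
  exact: (integrableZl measurableT (b j.+1 - b j) (mean_le_integrable_ge0 P _ _ (Hu j))).
have [is_ Es] := Rintegral_sum P _ (index_enum 'I_N.+2) (fun j w => (b j.+1 - b j) * u j w ^+ 2) (fun j => iu j).
have -> : \sum_(j < N.+2) (b j.+1 - b j) * \int[P]_w (u j w ^+ 2) =
    \int[P]_w (\sum_(j < N.+2) (b j.+1 - b j) * u j w ^+ 2).
  rewrite Es; apply: eq_bigr => j _; rewrite RintegralZl//.
  exact: (mean_le_integrable_ge0 P _ _ (Hu j)).
rewrite -lee_fin /Rintegral fineK; last exact: (integrable_fin_num measurableT is_).
have mI (Psi : R -> Omega -> R) (D : set R) : measurable (D : set (measurableTypeR R)) ->
    measurable_fun setT (fun z : R * Omega => (Psi z.1 z.2)%:E) ->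
    (forall r w, 0 <= (Psi r w)%:E)%E ->
    measurable_fun setT (fun w => \int[mu]_(r in D) (Psi r w)%:E)%E.
  move=> mD mPsi Psi0.
  exact: (measurable_section_integral D (fun z => (Psi z.1 z.2)%:E) mD mPsi (fun z => Psi0 _ _)).
have sub_itv r : `]s, t]%classic r -> `[0, T]%classic r.
  rewrite /= !in_itv/= => /andP[sr rt]; by rewrite (le_trans s0 (ltW sr)) (le_trans rt tT).
have g'E r w : `[0, T]%classic r -> g' r w = g r w.
  by move=> rT; rewrite /g' indicE mem_set ?mul1r.
have m0T : measurable (`[0, T] : set (measurableTypeR R)) by exact: measurable_itv.
have ms_err w : measurable_fun setT (fun r => (err r w)%:E) by exact: (measurable_fun_pair1 w m_err).
have ms_dev w : measurable_fun setT (fun r => (dev r w)%:E) by exact: (measurable_fun_pair1 w m_dev).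
have twice (D : set R) (Psi Theta : R -> Omega -> R) (c : R) :
    measurable (D : set (measurableTypeR R)) ->
    measurable_fun setT (fun z : R * Omega => (Psi z.1 z.2)%:E) ->
    (forall r w, 0 <= (Psi r w)%:E)%E -> (forall r w, (0 <= Theta r w)%R) ->
    (forall r w, D r -> Psi r w = 2 * Theta r w) ->
    (\int[P]_w \int[mu]_(r in D) (Theta r w)%:E <= c%:E)%E ->
    (\int[P]_w \int[mu]_(r in D) (Psi r w)%:E <= (2 * c)%:E)%E.
  move=> mD mPsi Psi0 Theta0 PT Hc.
  have mT w : measurable_fun D (fun r => (Theta r w)%:E).
    have : measurable_fun D (fun r => (2^-1)%:E * (Psi r w)%:E)%E.
      apply: emeasurable_funM => //; apply: measurable_funTS.
      exact: (measurable_fun_pair1 w mPsi).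
    apply: eq_measurable_fun => r; rewrite inE => rD.
    by rewrite -EFinM PT// mulrA mulVf ?mul1r.
  have E2 w : (\int[mu]_(r in D) (Psi r w)%:E = 2%:E * \int[mu]_(r in D) (Theta r w)%:E)%E.
    rewrite -ge0_integralZl//=.
      by apply: eq_integral => r; rewrite inE => rD; rewrite PT.
      exact: mT.
    by move=> r _; rewrite lee_fin.
  under eq_integral do rewrite E2.
  rewrite ge0_integralZl//=; first by rewrite EFinM lee_pmul2l.
    have : measurable_fun setT (fun w => (2^-1)%:E * \int[mu]_(r in D) (Psi r w)%:E)%E.
      by apply: emeasurable_funM => //; exact: mI.
    apply: eq_measurable_fun => w _; rewrite E2 muleA -EFinM mulVf ?mul1e//.
  by move=> w _; apply: integral_ge0 => r _; rewrite lee_fin.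
have EA : (\int[P]_w \int[mu]_(r in `]s, t]) (err r w)%:E <= (2 * A)%:E)%E.
  apply: (@le_trans _ _ (\int[P]_w \int[mu]_(r in `[0%R, T]) (err r w)%:E)%E).
    apply: ge0_le_integral => //.
    - by move=> w _; exact: integral_ge0.
    - exact: mI.
    - exact: mI.
    - move=> w _; apply: ge0_subset_integral => //.
        exact: (measurable_funTS (ms_err w)).
  apply: (twice _ _ _ _ m0T m_err err_ge0 (fun r w => sqr_ge0 _) _ HA) => r w rT.
  by rewrite /err g'E.
have EB : (\int[P]_w \int[mu]_(r in `]s, t]) (dev r w)%:E <= (2 * B)%:E)%E.
  apply: (twice _ _ _ _ (mitv s t) m_dev dev_ge0 (fun r w => sqr_ge0 _) _ HB) => r w rT.
  by rewrite /dev g'E//; exact: sub_itv.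
rewrite EFinD; apply: le_trans (leeD EA EB).
rewrite -ge0_integralD//; [|by move=> w _; exact: integral_ge0|exact: mI
  |by move=> w _; exact: integral_ge0|exact: mI].
apply: ge0_le_integral => //.
- by move=> w _; rewrite lee_fin sumr_ge0// => j _; rewrite mulr_ge0 ?sqr_ge0 ?subr_ge0.
- by case/integrableP: is_.
- by apply: emeasurable_funD; exact: mI.
move=> w _; rewrite -ge0_integralD//; [|exact: measurable_funTS (ms_err w)|exact: measurable_funTS (ms_dev w)].
apply: le_trans (path_le w); rewrite -sumEFin.
by rewrite le_eqVlt; apply/orP; left; apply/eqP; apply: eq_bigr => j _; rewrite -EFinM mulrC.
Qed.

End simple_isometry.

(** * The Ito isometry with a frozen integrand *)

Section ito_isometry.
Context {d} {Omega : measurableType d} {R : realType} (P : probability Omega R).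
Notation mu := (@lebesgue_measure R).
Context (F : R -> set_system Omega) (W : R -> Omega -> R).
Hypotheses (hF : complete_filtration P F) (hW : brownian_motion P F W).
Context (T : R) (g J : R -> Omega -> R).
Hypotheses (jg : jointly_measurable T g) (hJ : ito_integral P F W T g J).

Lemma measurable_ito t : 0 <= t -> measurable_fun setT (J t).
Proof.
move=> t0; apply: (known_measurable P F hF t) => //.
by apply/(knownE P F hF t) => //; case: hJ => H _ _; exact: H.
Qed.

Lemma cvge0_near (x : nat -> \bar R) (e : R) : 0 < e -> x @ \oo --> 0%E ->
  \forall n \near \oo, (x n <= e%:E)%E.
Proof.
move=> e0 x0.
have H : nbhs (0%E : \bar R) [set y | (y < e%:E)%E].
  by apply: open_nbhs_nbhs; split; [exact: open_ereal_lt_ereal|rewrite /= lte_fin].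
have {}H : \forall n \near \oo, (x n < e%:E)%E := x0 _ H.
by apply: filterS H => n /ltW.
Qed.

(** Passage to the limit along the simple processes defining the integral. The constant 6 is 3, from
    splitting a square into three, times the 2 of [simple_isometry]. *)
Lemma ito_isometry_bound (s t a B : R) (U : Omega -> R) :
  0 <= s -> s <= t -> t <= T -> known F s U -> mean_le P (fun w => U w ^+ 2) a ->
  (\int[P]_w \int[mu]_(r in `]s, t]) ((g r w - U w) ^+ 2)%R%:E <= B%:E)%E ->
  mean_le P (fun w => (J t w - J s w - U w * (W t w - W s w)) ^+ 2) (6 * B).
Proof.
move=> s0 st tT kU U2 HB.
have t0 := le_trans s0 st; have sT := le_trans st tT.
have mJs := measurable_ito s s0; have mJt := measurable_ito t t0.
have mU := known_measurable P F hF s U s0 kU.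
have mD := measurable_brownian_increment P F W hF hW s t s0 st.
have mX : measurable_fun setT (fun w => J t w - J s w - U w * (W t w - W s w)).
  apply: measurable_funB; first exact: measurable_funB.
  exact: measurable_funM.
split; [exact: measurable_funX|by move=> w; exact: sqr_ge0|].
have [_ _ [H [hH Hg HJ]]] := hJ.
apply/lee_addgt0Pr => e e0.
(* Two endpoint errors and twice the integrand error, all multiplied by 3, add up to exactly [e]. *)
have e12 : 0 < e / 12 by rewrite divr_gt0.
have At : 0 <= t <= T by rewrite t0.
have As : 0 <= s <= T by rewrite s0.
near \oo => n.
have h1 : ('E_P[fun w => ((J t w - simple_integral (H n) W t w) ^+ 2)%R] <= (e / 12)%:E)%E.
  by near: n; exact: (cvge0_near _ _ e12 (HJ t At)).
have h2 : ('E_P[fun w => ((J s w - simple_integral (H n) W s w) ^+ 2)%R] <= (e / 12)%:E)%E.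
  by near: n; exact: (cvge0_near _ _ e12 (HJ s As)).
have h3 : (\int[P]_w \int[mu]_(r in `[0%R, T])
    ((g r w - simple_eval (H n) r w) ^+ 2)%R%:E <= (e / 12)%:E)%E.
  by near: n; exact: (cvge0_near _ _ e12 Hg).
have I := simple_isometry P F W hF hW T s t s0 st tT U kU a U2 (H n) (hH n) g jg _ _ h3 HB.
have toM (X : Omega -> R) (c : R) : measurable_fun setT X ->
    ('E_P[fun w => (X w ^+ 2)%R] <= c%:E)%E -> mean_le P (fun w => X w ^+ 2) c.
  move=> mX' HX; split; [exact: measurable_funX|by move=> w; exact: sqr_ge0|].
  by move: HX; rewrite unlock.
have mIt := measurable_simple_integral P F W hF hW (H n) (hH n) t t0.
have mIs := measurable_simple_integral P F W hF hW (H n) (hH n) s s0.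
have m1 := toM _ _ (measurable_funB mJt mIt) h1.
have m2 := toM _ _ (measurable_funB mJs mIs) h2.
have M := mean_leZ P _ _ 3 (ler0n _ _) (mean_leD P _ _ _ _ (mean_leD P _ _ _ _ m1 m2) I).
have := mean_leW P _ _ (6 * B + e) (mean_le_mono P _ _ _ (measurable_funX 2 mX) _ M).
case.
- move=> w; rewrite sqr_ge0/=.
  set x := J t w - simple_integral _ _ t w; set y := J s w - simple_integral _ _ s w.
  set z := simple_integral _ _ _ _ - _ - _.
  rewrite (_ : J t w - J s w - _ = x - y + z); last by rewrite /x /y /z; ring.
  have := sqr_ge0 (x + y); have := sqr_ge0 (x - z); have := sqr_ge0 (y + z).
  move: x y z => x y z; nra.
- by lra.
- by move=> _ _; rewrite EFinD.
Unshelve. all: by end_near. Qed.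

End ito_isometry.

(** * Consequences of progressive measurability *)

Section progressive.
Context {d} {Omega : measurableType d} {R : realType} (P : probability Omega R).
Context (F : R -> set_system Omega) (hF : complete_filtration P F).
Context (g : R -> Omega -> R) (hg : progressively_measurable F g).

Lemma progressive_jointly_measurable T : 0 <= T -> jointly_measurable T g.
Proof.
move=> T0 mD Y mY; have := hg T T0 Y mY.
have -> : `[0, T] `*` [set: Omega] `&` (fun z : R * Omega => g z.1 z.2) @^-1` Y =
    [set z : R * Omega | `[0, T]%classic z.1 /\ Y (g z.1 z.2)].
  by apply/seteqP; split => z /= [] => [[]|].
pose M : set_system (R * Omega) := [set D | measurable D /\ D `<=` `[0, T] `*` [set: Omega]].
suff : <<s `[0, T] `*` [set: Omega], [set D | exists (I : set R) A,
   [/\ measurable I, I `<=` `[0, T]%classic, F T A & D = I `*` A]] >> `<=` M.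
  by move=> /[apply] -[].
apply: smallest_sub.
- split.
  + by split; [exact: measurable0|exact: sub0set].
  + move=> A [mA _]; split; [exact: measurableD|by move=> z []].
  + move=> A HA; split; first by apply: bigcupT_measurable => i; case: (HA i).
    by move=> z [i _]; case: (HA i) => _; apply.
- move=> _ [I [A [mI IT FA ->]]]; split.
    by apply: measurableX => //; case: hF => _ _ H _ _; exact: (H T T0).
  by move=> z [/IT ? _].
Qed.

(** The subsets of the product whose section at time t lies in F_t contain the generating rectangles
    and are stable under the operations of a sigma-algebra. *)
Lemma progressive_known t : 0 <= t -> known F t (g t).
Proof.
move=> t0; apply/(knownE P F hF t) => // _ [Y mY <-]; rewrite setTI.
have [sF0 sFC sFU] : sigma_algebra setT (F t) by case: hF => _ H _ _ _; exact: H.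
have tt : `[0, t]%classic t by rewrite /= in_itv/= t0 lexx.
pose M : set_system (R * Omega) := [set D | F t [set w | D (t, w)]].
have := hg t t0 Y mY.
suff : <<s `[0, t] `*` [set: Omega], [set D | exists (I : set R) A,
   [/\ measurable I, I `<=` `[0, t]%classic, F t A & D = I `*` A]] >> `<=` M.
  move=> /[apply]; rewrite /M /=.
  by rewrite (_ : [set w | _] = g t @^-1` Y)//; apply/seteqP; split => w /= => [[]|].
apply: smallest_sub.
- split.
  + by rewrite /M /=; apply: sF0.
  + move=> A FA; rewrite /M /=.
    have <- : setT `\` [set w | A (t, w)] = [set w | (`[0, t] `*` setT `\` A) (t, w)].
      by apply/seteqP; split => w /= => [[_ ?]|[_ ?]]; split.
    exact: sFC.
  + move=> A HA; rewrite /M /=.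
    have <- : \bigcup_i [set w | A i (t, w)] = [set w | (\bigcup_i A i) (t, w)].
      by apply/seteqP; split => w [i _ ?]; exists i.
    exact: sFU.
- move=> _ [I [A [mI IT FA ->]]]; rewrite /M /=.
  have [It|It] := pselect (I t).
    have -> : [set w | (I `*` A) (t, w)] = A by apply/seteqP; split => w // [].
    exact: FA.
  have -> : [set w | (I `*` A) (t, w)] = set0 by apply/seteqP; split => w // [].
  exact: sF0.
Qed.

End progressive.

(** * Local expansion of an Ito process *)

Section ito_increments.
Context {d} {Omega : measurableType d} {R : realType} (P : probability Omega R).
Notation mu := (@lebesgue_measure R).
Context (F : R -> set_system Omega) (W : R -> Omega -> R).
Hypotheses (hF : complete_filtration P F) (hW : brownian_motion P F W).
Context (T : R) (V f g : R -> Omega -> R).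
Hypotheses (jV : jointly_measurable T V) (jf : jointly_measurable T f) (jg : jointly_measurable T g).
Hypothesis hV : ito_process P F W T V f g.
Context (cf cg : R).
Hypothesis f_bound : forall t, 0 <= t <= T -> mean_le P (fun w => `|f t w|) cf.
Hypothesis g_bound : forall t, 0 <= t <= T -> mean_le P (fun w => g t w ^+ 2) cg.

Section interval.
Context (s t : R) (s0 : 0 <= s) (st : s <= t) (tT : t <= T).

Let mst : measurable (`]s, t] : set (measurableTypeR R)).
Proof. exact: measurable_itv. Qed.

Let sub_itv r : `]s, t]%classic r -> 0 <= r <= T.
Proof. by rewrite /= in_itv/= => /andP[sr rt]; rewrite (le_trans s0 (ltW sr)) (le_trans rt tT). Qed.

Let itv_mean c : 0 <= c -> mean_le mu (fun r : measurableTypeR R => \1_(`]s, t]%classic) r * c) (c * (t - s)).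
Proof.
move=> c0; split.
- by apply: measurable_funM => //; exact: measurable_indic.
- by move=> r; rewrite mulr_ge0// indicE.
- under eq_integral do rewrite mulrC.
  rewrite integral_mulr_indic integral_cst//= lebesgue_measure_itv/= lte_fin.
  case: ltP => h; first by rewrite -EFinB lexx.
  by rewrite mule0 lee_fin mulr_ge0// subr_ge0.
Qed.

Lemma drift_increment :
  mean_le P (fun w => `|\int[mu]_r (\1_(`]s, t]%classic) r * (\1_(`[0, T]%classic) r * f r w))|)
    (cf * (t - s)).
Proof.
have cf0 : 0 <= cf by apply: mean_le_ge0 (f_bound 0 _); rewrite lexx (le_trans s0)// (le_trans st).
have mPhi : measurable_fun setT (fun z : measurableTypeR R * Omega =>
    \1_(`]s, t]%classic) z.1 * (\1_(`[0, T]%classic) z.1 * f z.1 z.2) : R).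
  apply: measurable_funM; last exact: (measurable_restricted T f jf).
  by apply: (measurableT_comp _ measurable_fst); exact: measurable_indic.
have H r : mean_le P (fun w => `|\1_(`]s, t]%classic) r * (\1_(`[0, T]%classic) r * f r w)|)
    (\1_(`]s, t]%classic) r * cf).
  rewrite [in X in mean_le P _ X]indicE.
  have [|] := boolP (r \in `]s, t]%classic); last first.
    move=> nr; under eq_fun do rewrite indicE (negbTE nr) mul0r normr0.
    rewrite mul0r; exact: mean_le0.
  rewrite inE => /[dup] rst /sub_itv rT.
  under eq_fun do rewrite !indicE !mem_set// ?mul1r.
  by rewrite mul1r; exact: f_bound.
by case: (@mean_le_section _ _ (measurableTypeR R) Omega R mu P _ _ _ mPhi H (itv_mean cf cf0)).
Qed.

Lemma ito_decomposition : exists2 J, ito_integral P F W T g J &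
  {ae P, forall w, V t w - V s w =
    \int[mu]_r (\1_(`]s, t]%classic) r * (\1_(`[0, T]%classic) r * f r w)) + (J t w - J s w)}.
Proof.
case: hV => _ [J [hJ ae]]; exists J => //.
apply: filterS ae => w [iw E].
have sT : 0 <= s <= T by rewrite s0 (le_trans st).
have tT' : 0 <= t <= T by rewrite (le_trans s0 st).
rewrite (E t tT') (E s sT).
have -> : \int[mu]_r (\1_(`]s, t]%classic) r * (\1_(`[0, T]%classic) r * f r w)) =
    \int[mu]_(r in `]s, t]) f r w.
  rewrite /Rintegral [in RHS]integral_mkcond; congr fine; apply: eq_integral => r _.
  rewrite patchE [X in (X * _)%:E]indicE; case: ifPn => [|_]; last by rewrite mul0r.
  by rewrite inE => /sub_itv rT; rewrite indicE mem_set ?mul1r.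
rewrite -(@Rintegral_itvB _ _ (BLeft 0) (BRight t) s); first by ring.
- apply: integrableS iw => //; apply: subset_itvl; by rewrite bnd_simp.
- by rewrite bnd_simp.
- by rewrite bnd_simp.
Qed.

(** Tonelli exchanges time and expectation, after which the bound at each time is integrated over an
    interval of length t - s. *)
Lemma section_deviation (U : Omega -> R) (de : R) : measurable_fun setT U ->
  (forall r, s <= r <= t -> mean_le P (fun w => (g r w - U w) ^+ 2) de) ->
  (\int[P]_w \int[mu]_(r in `]s, t]) ((g r w - U w) ^+ 2)%R%:E <= (de * (t - s))%:E)%E.
Proof.
move=> mU H; have de0 : 0 <= de by apply: mean_le_ge0 (H s _); rewrite lexx.
pose Phi (z : measurableTypeR R * Omega) :=
  (\1_(`]s, t]%classic) z.1 * (\1_(`[0, T]%classic) z.1 * g z.1 z.2 - U z.2) ^+ 2)%:E.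
have mPhi : measurable_fun setT Phi.
  apply/measurable_EFinP; apply: measurable_funM.
    by apply: (measurableT_comp _ measurable_fst); exact: measurable_indic.
  apply: measurable_funX; apply: measurable_funB; first exact: (measurable_restricted T g jg).
  exact: (measurableT_comp mU measurable_snd).
have Phi0 z : (0 <= Phi z)%E by rewrite lee_fin mulr_ge0 ?sqr_ge0// indicE.
have E1 : (\int[P]_w \int[mu]_(r in `]s, t]) ((g r w - U w) ^+ 2)%R%:E =
    \int[P]_w fubini_G (mu : {sigma_finite_measure set (measurableTypeR R) -> \bar R}) Phi w)%E.
  apply: eq_integral => w _; rewrite /fubini_G [LHS]integral_mkcond.
  apply: eq_integral => r _; rewrite patchE /Phi/= indicE.
  case: ifPn => [|_]; last by rewrite mul0r.
  by rewrite inE => /sub_itv rT; rewrite mul1r indicE mem_set ?mul1r.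
rewrite E1.
have FT := @fubini_tonelli _ _ (measurableTypeR R) Omega R mu P Phi mPhi Phi0.
rewrite -FT.
have [_ _ M] := itv_mean de de0; apply: le_trans M.
apply: ge0_le_integral => //.
- by move=> r _; apply: integral_ge0 => w _; exact: Phi0.
- exact: (@measurable_fun_fubini_tonelli_F _ _ _ _ R P Phi).
- apply/measurable_EFinP; apply: measurable_funM => //; exact: measurable_indic.
move=> r _; rewrite /fubini_F /Phi /= indicE.
have [|nr] := boolP (r \in `]s, t]%classic); last first.
  under eq_integral do rewrite mul0r.
  by rewrite integral0 mul0r.
rewrite inE => /[dup] rst /sub_itv rT.
under eq_integral do rewrite mul1r indicE mem_set// mul1r.
rewrite mul1r; case: (H r) => //.
by move: rst; rewrite /= in_itv/= => /andP[/ltW -> ->].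
Qed.

(** The drift contributes [cf * (t - s)]; the stochastic part is bounded in second moment by the
    isometry, and Young's inequality against the constant 1 converts this to a first moment. *)
Lemma ito_increment (U : Omega -> R) (a de l : R) : known F s U ->
  mean_le P (fun w => U w ^+ 2) a -> 0 < l ->
  (forall r, s <= r <= t -> mean_le P (fun w => (g r w - U w) ^+ 2) de) ->
  mean_le P (fun w => `|V t w - V s w - U w * (W t w - W s w)|)
    (cf * (t - s) + (6 * (de * (t - s)) / l + l) / 2).
Proof.
move=> kU U2 l0 H; have mU := known_measurable P F hF s U s0 kU.
have [J hJ ae] := ito_decomposition.
have B := ito_isometry_bound P F W hF hW T g J jg hJ s t a _ U s0 st tT kU U2 (section_deviation U de mU H).
have sT : 0 <= s <= T by rewrite s0 (le_trans st).
have tT' : 0 <= t <= T by rewrite (le_trans s0 st).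
have t0 := le_trans s0 st.
have mD := measurable_brownian_increment P F W hF hW s t s0 st.
have mJ : measurable_fun setT (fun w => J t w - J s w - U w * (W t w - W s w)).
  apply: measurable_funB; last exact: measurable_funM.
  by apply: measurable_funB; exact: (measurable_ito P F W hF T g J hJ).
have m1 : mean_le P (fun=> 1 ^+ 2) 1 by rewrite expr1n; exact: (mean_le_cst P 1 ler01).
have M := mean_le_mul P _ (fun=> 1) l _ 1 l0 mJ (@measurable_cst _ _ _ _ setT (1 : R)) B m1.
rewrite mulr1 in M.
apply: mean_le_ae (mean_leD P _ _ _ _ drift_increment M).
- apply: measurableT_comp => //; apply: measurable_funB; last exact: measurable_funM.
  by apply: measurable_funB; apply: (measurable_path T V jV).
- by move=> w; exact: normr_ge0.
- apply: filterS ae => w ->; rewrite mulr1 -addrA; exact: ler_normD.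
Qed.

End interval.

Context (tau e0 : R) (e00 : 0 < e0) (e0tau : e0 <= tau) (e0T : tau + e0 <= T).
Hypothesis kg : forall t, 0 <= t -> known F t (g t).

Let near_itv t : `|t - tau| <= e0 -> 0 <= t <= T.
Proof. by rewrite ler_norml => /andP[h1 h2]; apply/andP; split; move: h1 h2 e0tau e0T; lra. Qed.

Let cf0 : 0 <= cf.
Proof.
apply: mean_le_ge0 (f_bound tau _); apply: near_itv.
by rewrite subrr normr0 ltW.
Qed.

Let cg0 : 0 <= cg.
Proof.
apply: mean_le_ge0 (g_bound tau _); apply: near_itv.
by rewrite subrr normr0 ltW.
Qed.

(** The case U = 0 and l = e of [ito_increment]: half of [e] comes from l itself, and the rest is
    linear in the length of the interval. *)
Lemma ito_mean_continuous e : 0 < e -> exists2 eta, 0 < eta & forall s t,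
  `|s - tau| <= e0 -> `|t - tau| <= e0 -> `|s - t| <= eta ->
  mean_le P (fun w => `|V s w - V t w|) e.
Proof.
move=> ee0; pose c := cf + 3 * cg / e + 1.
have c0 : 0 < c.
  by rewrite /c ltr_wpDl// addr_ge0// mulr_ge0 ?invr_ge0 ?(ltW ee0)// mulr_ge0.
exists (e / 2 / c); first by rewrite divr_gt0// divr_gt0.
move=> s t; wlog st : s t / s <= t.
  move=> H hs ht dst; have [/H|/ltW/H] := leP s t; first exact.
  under eq_fun do rewrite distrC; apply => //; by rewrite distrC.
move=> /near_itv/andP[s0 sT] /near_itv/andP[t0 tT] dst.
have ts0 : 0 <= t - s by rewrite subr_ge0.
have {}dst : t - s <= e / 2 / c by move: dst; rewrite distrC ger0_norm.
have U2 : mean_le P (fun=> 0 ^+ 2) 0 by rewrite expr0n; exact: mean_le0.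
have Hg r : s <= r <= t -> mean_le P (fun w => (g r w - 0) ^+ 2) cg.
  move=> /andP[sr rt]; under eq_fun do rewrite subr0; apply: g_bound.
  by rewrite (le_trans s0 sr) (le_trans rt tT).
have := ito_increment s t s0 st tT (fun=> 0) 0 cg e (known_cst F s 0) U2 ee0 Hg.
under eq_fun do rewrite mul0r subr0 distrC.
move=> /mean_leW; apply.
have : (t - s) * c <= e / 2 by rewrite -ler_pdivlMr.
rewrite /c; have -> : cf * (t - s) + (6 * (cg * (t - s)) / e + e) / 2 =
  (t - s) * (cf + 3 * cg / e) + e / 2 by field; rewrite gt_eqF.
rewrite mulrDr; move: ts0; set x := t - s; set y := x * _; lra.
Qed.

Hypothesis g_cont : forall e, 0 < e -> exists2 eta, 0 < eta & forall t,
  `|t - tau| <= eta -> mean_le P (fun w => (g t w - g tau w) ^+ 2) e.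

Lemma ito_first_order e : 0 < e -> exists2 eta, 0 < eta & forall t,
  `|t - tau| <= eta -> mean_le P (fun w =>
    `|V t w - V tau w - g tau w * (W t w - W tau w)|) (e * `|t - tau| `^ (1 / 2)).
Proof.
move=> ee0; pose la := e / 4; have la0 : 0 < la by rewrite divr_gt0.
pose de := la * e / 50; have de0 : 0 < de by rewrite divr_gt0// mulr_gt0.
have [ep ep0 Hg] := g_cont de de0.
pose q0 := e / 4 / (cf + 1); have q00 : 0 < q0 by rewrite divr_gt0 ?divr_gt0// ltr_wpDl.
exists (Num.min (Num.min ep e0) (q0 ^+ 2)); first by rewrite !lt_min ep0 e00/= exprn_gt0.
move=> t; rewrite !le_min -andbA => /and3P[tep te0 tq].
have tauT : 0 <= tau <= T by apply: near_itv; rewrite subrr normr0 ltW.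
have [tau0 tauT'] := andP tauT.
have /andP[t0 tT] := near_itv t te0.
have [->|tt] := eqVneq t tau.
  have -> : (fun w => `|V tau w - V tau w - g tau w * (W tau w - W tau w)|) = fun=> 0.
    by apply/funext => w; rewrite !subrr mulr0 subrr normr0.
  by apply: mean_leW (mean_le0 P) _; rewrite mulr_ge0 ?powR_ge0// ltW.
pose x := `|t - tau|; have x0 : 0 < x by rewrite normr_gt0 subr_eq0.
pose q := x `^ (1 / 2); have qx : q ^+ 2 = x.
  rewrite -powR_mulrn ?powR_ge0// -powRrM.
  by rewrite (_ : 1 / 2 * 2%:R = 1) ?powRr1 ?(ltW x0)//; field.
have qgt0 : 0 < q by rewrite powR_gt0.
have qq0 : q <= q0.
  by rewrite -(ler_pXn2r (_ : (0 < 2)%N)) ?nnegrE ?(ltW qgt0) ?(ltW q00)// qx.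
have cfq : cf * q <= e / 4.
  apply: (@le_trans _ _ ((cf + 1) * q0)); last by rewrite /q0 mulrC divfK// gt_eqF// ltr_wpDl.
  by rewrite ler_pM ?(ltW qgt0)// lerDl.
have near_r r : `|r - tau| <= x -> mean_le P (fun w => (g r w - g tau w) ^+ 2) de.
  by move=> rx; apply: Hg; exact: le_trans rx tep.
rewrite -/x -/q.
have lq : 0 < la * q by rewrite mulr_gt0.
have goal_bound (y z : R) : y = cf * q ^+ 2 + (6 * (z * q ^+ 2) / (la * q) + la * q) / 2 ->
    y = q * (cf * q + 3 * z / la + la / 2).
  by move=> ->; field; rewrite !gt_eqF.
have [lt|le] := ltP tau t.
  have xE : t - tau = x by rewrite /x gtr0_norm// subr_gt0.
  have H r : tau <= r <= t -> mean_le P (fun w => (g r w - g tau w) ^+ 2) de.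
    move=> /andP[r1 r2]; apply: near_r; rewrite ger0_norm ?subr_ge0// -xE lerD2r//.
  have := ito_increment tau t tau0 (ltW lt) tT (g tau) cg de (la * q) (kg tau tau0) (g_bound tau tauT) lq H.
  move=> /mean_leW; apply; rewrite xE -qx (goal_bound _ de (erefl _)) mulrC ler_wpM2r ?(ltW qgt0)//.
  rewrite /de; have -> : 3 * (la * e / 50) / la = 3 * e / 50 by field; rewrite gt_eqF.
  by rewrite /la; move: cfq; set y := cf * q; lra.
(* To the left of [tau] the value g_tau is not known at the start of the interval. The integrand is
   frozen at g_t instead, and (g_t - g_tau) (W_tau - W_t) is estimated separately by Young's
   inequality. *)
have lt : t < tau by rewrite lt_neqAle tt.
have xE : tau - t = x by rewrite /x distrC gtr0_norm// subr_gt0.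
have tx : `|t - tau| <= x by [].
have Htt := near_r t tx.
have H r : t <= r <= tau -> mean_le P (fun w => (g r w - g t w) ^+ 2) (4 * de).
  move=> /andP[r1 r2]; have Hr : mean_le P (fun w => (g r w - g tau w) ^+ 2) de.
    by apply: near_r; rewrite distrC ger0_norm ?subr_ge0// -xE lerD2l lerN2.
  have mg u : 0 <= u -> measurable_fun setT (g u).
    by move=> u0; apply: (known_measurable P F hF u) => //; exact: kg.
  have r0 := le_trans t0 r1.
  apply: mean_leW (mean_le_mono P _ _ _ _ _ (mean_leZ P _ _ 2 (ler0n _ _) (mean_leD P _ _ _ _ Hr Htt))) _.
  - by apply: measurable_funX; apply: measurable_funB; exact: mg.
  - move=> w; rewrite sqr_ge0/=; have := sqr_ge0 ((g r w - g tau w) + (g t w - g tau w)).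
    move: (g r w) (g t w) (g tau w) => x1 x2 x3; nra.
  - by rewrite le_eqVlt; apply/orP; left; apply/eqP; ring.
have tT' : 0 <= t <= T by rewrite t0.
have I := ito_increment t tau t0 (ltW lt) tauT' (g t) cg (4 * de) (la * q) (kg t t0) (g_bound t tT') lq H.
have mD := measurable_brownian_increment P F W hF hW t tau t0 (ltW lt).
have [D2 _] := brownian_increment_sqr P F W hW t tau t0 (ltW lt).
have mgB : measurable_fun setT (fun w => g t w - g tau w).
  by apply: measurable_funB; [apply: (known_measurable P F hF t)|apply: (known_measurable P F hF tau)] => //;
    exact: kg.
have laq : 0 < la / q by rewrite divr_gt0.
have X := mean_le_mul P _ _ (la / q) _ _ laq mgB mD Htt D2.
apply: mean_leW (mean_le_mono P _ _ _ _ _ (mean_leD P _ _ _ _ I X)) _.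
- apply: measurableT_comp => //; apply: measurable_funB.
    by apply: measurable_funB; apply: (measurable_path T V jV).
  apply: measurable_funM; first by apply: (known_measurable P F hF tau) => //; exact: kg.
  by apply: measurable_funB; [apply: (known_measurable P F hF t)|apply: (known_measurable P F hF tau)] => //;
    exact: (known_brownian P F W hF hW).
- move=> w; rewrite normr_ge0/= -[leLHS]normrN.
  have -> : - (V t w - V tau w - g tau w * (W t w - W tau w)) =
    (V tau w - V t w - g t w * (W tau w - W t w)) + (g t w - g tau w) * (W tau w - W t w) by ring.
  exact: ler_normD.
- rewrite xE -qx (goal_bound _ (4 * de) (erefl _)).
  have -> : (de / (la / q) + la / q * q ^+ 2) / 2 = q * ((de / la + la) / 2).
    by field; rewrite !gt_eqF.
  rewrite -mulrDr mulrC ler_wpM2r ?(ltW qgt0)// /de.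
  have -> : 3 * (4 * (la * e / 50)) / la = 12 * e / 50 by field; rewrite gt_eqF.
  have -> : la * e / 50 / la = e / 50 by field; rewrite gt_eqF.
  by rewrite /la; move: cfq; set y := cf * q; lra.
Qed.

End ito_increments.

(** * Brownian covariance and the Ito case *)

Lemma ereal_sup_real_bound {R : realType} (D : set R) (h : R -> \bar R) :
  (forall t, D t -> 0 <= h t)%E -> (ereal_sup [set h t | t in D] < +oo)%E ->
  exists c : R, forall t, D t -> (h t <= c%:E)%E.
Proof.
move=> h0; set M := ereal_sup _ => Moo; exists (fine M) => t Dt.
have hM : (h t <= M)%E by apply: ereal_sup_ubound; exists t.
by rewrite fineK// ge0_fin_numE// (le_trans (h0 t Dt)).
Qed.

Lemma margin {R : realType} (tau T : R) : 0 < tau < T ->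
  exists e0 : R, [/\ 0 < e0, e0 <= 1, e0 <= tau & tau + e0 <= T].
Proof.
move=> /andP[a b]; exists (Num.min 1 (Num.min tau (T - tau))); split.
- by rewrite !lt_min ltr01 a subr_gt0.
- by rewrite ge_min lexx.
- by rewrite !ge_min lexx orbT.
- by rewrite -lerBrDl !ge_min lexx !orbT.
Qed.

Lemma mean_le_norm_of_sqr {d} {T : measurableType d} {R : realType}
    (P : probability T R) (X : T -> R) (e : R) : 0 < e -> measurable_fun setT X ->
  mean_le P (fun w => X w ^+ 2) (e ^+ 2) -> mean_le P (fun w => `|X w|) e.
Proof.
move=> e0 mX X2.
have m1 : mean_le P (fun=> 1 ^+ 2) 1 by rewrite expr1n; exact: (mean_le_cst P 1 ler01).
have := mean_le_mul P _ (fun=> 1) e _ 1 e0 mX (@measurable_cst _ _ _ _ setT (1 : R)) X2 m1.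
under eq_fun do rewrite mulr1.
by move=> /mean_leW; apply; rewrite le_eqVlt; apply/orP; left; apply/eqP; field; rewrite gt_eqF.
Qed.

(** The covariance of a two-sided Brownian motion in its polarised form, which makes homogeneity and
    the comparison with second moments of increments immediate. *)
Lemma brownian_CE {R : realType} (r s : R) :
  brownian_C r s = (`|r| + `|s| - `|r - s|) / 2.
Proof.
rewrite /brownian_C.
have [r0|r0] := leP 0 r; have [s0|s0] := leP 0 s.
- rewrite mulr_ge0// (ger0_norm r0) (ger0_norm s0).
  by have [rs|rs] := leP r s; [rewrite ler0_norm ?subr_le0//|rewrite gtr0_norm ?subr_gt0//]; field.
- rewrite (ger0_norm r0) (ltr0_norm s0) ger0_norm; last by rewrite subr_ge0 (le_trans (ltW s0)).
  case: ifP => [rs|_]; last by field.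
  have r00 : r = 0.
    by apply/eqP; rewrite eq_le r0 andbT leNgt; apply/negP => rp; move: rs; rewrite pmulr_rge0// leNgt s0.
  by rewrite r00 min_l ?oppr_ge0 ?(ltW s0)//; field.
- rewrite (ltr0_norm r0) (ger0_norm s0) ltr0_norm; last by rewrite subr_lt0 (lt_le_trans r0).
  case: ifP => [rs|_]; last by field.
  have s00 : s = 0.
    by apply/eqP; rewrite eq_le s0 andbT leNgt; apply/negP => sp; move: rs; rewrite pmulr_lge0// leNgt r0.
  by rewrite s00 min_r ?oppr_ge0 ?(ltW r0)//; field.
- have -> : 0 <= r * s by rewrite nmulr_rge0// ltW.
  rewrite (ltr0_norm r0) (ltr0_norm s0).
  have [rs|rs] := leP r s.
    by rewrite ler0_norm ?subr_le0// min_r ?lerN2//; field.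
  by rewrite gtr0_norm ?subr_gt0// min_l ?lerN2 ?(ltW rs)//; field.
Qed.

Section brownian_moments.
Context {d} {Omega : measurableType d} {R : realType} (P : probability Omega R).
Context (F : R -> set_system Omega) (W : R -> Omega -> R).
Hypotheses (hF : complete_filtration P F) (hW : brownian_motion P F W).

Lemma measurable_brownian t : 0 <= t -> measurable_fun setT (W t).
Proof. by move=> t0; apply: (known_measurable P F hF t) => //; exact: (known_brownian P F W). Qed.

Lemma brownian_sqr u v : 0 <= u -> 0 <= v ->
  mean_le P (fun w => (W u w - W v w) ^+ 2) `|u - v| /\
  \int[P]_w ((W u w - W v w) ^+ 2) = `|u - v|.
Proof.
move=> u0 v0; have [uv|vu] := leP u v.
  have [H1 H2] := brownian_increment_sqr P F W hW u v u0 uv.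
  have -> : (fun w => (W u w - W v w) ^+ 2) = (fun w => (W v w - W u w) ^+ 2).
    by apply/funext => w; rewrite -sqrrN opprB.
  by rewrite distrC ger0_norm ?subr_ge0.
have [H1 H2] := brownian_increment_sqr P F W hW v u v0 (ltW vu).
by rewrite gtr0_norm ?subr_gt0.
Qed.

(** Polarisation: a product of increments from a common point is half of two squares minus the
    square of the difference, and the means of squares are lengths. *)
Lemma brownian_covariance tau r s : 0 <= tau -> 0 <= tau + r -> 0 <= tau + s ->
  \int[P]_w ((W (tau + r) w - W tau w) * (W (tau + s) w - W tau w)) = brownian_C r s.
Proof.
move=> t0 r0 s0.
have [A1 A2] := brownian_sqr _ _ r0 t0; have [B1 B2] := brownian_sqr _ _ s0 t0.
have [C1 C2] := brownian_sqr _ _ r0 s0.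
have iA := mean_le_integrable_ge0 P _ _ A1; have iB := mean_le_integrable_ge0 P _ _ B1.
have iC := mean_le_integrable_ge0 P _ _ C1.
have -> : (fun w => (W (tau + r) w - W tau w) * (W (tau + s) w - W tau w)) =
    (fun w => 2^-1 * (((W (tau + r) w - W tau w) ^+ 2 + (W (tau + s) w - W tau w) ^+ 2) -
      (W (tau + r) w - W (tau + s) w) ^+ 2)).
  by apply/funext => w; field.
have iAB := integrableD measurableT iA iB.
rewrite RintegralZl//; last exact: (integrableB measurableT iAB iC).
rewrite RintegralB// RintegralD// A2 B2 C2 brownian_CE.
rewrite (_ : tau + r - tau = r); last by ring.
rewrite (_ : tau + s - tau = s); last by ring.
by rewrite (_ : tau + r - (tau + s) = r - s) 1?mulrC//; ring.
Qed.

End brownian_moments.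

Section ito_case.
Context {d} {Omega : measurableType d} {R : realType} (P : probability Omega R).
Context (F : R -> set_system Omega) (W : R -> Omega -> R).
Hypotheses (hF : complete_filtration P F) (hW : brownian_motion P F W).
Context (T tau : R) (htau : 0 < tau < T) (mu sigma : R -> Omega -> R).
Hypotheses (jmu : jointly_measurable T mu) (jsigma : jointly_measurable T sigma).
Hypothesis hmoment : moment_bound P T mu sigma.
Context (K : R -> R) (C : R -> R -> R) (hK : admissible_kernel 1 C K).
Hypothesis CE : forall x y, C x y = brownian_C x y.
Context (f g : R -> Omega -> R).
Hypotheses (pf : progressively_measurable F f) (pg : progressively_measurable F g).
Hypothesis hV : ito_process P F W T (fun t w => sigma t w ^+ 2) f g.
Hypothesis supf : (ereal_sup [set 'E_P[fun w => `|f t w|%R] | t in `[0%R, T]] < +oo)%E.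
Hypothesis supg : (ereal_sup [set 'E_P[fun w => (g t w ^+ 2)%R] | t in `[0%R, T]] < +oo)%E.
Hypothesis g_cont : 'E_P[fun w => ((g (tau + h) w - g tau w) ^+ 2)%R]%E @[h --> 0] --> 0%E.

Lemma ito_case : 
  cvg_in_distribution (P \x (normal_prob 0 1 : probability (measurableTypeR R) R))%E
    (fun h p => h `^ (- (1 / 2)) * kernel_error K T tau (fun t w => sigma t w ^+ 2) h p.1)
    (fun p => Num.sqrt (g tau p.1 ^+ 2 * kernel_form K (@brownian_C R)) * p.2).
Proof.
have [e0 [e00 e01 e0tau e0T]] := margin tau T htau.
have /andP[tau0 tauT] := htau; have T0 := ltW (lt_trans tau0 tauT).
have tauI : 0 <= tau <= T by rewrite !ltW.
have jf := progressive_jointly_measurable P F hF f pf T T0.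
have jg := progressive_jointly_measurable P F hF g pg T T0.
have kg t (t0 : 0 <= t) := progressive_known P F hF g pg t t0.
have jV := jointly_measurable_sqr T sigma jsigma.
have mf t (tT : 0 <= t <= T) := measurable_path T f jf t tT.
have mg t (tT : 0 <= t <= T) := measurable_path T g jg t tT.
have near_itv t : `|t - tau| <= e0 -> 0 <= t <= T.
  by rewrite ler_norml => /andP[h1 h2]; apply/andP; split; move: h1 h2 e0tau e0T; lra.
have [cf Hf] : exists cf, forall t, 0 <= t <= T -> mean_le P (fun w => `|f t w|) cf.
  have [|c Hc] := ereal_sup_real_bound _ _ _ supf.
    by move=> t _; rewrite unlock; apply: integral_ge0 => w _; rewrite lee_fin.
  exists c => t tT; split; [exact: measurableT_comp (mf t tT)|by move=> w; exact: normr_ge0|].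
  by have := Hc t; rewrite unlock; apply; rewrite /= in_itv.
have [cg Hg] : exists cg, forall t, 0 <= t <= T -> mean_le P (fun w => g t w ^+ 2) cg.
  have [|c Hc] := ereal_sup_real_bound _ _ _ supg.
    by move=> t _; rewrite unlock; apply: integral_ge0 => w _; rewrite lee_fin sqr_ge0.
  exists c => t tT; split; [exact: measurable_funX (mg t tT)|by move=> w; exact: sqr_ge0|].
  by have := Hc t; rewrite unlock; apply; rewrite /= in_itv.
have gc e : 0 < e -> exists2 eta, 0 < eta & forall t,
    `|t - tau| <= eta -> mean_le P (fun w => (g t w - g tau w) ^+ 2) e.
  move=> ee0.
  have H : nbhs (0%E : \bar R) [set y | (y < e%:E)%E].
    by apply: open_nbhs_nbhs; split; [exact: open_ereal_lt_ereal|rewrite /= lte_fin].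
  have /nbhs_ballP[eta /= eta0 He] := g_cont _ H.
  exists (Num.min e0 (eta / 2)); first by rewrite lt_min e00 divr_gt0.
  move=> t; rewrite le_min => /andP[te0 te].
  have tT := near_itv t te0.
  split; [by apply: measurable_funX; apply: measurable_funB; exact: mg|by move=> w; exact: sqr_ge0|].
  have := He (t - tau); rewrite /ball/= sub0r normrN [tau + _]addrC subrK unlock => Hb.
  by apply: ltW; apply: Hb; rewrite (le_lt_trans te)// gtr_pMr// invf_lt1 ?ltr1n.
have gc1 e : 0 < e -> exists2 eta, 0 < eta & forall t,
    `|t - tau| <= eta -> mean_le P (fun w => `|g t w - g tau w|) e.
  move=> ee0; have [eta eta0 H] := gc (e ^+ 2) (exprn_gt0 2 ee0).
  exists (Num.min eta e0); first by rewrite lt_min eta0.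
  move=> t; rewrite le_min => /andP[te te0]; apply: mean_le_norm_of_sqr => //; last exact: H.
  by apply: measurable_funB; apply: mg => //; exact: near_itv.
have mK := measurable_kernel _ _ _ hK.
have [kap iK] := kernel_weight_mean _ _ _ hK.
have [M0 V_bound] := squared_volatility_bound P T mu sigma jsigma jmu hmoment tau tauI.
have mN t : `|t - tau| <= e0 -> measurable_fun setT (W t).
  by move=> /near_itv/andP[t0 _]; exact: (measurable_brownian P F W hF hW).
have N_bound t : `|t - tau| <= e0 ->
    mean_le P (fun w => (W t w - W tau w) ^+ 2) (1 * `|t - tau| `^ 1).
  move=> /near_itv/andP[t0 _]; rewrite mul1r powRr1//.
  by case: (brownian_sqr P F W hW t tau t0 (ltW tau0)).
have V_cont := ito_mean_continuous P F W hF hW T _ f g jV jf jg hV cf cg Hf Hg tau e0 e00 e0tau e0T.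
have N_cont e : 0 < e -> exists2 eta, 0 < eta & forall s t,
    `|s - tau| <= e0 -> `|t - tau| <= e0 -> `|s - t| <= eta ->
    mean_le P (fun w => (W s w - W t w) ^+ 2) e.
  move=> ee0; exists e => // s t /near_itv/andP[s0 _] /near_itv/andP[t0 _] st.
  by case: (brownian_sqr P F W hW s t s0 t0) => H _; exact: mean_leW H _.
have N_cov e : 0 < e -> exists2 eta, 0 < eta & forall r s : R, `|r| <= eta -> `|s| <= eta ->
    `|\int[P]_w ((W (tau + r) w - W tau w) * (W (tau + s) w - W tau w)) - 1 * C r s| <=
    e * (r ^+ 2 + s ^+ 2) `^ (1 / 2).
  move=> ee0; exists e0 => // r s re se.
  have tr (x : R) : `|x| <= e0 -> 0 <= tau + x.
    by rewrite ler_norml => /andP[h1 h2]; move: h1 h2 e0tau; lra.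
  rewrite (brownian_covariance P F W hW tau r s (ltW tau0) (tr r re) (tr s se)).
  by rewrite CE mul1r subrr normr0 mulr_ge0 ?powR_ge0// ltW.
have C_hom a r s : 0 < a -> C (a * r) (a * s) = a `^ 1 * C r s.
  move=> a0; rewrite !CE !brownian_CE -mulrBr !normrM (gtr0_norm a0) powRr1 ?(ltW a0)//.
  by field.
have V_approx A e : 0 < A -> 0 < e -> exists2 eta, 0 < eta & forall t,
    `|t - tau| <= eta -> mean_le P (fun w => \1_[set w | `|g tau w| <= A] w *
    `|sigma t w ^+ 2 - sigma tau w ^+ 2 - g tau w * (W t w - W tau w)|) (e * `|t - tau| `^ (1 / 2)).
  move=> _ ee0.
  have [eta eta0 H] := ito_first_order P F W hF hW T _ f g jV jf jg hV cf cg Hf Hg tau e0 e00 e0tau e0T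
    (fun t t0 => kg t t0) gc e ee0.
  exists eta => // t te; have M := H t te; have [mM _ _] := M.
  apply: mean_le_mono M.
    apply: measurable_funM => //; apply: measurable_indic.
    have -> : [set w | `|g tau w| <= A] = ~` [set w | A < `|g tau w|].
      by apply/seteqP; split=> w /=; rewrite leNgt => /negP.
    by apply: measurableC; apply: measurable_lt_norm; exact: mg.
  move=> w; rewrite indicE; case: (_ \in _); rewrite ?mul1r ?mul0r normr_ge0 ?lexx//.
have kg' t : `|t - tau| <= e0 -> known F t (g t).
  by move=> /near_itv/andP[t0 _]; exact: kg.
have trig (dl : nat -> R) (m : nat -> nat) (a b c : R) :
  (forall n, 0 < dl n) -> (forall n, dl n <= e0) -> dl @ \oo --> 0 ->
  (forall n, (0 < m n)%N) -> (forall n, (dl n)^-1 / (m n)%:R <= 1) ->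
  \int[P]_w (grid_sum tau 1 K W (dl n) (m n) w ^+ 2) @[n --> \oo] --> 1 * kernel_form K C ->
  \int[P]_w cos (a * g tau w + b * grid_sum tau 1 K W (dl n) (m n) w + c) @[n --> \oo] -->
  \int[P]_w cos (a * g tau w + c) * expR (- (b ^+ 2 * (1 * kernel_form K C)) / 2).
  move=> h1 h2 h3 h4 _ h5.
  exact: (brownian_trig P F W hF hW tau 1 e0 _ K g e0tau kg' gc1 dl m a b c h1 h2 h3 h4 h5).
(* The abstract theorem is used with driving process [W], conditioning variable [g tau], factor the
   identity, and gamma = L = 1. *)
have cid : continuous (@id R) by move=> x; exact: cvg_id.
have -> : @brownian_C R = C by apply/funext => x; apply/funext => y; rewrite CE.
have := mixed_normal_cvg P T tau 1 kap M0 1 e0 1 K id C _ W (g tau) htau jV ltr01 mK iK V_bound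
  e00 e01 e0tau e0T (mg tau tauI) cid mN N_bound V_cont N_cont N_cov C_hom V_approx trig.
by rewrite (mul1r (kernel_form K C)).
Qed.

End ito_case.

(** * Increments of a Gaussian process under uniform scaling *)

Section gaussian_increments.
Context {d} {Omega : measurableType d} {R : realType} (P : probability Omega R).
Context (Z : R -> Omega -> R) (hZ : gaussian_process P Z).

Lemma gaussian_variable_facts (Y : Omega -> R) : gaussian_variable P Y ->
  [/\ measurable_fun setT Y, P.-integrable setT (EFin \o Y) &
      mean_le P (fun w => Y w ^+ 2) (\int[P]_w (Y w ^+ 2))].
Proof.
move=> gY; have [k /(_ Y gY)[m [s [mY _ _ Y4 _]]]] := gaussian_moments P.
have H := mean_leD P _ _ _ _ (mean_le_cst P 1 ler01) Y4.
split=> //.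
- apply: mean_le_integrable => //.
  apply: mean_le_mono H; first exact: measurableT_comp.
  by move=> w; rewrite normr_ge0 normr_le_quartic.
- apply: integrable_mean_le; last by move=> w; exact: sqr_ge0.
  apply: mean_le_integrable_ge0; apply: mean_le_mono H; first exact: measurable_funX.
  by move=> w; rewrite sqr_ge0 sqr_le_quartic.
Qed.

Lemma gaussian_process_at t : 0 <= t -> gaussian_variable P (Z t).
Proof.
move=> t0; have := hZ 1%N (fun=> t) (fun=> 1) (fun=> t0).
by under eq_fun do rewrite big_ord1 mul1r.
Qed.

Lemma gaussian_process_increment s t : 0 <= s -> 0 <= t ->
  gaussian_variable P (fun w => Z s w - Z t w).
Proof.
move=> s0 t0; pose u (i : 'I_2) := if i == ord0 then s else t.
pose a (i : 'I_2) : R := if i == ord0 then 1 else -1.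
have u0 i : 0 <= u i by rewrite /u; case: ifP.
have := hZ 2%N u a u0; under eq_fun do rewrite big_ord_recl big_ord1 /a/u/= mul1r mulN1r.
by [].
Qed.

Lemma measurable_gaussian_process t : 0 <= t -> measurable_fun setT (Z t).
Proof. by move=> /gaussian_process_at /gaussian_variable_facts[]. Qed.

Lemma integrable_increments s t u v : 0 <= s -> 0 <= t -> 0 <= u -> 0 <= v ->
  P.-integrable setT (EFin \o (fun w => (Z s w - Z t w) * (Z u w - Z v w))).
Proof.
move=> s0 t0 u0 v0.
have [m1 _ h1] := gaussian_variable_facts _ (gaussian_process_increment s t s0 t0).
have [m2 _ h2] := gaussian_variable_facts _ (gaussian_process_increment u v u0 v0).
exact: (integrable_mul P _ _ _ _ m1 m2 h1 h2).
Qed.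

Context (T gamma : R) (LZ : R -> R) (CZ : R -> R -> R).
Hypotheses (g0 : 0 < gamma) (hU : scaling_condition_uniform P T Z gamma LZ CZ).

Let CZ_hom h r s : 0 < h -> CZ (h * r) (h * s) = h `^ gamma * CZ r s.
Proof. by case: hU => -[_ _ _ H] _ _; exact: H. Qed.

(** Homogeneity at the origin with factor 2 reads C(0, 0) = 2^gamma C(0, 0), and 2^gamma differs
    from 1. *)
Let CZ00 : CZ 0 0 = 0.
Proof.
have := CZ_hom 2 0 0 (ltr0n _ 2); rewrite !mulr0 => E.
have : (2 `^ gamma - 1) * CZ 0 0 = 0 by rewrite mulrBl mul1r -E subrr.
move/eqP; rewrite mulf_eq0 => /orP[|/eqP//].
by rewrite subr_eq0 powR_eq1 (gt_eqF g0) orbF => /orP[/eqP h|h]; exfalso; move: h; lra.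
Qed.

Lemma uniform_scaling e : 0 < e -> exists2 eta, 0 < eta & forall t r s,
  0 < t < T -> 0 <= t + r -> 0 <= t + s -> `|r| <= eta -> `|s| <= eta ->
  `|\int[P]_w ((Z (t + r) w - Z t w) * (Z (t + s) w - Z t w)) - LZ t * CZ r s| <=
  e * (r ^+ 2 + s ^+ 2) `^ (gamma / 2).
Proof.
move=> e0; case: hU => _ lim _.
have H : nbhs (0%E : \bar R) [set y | (y < e%:E)%E].
  by apply: open_nbhs_nbhs; split; [exact: open_ereal_lt_ereal|rewrite /= lte_fin].
have /nbhs_ballP[eta /= eta0 He] := lim _ H.
exists (eta / 2); first by rewrite divr_gt0.
move=> t r s tT r0 s0 re se.
(* The scaling limit is over punctured neighbourhoods, so the origin is treated apart, where both
   sides vanish. *)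
have [/eqP[-> ->]|rs] := boolP ((r, s) == (0, 0)).
  rewrite addr0 CZ00 mulr0 subr0; under eq_Rintegral do rewrite subrr mulr0.
  by rewrite /Rintegral integral0 normr0 mulr_ge0 ?powR_ge0// ltW.
have half (x : R) : `|x| <= eta / 2 -> ball (0 : R) eta x.
  rewrite /ball/= sub0r normrN => /le_lt_trans; apply.
  by rewrite gtr_pMr// invf_lt1 ?ltr1n.
have := He (r, s) (conj (half r re) (half s se)) rs.
rewrite /= => Hs.
have {}Hs : (scaling_error P Z gamma LZ CZ t (r, s) < e%:E)%E.
  by apply: le_lt_trans Hs; apply: ereal_sup_ubound; exists t.
have t0 : 0 <= t by case/andP: tT => /ltW.
have q0 : 0 < r ^+ 2 + s ^+ 2.
  rewrite lt_neqAle addr_ge0 ?sqr_ge0// andbT eq_sym paddr_eq0 ?sqr_ge0// !sqrf_eq0.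
  by move: rs; rewrite xpair_eqE.
move: Hs; rewrite /scaling_error/= unlock.
have fin := integrable_fin_num measurableT (integrable_increments _ _ _ _ r0 t0 s0 t0).
rewrite -(fineK fin) -EFinB abse_EFin -EFinM lte_fin powRN => Hs.
by apply: ltW; rewrite [e * _]mulrC -ltr_pdivrMl ?powR_gt0.
Qed.

(** The scaling expansion on the diagonal: by homogeneity C(x, x) is |x|^gamma times its value at 1
    or at -1, and L is bounded on the interval. Uniformity in t gives increments between any two
    points near [tau], not only from [tau]. *)
Lemma uniform_increment_sqr : exists eta kN, [/\ 0 < eta, eta <= 1, 0 <= kN & forall s t,
  0 < t < T -> 0 <= s -> `|s - t| <= eta ->
  mean_le P (fun w => (Z s w - Z t w) ^+ 2) (kN * `|s - t| `^ gamma)].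
Proof.
have [eta eta0 H] := uniform_scaling 1 ltr01.
case: hU => _ _ supL.
have [|CL HL] := ereal_sup_real_bound _ (fun t => `|LZ t|%:E) _ supL.
  by move=> t _; rewrite lee_fin.
pose k := `|CL| * (`|CZ 1 1| + `|CZ (-1) (-1)|) + 2 `^ (gamma / 2).
have k0 : 0 <= k by rewrite /k addr_ge0 ?powR_ge0// mulr_ge0// addr_ge0.
exists (Num.min eta 1), k; split=> //; first by rewrite lt_min eta0 ltr01.
  by rewrite ge_min lexx orbT.
move=> s t tT s0; rewrite le_min => /andP[st _].
have t0 : 0 <= t by case/andP: tT => /ltW.
have [mD _ D2] := gaussian_variable_facts _ (gaussian_process_increment s t s0 t0).
apply: mean_leW D2 _.
have ts : t + (s - t) = s by rewrite addrC subrK.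
have := H t (s - t) (s - t) tT; rewrite ts => /(_ s0 s0 st st).
set x := s - t => HI.
rewrite (_ : \int[P]_w _ = \int[P]_w ((Z s w - Z t w) * (Z s w - Z t w))); last first.
  by apply: eq_Rintegral => w _; rewrite expr2.
move: HI; set I := (X in X <= _) => HI.
have C1 : `|CZ x x| <= `|x| `^ gamma * (`|CZ 1 1| + `|CZ (-1) (-1)|).
  have [x0|x0|->] := ltgtP x 0.
  - have -> : CZ x x = CZ (`|x| * -1) (`|x| * -1) by rewrite ltr0_norm// mulrN1 opprK.
    rewrite CZ_hom ?normr_gt0 ?lt_eqF// normrM ger0_norm ?powR_ge0// ler_wpM2l ?powR_ge0//.
    by rewrite lerDr.
  - have -> : CZ x x = CZ (`|x| * 1) (`|x| * 1) by rewrite gtr0_norm// mulr1.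
    rewrite CZ_hom ?normr_gt0 ?gt_eqF// normrM ger0_norm ?powR_ge0// ler_wpM2l ?powR_ge0//.
    by rewrite lerDl.
  - by rewrite CZ00 normr0 mulr_ge0 ?powR_ge0// addr_ge0.
have L1 : `|LZ t| <= `|CL|.
  by apply: (le_trans _ (ler_norm CL)); rewrite -lee_fin; apply: HL; rewrite /= in_itv.
have P1 : (x ^+ 2 + x ^+ 2) `^ (gamma / 2) = 2 `^ (gamma / 2) * `|x| `^ gamma.
  have -> : x ^+ 2 + x ^+ 2 = 2 * `|x| ^+ 2 by rewrite real_normK ?num_real// mulr2n mulrDl mul1r.
  rewrite powRM ?sqr_ge0// -[`|x| ^+ 2]powR_mulrn// -powRrM; congr (_ * _ `^ _).
  by field.
have : `|LZ t * CZ x x| <= `|CL| * (`|x| `^ gamma * (`|CZ 1 1| + `|CZ (-1) (-1)|)).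
  by rewrite normrM ler_pM.
move: HI; rewrite P1 mul1r !ler_norml => /andP[_ h1] /andP[_ h2].
rewrite /k mulrDl; move: h1 h2.
rewrite (_ : `|CL| * (`|x| `^ gamma * _) = `|CL| * (`|CZ 1 1| + `|CZ (-1) (-1)|) * `|x| `^ gamma); last by ring.
move: (2 `^ _ * _) (`|CL| * _ * _) (LZ t * _) => y z u; lra.
Qed.

End gaussian_increments.

(** * Local bounds for C^2 functions *)

Section smooth_bounds.
Context {R : realType}.
Implicit Types h : R -> R.

Lemma continuous_bounded_itv h A : continuous h -> exists c, 0 <= c /\
  forall x, `|x| <= A -> `|h x| <= c.
Proof.
move=> ch; have [A0|A0] := leP 0 A; last first.
  by exists 0; split=> // x /(le_trans (normr_ge0 x)); rewrite leNgt A0.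
have AA : - A <= A by rewrite ge0_cp.
have cn : {within `[- A, A], continuous (fun x => `|h x|)}.
  apply: continuous_subspaceT => x; apply: (continuous_comp (ch x)); exact: norm_continuous.
have [c _ H] := EVT_max AA cn.
exists `|h c|; split=> // x; rewrite ler_norml => xA; apply: H.
by rewrite in_itv.
Qed.

Lemma derivable_continuous h : (forall x, derivable h x 1) -> continuous h.
Proof. by move=> dh x; apply: differentiable_continuous; exact/derivable1_diffP. Qed.

Lemma mean_value_segment h x y : (forall z, derivable h z 1) ->
  exists2 z, h y - h x = derive1 h z * (y - x) & Num.min x y <= z <= Num.max x y.
Proof.
move=> dh.
have dh' z : is_derive z (1 : R) h (derive1 h z).
  by rewrite derive1E; exact: derivableP.
have ch := derivable_continuous h dh.
wlog xy : x y / x <= y.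
  move=> H; have [xy|/ltW yx] := leP x y.
    by have := H _ _ xy; rewrite (min_idPl xy) (max_idPr xy).
  have [z E zxy] := H _ _ yx; exists z; last by rewrite minC maxC in zxy; rewrite (min_idPr yx) (max_idPl yx) in zxy.
  by rewrite -opprB E -mulrN opprB.
have [z] := MVT_segment xy (fun z _ => dh' z) (continuous_subspaceT ch).
by rewrite in_itv/= => zxy E; exists z => //; rewrite (min_idPl xy) (max_idPr xy).
Qed.

Lemma derivable_lipschitz_itv h A : (forall z, derivable h z 1) -> continuous (derive1 h) ->
  exists c, 0 <= c /\ forall x y, `|x| <= A -> `|y| <= A -> `|h x - h y| <= c * `|x - y|.
Proof.
move=> dh ch'; have [c [c0 Hc]] := continuous_bounded_itv _ A ch'.
exists c; split=> // x y; rewrite (ler_norml x) (ler_norml y) => /andP[x1 x2] /andP[y1 y2].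
have [z -> /andP[z1 z2]] := mean_value_segment h y x dh.
rewrite normrM ler_wpM2r// Hc// ler_norml (le_trans _ z1) ?le_min ?x1 ?y1//=.
by rewrite (le_trans z2)// ge_max x2 y2.
Qed.

(** The mean value theorem for h gives an intermediate point, and the Lipschitz bound for its
    derivative on [-A - 1, A + 1] gives a second factor |y - x|. *)
Lemma taylor_quadratic_bound h A : (forall x, derivable h x 1) ->
  (forall x, derivable (derive1 h) x 1) -> continuous (derive1 (derive1 h)) ->
  exists c, 0 <= c /\ forall x y, `|x| <= A -> `|y - x| <= 1 ->
    `|h y - h x - derive1 h x * (y - x)| <= c * (y - x) ^+ 2.
Proof.
move=> dh dh1 ch2; have [c [c0 Hc]] := derivable_lipschitz_itv _ (A + 1) dh1 ch2.
exists c; split=> // x y; rewrite (ler_norml x) (ler_norml (y - x)) => /andP[x1 x2] /andP[d1 d2].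
have [z -> /andP[z1 z2]] := mean_value_segment h x y dh.
rewrite -mulrBl normrM -[(y - x) ^+ 2]real_normK ?num_real// expr2 mulrA ler_wpM2r//.
have zx : `|z - x| <= `|y - x|.
  have [xy|/ltW yx] := leP x y.
    rewrite (min_idPl xy) in z1; rewrite (max_idPr xy) in z2.
    by rewrite !ger0_norm ?subr_ge0// lerD2r.
  rewrite (min_idPr yx) in z1; rewrite (max_idPl yx) in z2.
  by rewrite !ler0_norm ?subr_le0// lerN2 lerD2r.
have zA : `|z| <= A + 1.
  have xA : `|x| <= A by rewrite ler_norml x1.
  have yx1 : `|y - x| <= 1 by rewrite ler_norml d1.
  rewrite -(subrK x z) (le_trans (ler_normD _ _))// addrC lerD//.
  exact: le_trans yx1.
have xA : `|x| <= A + 1 by rewrite ler_norml; apply/andP; split; lra.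
by rewrite (le_trans (Hc z x zA xA))// ler_wpM2l.
Qed.

End smooth_bounds.

(** * Continuity and first-order expansion of f(Z) *)

Section gaussian_volatility.
Context {d} {Omega : measurableType d} {R : realType} (P : probability Omega R).
Context (Z V : R -> Omega -> R) (hZ : gaussian_process P Z).
Context (tau gamma kN M e0 : R) (f : R -> R).
Hypotheses (df : forall x, derivable f x 1) (df1 : forall x, derivable (derive1 f) x 1).
Hypothesis cf2 : continuous (derive1 (derive1 f)).
Hypotheses (g1 : 1 <= gamma) (e00 : 0 < e0) (e01 : e0 <= 1) (M0 : 0 < M) (kN0 : 0 <= kN).
Hypothesis nonneg : forall t, `|t - tau| <= e0 -> 0 <= t.
Hypothesis mV : forall t, `|t - tau| <= e0 -> measurable_fun setT (V t).
Hypothesis V2 : forall t, `|t - tau| <= e0 -> mean_le P (fun w => V t w ^+ 2) M.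
Hypothesis VZ : {ae P, forall w t, `|t - tau| <= e0 -> V t w = f (Z t w)}.
Hypothesis incr : forall s t, `|s - tau| <= e0 -> `|t - tau| <= e0 -> `|s - t| <= e0 ->
  mean_le P (fun w => (Z s w - Z t w) ^+ 2) (kN * `|s - t| `^ gamma).

Let g0 : 0 < gamma. Proof. exact: lt_le_trans g1. Qed.

Let tau_near : `|tau - tau| <= e0. Proof. by rewrite subrr normr0 ltW. Qed.

Let cf1 : continuous (derive1 f). Proof. exact: derivable_continuous. Qed.

Let powR_le (x : R) : 0 <= x -> x <= 1 -> x `^ gamma <= x.
Proof.
rewrite le_eqVlt => /predU1P[<- _|x0 x1]; first by rewrite powR0// gt_eqF.
by apply: ge1r_powR => //; rewrite x0.
Qed.

Lemma increment_sqr_small e : 0 < e -> exists2 eta, 0 < eta & forall s t,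
  `|s - tau| <= e0 -> `|t - tau| <= e0 -> `|s - t| <= eta ->
  mean_le P (fun w => (Z s w - Z t w) ^+ 2) e.
Proof.
move=> ee0; have k1 : 0 < kN + 1 by rewrite ltr_wpDl.
exists (Num.min e0 (e / (kN + 1))); first by rewrite lt_min e00 divr_gt0.
move=> s t hs ht; rewrite le_min => /andP[h1 h2].
apply: mean_leW (incr s t hs ht h1) _.
apply: (@le_trans _ _ ((kN + 1) * `|s - t|)); last by rewrite mulrC -ler_pdivlMr.
apply: ler_pM => //; first by rewrite lerDl.
by apply: powR_le => //; exact: le_trans e01.
Qed.

Let Z2 : exists ZB, 0 <= ZB /\ forall t, `|t - tau| <= e0 -> mean_le P (fun w => Z t w ^+ 2) ZB.
Proof.
have [_ _ H] := gaussian_variable_facts P _ (gaussian_process_at P Z hZ tau (nonneg tau tau_near)).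
set q := (\int[P]_w _) in H.
have H0 : 0 <= q := mean_le_ge0 P _ _ H.
exists (2 * q + 2 * kN); split; first by rewrite addr_ge0// mulr_ge0.
move=> t tt.
have ti := incr t tau tt tau_near tt.
have m2 := mean_leD P _ _ _ _ (mean_leZ P _ _ 2 (ler0n _ _) H) (mean_leZ P _ _ 2 (ler0n _ _) ti).
apply: mean_leW (mean_le_mono P _ _ _ _ _ m2) _.
- by apply: measurable_funX; exact: (measurable_gaussian_process P Z hZ t (nonneg t tt)).
- move=> w; rewrite sqr_ge0/=; have := sqr_ge0 (2 * Z tau w - Z t w).
  move: (Z t w) (Z tau w) => x y; nra.
- rewrite lerD2l ler_wpM2l// ler_piMr//.
  by rewrite (le_trans (powR_le _ (normr_ge0 _) (le_trans tt e01)))// (le_trans tt).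
Qed.

(** Where both values of Z are at most A in modulus, f is Lipschitz. Elsewhere Young's inequality
    bounds |f(x) - f(y)| by la (f(x)^2 + f(y)^2) plus 1/(2 la), and this constant is at most (x^2 +
    y^2) / (2 la A); moments of V and Z finish the estimate. *)
Lemma gaussian_mean_continuous e : 0 < e -> exists2 eta, 0 < eta & forall s t,
  `|s - tau| <= e0 -> `|t - tau| <= e0 -> `|s - t| <= eta ->
  mean_le P (fun w => `|V s w - V t w|) e.
Proof.
move=> ee0; have [ZB [ZB0 HZB]] := Z2.
(* Chosen in the order [la], [A], [l], so that each of the three contributions is at most e/4. *)
pose la := e / (8 * M); have la0 : 0 < la by rewrite divr_gt0// mulr_gt0.
pose A := 4 * ZB / (la * e) + 1.
have q0 : 0 <= 4 * ZB / (la * e) by rewrite divr_ge0//; [exact: mulr_ge0|exact: mulr_ge0 (ltW la0) (ltW ee0)].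
have A1 : 1 <= A by rewrite lerDr.
have A0 : 0 < A by exact: lt_le_trans A1.
have [c [c0 Hc]] := derivable_lipschitz_itv f A df cf1.
pose l := e / (4 * (c + 1)); have l0 : 0 < l by rewrite divr_gt0// mulr_gt0// ltr_wpDl.
have [eta eta0 Heta] := increment_sqr_small (l ^+ 2) (exprn_gt0 2 l0).
exists eta => // s t hs ht st.
have D2 := Heta s t hs ht st.
have il : 0 <= c / (2 * l) by rewrite divr_ge0// mulr_ge0// ltW.
have ila : 0 <= (2 * la * A)^-1.
  by rewrite invr_ge0; apply: mulr_ge0 (ltW A0); apply: mulr_ge0 (ltW la0).
have B := mean_leD P _ _ _ _ (mean_leD P _ _ _ _
  (mean_leD P _ _ _ _ (mean_leZ P _ _ _ il D2) (mean_le_cst P (c * l / 2) (divr_ge0 (mulr_ge0 c0 (ltW l0)) (ler0n _ _))))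
  (mean_leZ P _ _ la (ltW la0) (mean_leD P _ _ _ _ (V2 s hs) (V2 t ht))))
  (mean_leZ P _ _ _ ila (mean_leD P _ _ _ _ (HZB s hs) (HZB t ht))).
have mD : measurable_fun setT (fun w => `|V s w - V t w|).
  by apply: measurableT_comp => //; apply: measurable_funB; exact: mV.
apply: mean_leW (mean_le_ae P _ _ _ mD (fun w => normr_ge0 _) _ B) _.
- apply: filterS VZ => w Hw; rewrite (Hw s hs) (Hw t ht).
  move: (Z s w) (Z t w) => x y.
  have T1 : 0 <= c / (2 * l) * (x - y) ^+ 2 + c * l / 2.
    exact: addr_ge0 (mulr_ge0 il (sqr_ge0 _)) (divr_ge0 (mulr_ge0 c0 (ltW l0)) (ler0n _ _)).
  have T3 : 0 <= (2 * la * A)^-1 * (x ^+ 2 + y ^+ 2) by rewrite mulr_ge0// addr_ge0// sqr_ge0.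
  have T2 : 0 <= la * (f x ^+ 2 + f y ^+ 2) by rewrite mulr_ge0 ?(ltW la0)// addr_ge0// sqr_ge0.
  have [xyA|] := boolP ((`|x| <= A) && (`|y| <= A)).
    have /andP[xA yA] := xyA.
    apply: (le_trans (Hc x y xA yA)).
    suff : c * `|x - y| <= c / (2 * l) * (x - y) ^+ 2 + c * l / 2 by lra.
    rewrite (_ : c / (2 * l) * _ + _ = c * ((x - y) ^+ 2 / (2 * l) + l / 2)); last by field; rewrite gt_eqF.
    rewrite ler_wpM2l// -real_normK ?num_real//; move: `|x - y| => u.
    have : 0 <= (u - l) ^+ 2 / (2 * l) by rewrite divr_ge0 ?sqr_ge0// mulr_ge0// ltW.
    rewrite (_ : (u - l) ^+ 2 / (2 * l) = u ^+ 2 / (2 * l) + l / 2 - u); last by field; rewrite gt_eqF.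
    by lra.
  rewrite negb_and -!ltNge => big.
  have big2 : A <= x ^+ 2 + y ^+ 2.
    have sq u : A < `|u| -> A <= u ^+ 2.
      move=> Au; rewrite -real_normK ?num_real// expr2.
      by apply: (le_trans (ltW Au)); rewrite ler_peMl// (le_trans A1)// ltW.
    have := sqr_ge0 x; have := sqr_ge0 y.
    by case/orP: big => /sq; move: (x ^+ 2) (y ^+ 2) => u v; lra.
  have T3' : (2 * la)^-1 <= (2 * la * A)^-1 * (x ^+ 2 + y ^+ 2).
    have ila2 : 0 <= (2 * la)^-1 by rewrite invr_ge0; apply: mulr_ge0 (ltW la0).
    by rewrite [(2 * la * A)^-1]invfM -mulrA ler_peMr// ler_pdivlMl// mulr1.
  suff : `|f x - f y| <= la * (f x ^+ 2 + f y ^+ 2) + (2 * la)^-1 by lra.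
  have : 0 <= la * (`|f x - f y| - la^-1) ^+ 2 by rewrite mulr_ge0 ?sqr_ge0// ltW.
  have sq : `|f x - f y| ^+ 2 = (f x - f y) ^+ 2 by rewrite real_normK ?num_real.
  have -> : la * (`|f x - f y| - la^-1) ^+ 2 = la * (f x - f y) ^+ 2 - 2 * `|f x - f y| + la^-1.
    by rewrite -sq; field; rewrite gt_eqF.
  have -> : (2 * la)^-1 = la^-1 / 2 by rewrite invfM mulrC.
  have : 0 <= la * (f x + f y) ^+ 2 by rewrite mulr_ge0 ?sqr_ge0// ltW.
  rewrite (_ : la * (f x - f y) ^+ 2 = 2 * (la * (f x ^+ 2 + f y ^+ 2)) - la * (f x + f y) ^+ 2); last by ring.
  move: (la * _) (la * _) `|_| (la^-1) => u v z y'; lra.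
- have -> : la * (M + M) = e / 4 by rewrite /la; field; rewrite gt_eqF.
  have -> : c / (2 * l) * l ^+ 2 + c * l / 2 = c * l by field; rewrite gt_eqF.
  have cl : c * l <= e / 4.
    rewrite /l (_ : c * _ = e / 4 * (c / (c + 1))); last by field; rewrite gt_eqF// ltr_wpDl.
    rewrite ler_piMr ?divr_ge0 ?(ltW ee0)// ler_pdivrMr ?ltr_wpDl// mul1r lerDl//.
  have AZ : (2 * la * A)^-1 * (ZB + ZB) <= e / 4.
    rewrite mulrC ler_pdivrMr; last first.
      by apply: mulr_gt0 A0; apply: mulr_gt0 la0.
    have lae : 0 < la * e by exact: mulr_gt0.
    have : 4 * ZB <= la * e * A.
      by rewrite /A mulrDr mulr1 [la * e * _]mulrC divfK ?gt_eqF// lerDl ltW.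
    by rewrite (_ : e / 4 * (2 * la * A) = la * e * A / 2); [lra|field].
  by lra.
Qed.

(** Let D be the increment of Z and q = |t - tau|^(gamma/2). On |Z_tau| <= A the remainder is at
    most c D^2 + D^4 / (2 q^2) + q^2 (V_t^2 + V_tau^2): Taylor's formula for |D| <= 1, and D^2 >= 1
    otherwise. Since D is Gaussian with second moment of order q^2, its fourth moment is of order
    q^4, and the whole mean is at most [kap] q^2, which is o(q). *)
Lemma gaussian_first_order A e : 0 < A -> 0 < e -> exists2 eta, 0 < eta & forall t,
  `|t - tau| <= eta -> mean_le P (fun w => \1_[set w | `|Z tau w| <= A] w *
    `|V t w - V tau w - derive1 f (Z tau w) * (Z t w - Z tau w)|) (e * `|t - tau| `^ (gamma / 2)).
Proof.
move=> A0 ee0; have [c1 [c10 Hc1]] := taylor_quadratic_bound f A df df1 cf2.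
have [c2 [c20 Hc2]] := continuous_bounded_itv (derive1 f) A cf1.
have [K4 HK4] := gaussian_moments P.
pose c := c1 + c2; have c0 : 0 <= c by exact: addr_ge0.
pose kap := c * kN + `|K4| * kN ^+ 2 / 2 + 2 * M.
have kap0 : 0 <= kap.
  rewrite /kap; apply: addr_ge0; last exact: mulr_ge0 (ltW M0).
  by apply: addr_ge0; [exact: mulr_ge0|apply: divr_ge0 => //; exact: mulr_ge0 (sqr_ge0 _)].
have k1 : 0 < kap + 1 by rewrite ltr_wpDl.
have q00 : 0 < e / (kap + 1) by exact: divr_gt0.
exists (Num.min e0 ((e / (kap + 1)) ^+ 2)); first by rewrite lt_min e00 exprn_gt0.
move=> t; rewrite le_min => /andP[tt tq].
have mZ s (hs : `|s - tau| <= e0) := measurable_gaussian_process P Z hZ s (nonneg s hs).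
have mf1 : measurable_fun setT (derive1 f) by exact: continuous_measurable_fun.
have mA : measurable [set w | `|Z tau w| <= A].
  have -> : [set w | `|Z tau w| <= A] = ~` [set w | A < `|Z tau w|].
    by apply/seteqP; split=> w /=; rewrite leNgt => /negP.
  by apply: measurableC; apply: measurable_lt_norm; exact: mZ.
have mF : measurable_fun setT (fun w => \1_[set w | `|Z tau w| <= A] w *
    `|V t w - V tau w - derive1 f (Z tau w) * (Z t w - Z tau w)|).
  apply: measurable_funM; first exact: measurable_indic.
  apply: measurableT_comp => //; apply: measurable_funB.
    by apply: measurable_funB; exact: mV.
  apply: measurable_funM; first exact: (measurableT_comp mf1 (mZ tau tau_near)).
  by apply: measurable_funB; exact: mZ.
have F0 w : 0 <= \1_[set w | `|Z tau w| <= A] w *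
    `|V t w - V tau w - derive1 f (Z tau w) * (Z t w - Z tau w)|.
  by rewrite mulr_ge0// indicE.
have [tE|tne] := eqVneq t tau.
  apply: mean_leW (mean_le_mono P _ _ _ mF _ (mean_le0 P)) _.
    by move=> w; rewrite F0 /= tE !subrr mulr0 subrr normr0 mulr0.
  by rewrite mulr_ge0 ?powR_ge0// ltW.
set x := `|t - tau| in tt tq *.
have x0 : 0 < x by rewrite normr_gt0 subr_eq0.
pose q := x `^ (gamma / 2); have qgt0 : 0 < q by rewrite powR_gt0.
have qp : q ^+ 2 = x `^ gamma.
  by rewrite -powR_mulrn ?powR_ge0// -powRrM; congr (_ `^ _); field.
have qq : q <= e / (kap + 1).
  rewrite -(ler_pXn2r (_ : (0 < 2)%N)) ?nnegrE ?(ltW qgt0) ?(ltW q00)// qp.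
  by rewrite (le_trans (powR_le _ (ltW x0) (le_trans tt e01))).
have D2 := incr t tau tt tau_near tt; rewrite -/x -qp in D2.
have gD := gaussian_process_increment P Z hZ t tau (nonneg t tt) (nonneg tau tau_near).
have [_ [_ [mD _ _ D4 _]]] := HK4 _ gD.
have {}D4 : mean_le P (fun w => (Z t w - Z tau w) ^+ 4) (`|K4| * (kN * q ^+ 2) ^+ 2).
  apply: mean_leW D4 _; apply: (@le_trans _ _ (`|K4| * (\int[P]_w ((Z t w - Z tau w) ^+ 2)) ^+ 2)).
    by rewrite ler_wpM2r ?sqr_ge0// ler_norm.
  have D2' : mean_le P (fun w => `|(Z t w - Z tau w) ^+ 2|) (kN * q ^+ 2).
    by under eq_fun do rewrite ger0_norm ?sqr_ge0//.
  have I2 := mean_le_Rintegral P _ _ (measurable_funX 2 mD) D2'.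
  rewrite ler_wpM2l// -[leLHS]real_normK ?num_real//.
  by rewrite lerXn2r ?nnegrE//; apply: mulr_ge0 (ltW _); rewrite ?exprn_gt0.
have q20 : 0 < q ^+ 2 by rewrite exprn_gt0.
have iq : 0 <= (2 * q ^+ 2)^-1 by rewrite invr_ge0; apply: mulr_ge0 (ltW q20).
have B := mean_leD P _ _ _ _ (mean_leD P _ _ _ _ (mean_leZ P _ _ c c0 D2) (mean_leZ P _ _ _ iq D4))
  (mean_leZ P _ _ _ (ltW q20) (mean_leD P _ _ _ _ (V2 t tt) (V2 tau tau_near))).
apply: mean_leW (mean_le_ae P _ _ _ mF F0 _ B) _.
- apply: filterS VZ => w Hw; rewrite (Hw t tt) (Hw tau tau_near).
  move: (Z t w) (F0 w) => y _.
  have pos : 0 <= c * (y - Z tau w) ^+ 2 + (2 * q ^+ 2)^-1 * (y - Z tau w) ^+ 4 +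
      q ^+ 2 * (f y ^+ 2 + f (Z tau w) ^+ 2).
    apply: addr_ge0; last by apply: mulr_ge0 (ltW q20) _; apply: addr_ge0; exact: sqr_ge0.
    apply: addr_ge0; first exact: mulr_ge0 (sqr_ge0 _).
    by apply: mulr_ge0 => //; rewrite (exprM _ 2 2) sqr_ge0.
  rewrite indicE; have [|_] := boolP (w \in _); last by rewrite mul0r.
  rewrite inE mul1r /=; move: (Z tau w) pos => z pos zA.
  have E4 : 0 <= (2 * q ^+ 2)^-1 * (y - z) ^+ 4 by apply: mulr_ge0 => //; rewrite (exprM _ 2 2) sqr_ge0.
  have EV : 0 <= q ^+ 2 * (f y ^+ 2 + f z ^+ 2) by apply: mulr_ge0 (ltW q20) _; apply: addr_ge0; exact: sqr_ge0.
  have s2 := sqr_ge0 (y - z).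
  have cD : c * (y - z) ^+ 2 = c1 * (y - z) ^+ 2 + c2 * (y - z) ^+ 2 by rewrite mulrDl.
  have p1 : 0 <= c1 * (y - z) ^+ 2 by exact: mulr_ge0.
  have p2 : 0 <= c2 * (y - z) ^+ 2 by exact: mulr_ge0.
  have [yz|yz] := leP `|y - z| 1.
    by apply: (le_trans (Hc1 z y zA yz)); lra.
  have yz2 : `|y - z| <= (y - z) ^+ 2.
    by rewrite -[leRHS]real_normK ?num_real// expr2 ler_peMl// ltW.
  have yz1 : 1 <= (y - z) ^+ 2 by exact: le_trans (ltW yz) yz2.
  apply: (le_trans (ler_normB _ _)).
  have h1 : `|derive1 f z * (y - z)| <= c2 * (y - z) ^+ 2 by rewrite normrM ler_pM// Hc2.
  (* A factor (y - z)^2 >= 1 is inserted for free, and Young's inequality with weight q^2 then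
     separates it from f. *)
  have h2 : `|f y - f z| <= (2 * q ^+ 2)^-1 * (y - z) ^+ 4 + q ^+ 2 * (f y ^+ 2 + f z ^+ 2).
    apply: (@le_trans _ _ ((y - z) ^+ 2 * `|f y - f z|)); first by rewrite ler_peMl.
    have : 0 <= ((y - z) ^+ 2 - q ^+ 2 * `|f y - f z|) ^+ 2 / (2 * q ^+ 2).
      by apply: divr_ge0 (sqr_ge0 _) _; apply: mulr_ge0 (ltW q20).
    have -> : ((y - z) ^+ 2 - q ^+ 2 * `|f y - f z|) ^+ 2 / (2 * q ^+ 2) =
        (2 * q ^+ 2)^-1 * (y - z) ^+ 4 + q ^+ 2 * `|f y - f z| ^+ 2 / 2 - (y - z) ^+ 2 * `|f y - f z|.
      by field; rewrite gt_eqF.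
    rewrite real_normK ?num_real//.
    have : 0 <= q ^+ 2 * (f y + f z) ^+ 2 by exact: mulr_ge0 (ltW q20) (sqr_ge0 _).
    rewrite (_ : q ^+ 2 * (f y - f z) ^+ 2 = 2 * (q ^+ 2 * (f y ^+ 2 + f z ^+ 2)) - q ^+ 2 * (f y + f z) ^+ 2); last by ring.
    move: ((2 * q ^+ 2)^-1 * (y - z) ^+ 4) (q ^+ 2 * (f y ^+ 2 + f z ^+ 2))
      (q ^+ 2 * (f y + f z) ^+ 2) ((y - z) ^+ 2 * `|f y - f z|) => u1 u2 u3 u4; lra.
  by lra.
- rewrite -/q.
  have -> : c * (kN * q ^+ 2) + (2 * q ^+ 2)^-1 * (`|K4| * (kN * q ^+ 2) ^+ 2) + q ^+ 2 * (M + M) =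
      (kap * q) * q by rewrite /kap; field; rewrite gt_eqF.
  rewrite ler_wpM2r ?(ltW qgt0)//.
  apply: (@le_trans _ _ ((kap + 1) * (e / (kap + 1)))); last by rewrite mulrC divfK// gt_eqF.
  by apply: ler_pM => //; [exact: ltW|rewrite lerDl].
Qed.

End gaussian_volatility.

(** * Mixing of Gaussian grid sums with Z at [tau] *)

Lemma gaussian_cos {d} {Omega : measurableType d} {R : realType} (P : probability Omega R)
    (Y : Omega -> R) (c : R) : gaussian_variable P Y ->
  \int[P]_w cos (Y w + c) =
  expR (- (\int[P]_w (Y w ^+ 2) - (\int[P]_w Y w) ^+ 2) / 2) * cos (\int[P]_w Y w + c).
Proof.
move=> gY; have [k /(_ Y gY)[m [s [_ E1 E2 _ E3]]]] := gaussian_moments P.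
have := E3 1 c; rewrite !mul1r E2 E1 addrAC subrr add0r => <-.
by apply: eq_Rintegral => w _; rewrite mul1r.
Qed.

Section gaussian_trig.
Context {d} {Omega : measurableType d} {R : realType} (P : probability Omega R).
Notation mu := (@lebesgue_measure R).
Context (Z : R -> Omega -> R) (hZ : gaussian_process P Z).
Context (tau gamma kap v e0 k1 eta : R) (K : R -> R).
Hypotheses (g1 : 1 <= gamma) (g2 : gamma < 2) (e0tau : e0 <= tau) (tau0 : 0 <= tau).
Hypotheses (mK : measurable_fun setT K) (iK : mean_le mu (fun x => `|K x| * weight gamma x) kap).
Hypotheses (eta0 : 0 < eta) (k10 : 0 <= k1).
Hypothesis cov_tau : forall r : R, `|r| <= eta -> 0 <= tau + r ->
  `|\int[P]_w ((Z (tau + r) w - Z tau w) * Z tau w)| <= k1 * `|r|.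
Hypothesis mean_tau : forall r : R, `|r| <= eta -> 0 <= tau + r ->
  `|\int[P]_w Z (tau + r) w - \int[P]_w Z tau w| <= k1 * `|r|.

Let g0 : 0 < gamma. Proof. exact: lt_le_trans g1. Qed.

(** The expression is a constant times dl^(2 - gamma), with a positive exponent. *)
Lemma grid_bias_cvg (dl : nat -> R) : (forall n, 0 < dl n) -> dl @ \oo --> 0 ->
  k1 * ((dl n `^ gamma)^-1 * (dl n ^+ 2 * kap)) @[n --> \oo] --> 0.
Proof.
move=> dl0 dlc.
have g20 : 0 < 2 - gamma by rewrite subr_gt0.
have H : dl n `^ (2 - gamma) @[n --> \oo] --> 0.
  by have := (cvg_at_rightP (fun a => a `^ (2 - gamma)) 0 0).1 (powR_cvg0 g20) dl (conj dl0 dlc).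
have -> : (fun n => k1 * ((dl n `^ gamma)^-1 * (dl n ^+ 2 * kap))) =
    (fun n => k1 * kap * dl n `^ (2 - gamma)).
  apply/funext => n; rewrite (_ : dl n ^+ 2 = dl n `^ (2 - gamma) * dl n `^ gamma); last first.
    by rewrite -powRD ?subrK ?powR_mulrn ?(ltW (dl0 n))//; rewrite (gt_eqF (dl0 n)) implybT.
  by field; rewrite gt_eqF// powR_gt0.
by rewrite -[X in _ --> X](mulr0 (k1 * kap)); exact: cvgMr.
Qed.

(** The combination a Z_tau + b S is Gaussian, so the mean of its shifted cosine depends only on
    first and second moments. The mean of S and the mean of S Z_tau tend to 0 by the linear bounds
    at [tau] and [grid_weight_time_sum], so in the limit the variance splits and the factor exp(-b^2
    v / 2) comes out. *)
Lemma gaussian_trig (dl : nat -> R) (m : nat -> nat) (a b c : R) :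
  (forall n, 0 < dl n) -> (forall n, dl n <= e0) -> dl @ \oo --> 0 ->
  (forall n, (0 < m n)%N) -> (forall n, (dl n)^-1 / (m n)%:R <= 1) ->
  \int[P]_w (grid_sum tau gamma K Z (dl n) (m n) w ^+ 2) @[n --> \oo] --> v ->
  \int[P]_w cos (a * Z tau w + b * grid_sum tau gamma K Z (dl n) (m n) w + c) @[n --> \oo] -->
  \int[P]_w cos (a * Z tau w + c) * expR (- (b ^+ 2 * v) / 2).
Proof.
move=> dl0 dle0 dlc m0 mesh1 vc.
pose S n := grid_sum tau gamma K Z (dl n) (m n).
pose t n := grid_time tau (dl n) (m n).
pose wt n := grid_weight K gamma (dl n) (m n).
have tI n (i : 'I_(2 * m n)) : 0 <= t n i /\ `|t n i - tau| <= dl n.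
  have H : `|t n i - tau| <= dl n.
    exact: (grid_time_norm tau (dl n) (m n) (dl0 n) (m0 n) i (ltnW (ltn_ord i))).
  split=> //; move: H; rewrite ler_norml => /andP[h _].
  by have := dle0 n; move: h e0tau; lra.
have gtau := gaussian_process_at P Z hZ tau tau0.
have [mtau itau tau2] := gaussian_variable_facts P _ gtau.
have incr n (i : 'I_(2 * m n)) := gaussian_process_increment P Z hZ _ _ (tI n i).1 tau0.
pose A0 := \int[P]_w Z tau w; pose B0 := \int[P]_w (Z tau w ^+ 2).
pose ES n := \int[P]_w S n w; pose CS n := \int[P]_w (S n w * Z tau w).
have step n : [/\ P.-integrable setT (EFin \o S n),
    ES n = \sum_(i < 2 * m n) wt n i * (\int[P]_w Z (t n i) w - A0),
    P.-integrable setT (EFin \o (fun w => S n w * Z tau w)) &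
    CS n = \sum_(i < 2 * m n) wt n i * \int[P]_w ((Z (t n i) w - Z tau w) * Z tau w)].
  have i1 (i : 'I_(2 * m n)) : P.-integrable setT (EFin \o (fun w => wt n i * (Z (t n i) w - Z tau w))).
    have [_ h _] := gaussian_variable_facts P _ (incr n i).
    exact: (integrableZl measurableT (wt n i) h).
  have i2 (i : 'I_(2 * m n)) : P.-integrable setT (EFin \o (fun w => (Z (t n i) w - Z tau w) * Z tau w)).
    have [m1 _ h] := gaussian_variable_facts P _ (incr n i).
    exact: (integrable_mul P _ _ _ _ m1 mtau h tau2).
  have i3 (i : 'I_(2 * m n)) := integrableZl measurableT (wt n i) (i2 i).
  have [j1 E1] := Rintegral_sum P _ (index_enum 'I_(2 * m n)) _ i1.
  have [j3 E3] := Rintegral_sum P _ (index_enum 'I_(2 * m n)) _ i3.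
  have SZ w : S n w * Z tau w = \sum_(i < 2 * m n) wt n i * ((Z (t n i) w - Z tau w) * Z tau w).
    by rewrite /S /grid_sum mulr_suml; apply: eq_bigr => i _; rewrite mulrA.
  split.
  - exact: j1.
  - rewrite /ES /S /grid_sum E1; apply: eq_bigr => i _.
    have [_ h _] := gaussian_variable_facts P _ (incr n i).
    rewrite RintegralZl//; congr (_ * _); rewrite RintegralB//.
    by have [_ h' _] := gaussian_variable_facts P _ (gaussian_process_at P Z hZ _ (tI n i).1).
  - by apply: eq_integrable j3 => // w _; rewrite /= SZ.
  - rewrite /CS; under eq_Rintegral do rewrite SZ.
    rewrite E3; apply: eq_bigr => i _; rewrite RintegralZl//; exact: i2.
have near_eta : \forall n \near \oo, dl n <= eta.
  apply: filterS ((cvgr0Pnorm_lt dl).1 dlc eta eta0) => n.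
  by rewrite gtr0_norm// => /ltW.
have small (X : nat -> R) (x : forall n, 'I_(2 * m n) -> R) :
    (forall n, X n = \sum_(i < 2 * m n) wt n i * x n i) ->
    (forall n i, dl n <= eta -> `|x n i| <= k1 * `|t n i - tau|) -> X @ \oo --> 0.
  move=> XE Hx; apply: cvg0_norm_le (grid_bias_cvg dl dl0 dlc).
  apply: filterS near_eta => n dn; rewrite XE; apply: (le_trans (ler_norm_sum _ _ _)).
  have := grid_weight_time_sum tau K gamma kap g0 mK iK (dl n) (m n) (dl0 n) (m0 n) (mesh1 n) g1.
  move=> /(ler_wpM2l k10); apply: le_trans; rewrite mulr_sumr; apply: ler_sum => i _.
  by rewrite normrM mulrCA ler_wpM2l// Hx.
have ES0 : ES @ \oo --> 0.
  apply: (small ES (fun n i => \int[P]_w Z (t n i) w - A0)).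
    by move=> n; case: (step n).
  move=> n i dn; have := mean_tau (t n i - tau); rewrite [tau + _]addrC subrK; apply.
    exact: le_trans (tI n i).2 dn.
  exact: (tI n i).1.
have CS0 : CS @ \oo --> 0.
  apply: (small CS (fun n i => \int[P]_w ((Z (t n i) w - Z tau w) * Z tau w))).
    by move=> n; case: (step n).
  move=> n i dn; have := cov_tau (t n i - tau); rewrite [tau + _]addrC subrK; apply.
    exact: le_trans (tI n i).2 dn.
  exact: (tI n i).1.
(* The last of 2 m + 1 times is [tau]; its coefficient gathers a' and all the terms subtracted in
   the increments. *)
have gY (a' b' : R) n : gaussian_variable P (fun w => a' * Z tau w + b' * S n w).
  pose u (i : 'I_(2 * m n).+1) := if (i < 2 * m n)%N then t n i else tau.
  pose al (i : 'I_(2 * m n).+1) := if (i < 2 * m n)%N then b' * wt n i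
    else a' - b' * \sum_(i < 2 * m n) wt n i.
  have u0 i : 0 <= u i.
    by rewrite /u; case: ifP => // h; exact: (tI n (Ordinal h)).1.
  have := hZ _ u al u0.
  have E w : \sum_(i < (2 * m n).+1) al i * Z (u i) w = a' * Z tau w + b' * S n w.
    rewrite big_ord_recr /= /al /u /= ltnn.
    under eq_bigr do rewrite ltn_ord.
    rewrite (_ : \sum_(i < 2 * m n) _ = b' * S n w + b' * (\sum_(i < 2 * m n) wt n i) * Z tau w); first by ring.
    rewrite /S /grid_sum !mulr_sumr mulr_suml -big_split; apply: eq_bigr => i _ /=.
    by rewrite /wt /t; ring.
  by under eq_fun do rewrite E.
have S2 n : P.-integrable setT (EFin \o (fun w => S n w ^+ 2)).
  have [_ _ h] := gaussian_variable_facts P _ (gY 0 1 n).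
  have := mean_le_integrable_ge0 P _ _ h.
  by apply: eq_integrable => // w _; rewrite /= mul0r add0r mul1r.
have itau2 := mean_le_integrable_ge0 P _ _ tau2.
have E1 n : \int[P]_w (a * Z tau w + b * S n w) = a * A0 + b * ES n.
  have [iS _ _ _] := step n.
  have j1 := integrableZl measurableT a itau; have j2 := integrableZl measurableT b iS.
  by rewrite RintegralD// !RintegralZl.
have E2 n : \int[P]_w ((a * Z tau w + b * S n w) ^+ 2) =
    a ^+ 2 * B0 + (2 * a * b) * CS n + b ^+ 2 * \int[P]_w (S n w ^+ 2).
  have [_ _ iC _] := step n.
  have E w : (a * Z tau w + b * S n w) ^+ 2 =
      a ^+ 2 * Z tau w ^+ 2 + (2 * a * b) * (S n w * Z tau w) + b ^+ 2 * S n w ^+ 2 by ring.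
  under eq_Rintegral do rewrite E.
  have j1 := integrableZl measurableT (a ^+ 2) itau2.
  have j2 := integrableZl measurableT (2 * a * b) iC.
  have j3 := integrableZl measurableT (b ^+ 2) (S2 n).
  have j12 := integrableD measurableT j1 j2.
  by rewrite RintegralD// RintegralD// !RintegralZl.
have -> : (fun n => \int[P]_w cos (a * Z tau w + b * grid_sum tau gamma K Z (dl n) (m n) w + c)) =
    (fun n => expR (- (a ^+ 2 * B0 + (2 * a * b) * CS n + b ^+ 2 * \int[P]_w (S n w ^+ 2)
      - (a * A0 + b * ES n) ^+ 2) / 2) * cos (a * A0 + b * ES n + c)).
  by apply/funext => n; rewrite (gaussian_cos P _ c (gY a b n)) E1 E2.
have lm : a * A0 + b * ES n @[n --> \oo] --> a * A0.
  rewrite -[X in _ --> X]addr0 -[X in _ --> _ + X](mulr0 b); apply: cvgD; first exact: cvg_cst.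
  exact: cvgMr.
have -> : \int[P]_w cos (a * Z tau w + c) * expR (- (b ^+ 2 * v) / 2) =
    expR (- (a ^+ 2 * B0 + b ^+ 2 * v - (a * A0) ^+ 2) / 2) * cos (a * A0 + c).
  have gZ : gaussian_variable P (fun w => a * Z tau w).
    have := hZ 1%N (fun=> tau) (fun=> a) (fun=> tau0).
    by under eq_fun do rewrite big_ord1.
  rewrite (gaussian_cos P _ c gZ) RintegralZl// -/A0.
  have -> : \int[P]_w ((a * Z tau w) ^+ 2) = a ^+ 2 * B0.
    by under eq_Rintegral do rewrite exprMn; rewrite RintegralZl.
  by rewrite mulrAC -expRD; congr (expR _ * _); field.
have lq : - (a ^+ 2 * B0 + (2 * a * b) * CS n + b ^+ 2 * \int[P]_w (S n w ^+ 2)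
    - (a * A0 + b * ES n) ^+ 2) / 2 @[n --> \oo] --> - (a ^+ 2 * B0 + b ^+ 2 * v - (a * A0) ^+ 2) / 2.
  apply: cvgMl; apply: cvgN; apply: cvgB.
    apply: cvgD; last exact: cvgMr.
    rewrite -[X in _ --> X]addr0 -[X in _ --> _ + X](mulr0 (2 * a * b)); apply: cvgD; first exact: cvg_cst.
    exact: cvgMr.
  by under eq_fun do rewrite expr2; rewrite expr2; exact: cvgM.
have lmc : a * A0 + b * ES n + c @[n --> \oo] --> a * A0 + c.
  by apply: cvgD => //; exact: cvg_cst.
have H1 := @continuous_expR R (- (a ^+ 2 * B0 + b ^+ 2 * v - (a * A0) ^+ 2) / 2).
have H2 := @continuous_cos R (a * A0 + c).
have le : expR (- (a ^+ 2 * B0 + (2 * a * b) * CS n + b ^+ 2 * \int[P]_w (S n w ^+ 2)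
    - (a * A0 + b * ES n) ^+ 2) / 2) @[n --> \oo] -->
    expR (- (a ^+ 2 * B0 + b ^+ 2 * v - (a * A0) ^+ 2) / 2) := cvg_comp _ _ lq H1.
have lc : cos (a * A0 + b * ES n + c) @[n --> \oo] --> cos (a * A0 + c) := cvg_comp _ _ lmc H2.
exact: (cvgM le lc).
Qed.

End gaussian_trig.

(** * The Gaussian case *)

Lemma bigO_linear_bound {R : realType} (h : R -> R) :
  h =O_ (nbhs (0 : R)) (fun r : R => `|r|) ->
  exists k eta, [/\ 0 <= k, 0 < eta & forall r : R, `|r| <= eta -> `|h r| <= k * `|r|].
Proof.
move=> /eqO_exP[k k0 /nbhs_ballP[eta /= eta0 H]].
exists k, (eta / 2); split; [exact: ltW|by rewrite divr_gt0|] => r re.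
have := H r; rewrite /ball/= sub0r normrN normr_id; apply.
by rewrite (le_lt_trans re)// gtr_pMr// invf_lt1 ?ltr1n.
Qed.

Section gaussian_case.
Context {d} {Omega : measurableType d} {R : realType} (P : probability Omega R).
Context (T tau : R) (htau : 0 < tau < T) (mu sigma : R -> Omega -> R).
Hypotheses (jmu : jointly_measurable T mu) (jsigma : jointly_measurable T sigma).
Hypothesis hmoment : moment_bound P T mu sigma.
Context (gamma : R) (K : R -> R) (C : R -> R -> R) (hK : admissible_kernel gamma C K).
Context (f : R -> R) (Z : R -> Omega -> R) (LZ : R -> R) (CZ : R -> R -> R).
Hypotheses (df : forall x, derivable f x 1) (df1 : forall x, derivable (derive1 f) x 1).
Hypothesis cf2 : continuous (derive1 (derive1 f)).
Hypothesis hZ : gaussian_process P Z.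
Hypothesis hVZ : {ae P, forall w, forall t, 0 <= t <= T -> sigma t w ^+ 2 = f (Z t w)}.
Hypothesis hgamma : 1 <= gamma < 2.
Hypothesis hU : scaling_condition_uniform P T Z gamma LZ CZ.
Hypothesis hcov : (fun r : R => fine 'E_P[fun w => ((Z (tau + r) w - Z tau w) * Z tau w)%R])
       =O_ (nbhs (0 : R)) (fun r : R => `|r|).
Hypothesis hmean : (fun r : R => fine 'E_P[Z (tau + r)] - fine 'E_P[Z tau])
       =O_ (nbhs (0 : R)) (fun r : R => `|r|).

Lemma gaussian_case :
  cvg_in_distribution (P \x (normal_prob 0 1 : probability (measurableTypeR R) R))%E
    (fun h p => h `^ (- (gamma / 2)) * kernel_error K T tau (fun t w => sigma t w ^+ 2) h p.1)
    (fun p => Num.sqrt (derive1 f (Z tau p.1) ^+ 2 * LZ tau * kernel_form K CZ) * p.2).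
Proof.
have [m0 [m00 m01 m0tau m0T]] := margin tau T htau.
have /andP[tau0 tauT] := htau; have tauI : 0 <= tau <= T by rewrite !ltW.
have /andP[g1 g2] := hgamma; have g0 : 0 < gamma by exact: lt_le_trans g1.
have [eta [kN [eta0 eta1 kN0 Hincr]]] := uniform_increment_sqr P Z hZ T gamma LZ CZ g0 hU.
(* Half the margin keeps the window inside the open interval ]0, T[, where the uniform scaling
   condition is available. *)
pose e0 := Num.min (m0 / 2) eta.
have m20 : 0 < m0 / 2 by rewrite divr_gt0.
have m2m : m0 / 2 < m0 by rewrite gtr_pMr// invf_lt1 ?ltr1n.
have e00 : 0 < e0 by rewrite lt_min m20.
have e0m : e0 < m0 by rewrite gt_min m2m.
have e0eta : e0 <= eta by rewrite ge_min lexx orbT.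
clearbody e0.
have e01 : e0 <= 1 by rewrite (le_trans (ltW e0m)).
have e0tau : e0 <= tau by rewrite (le_trans (ltW e0m)).
have e0T : tau + e0 <= T by rewrite (le_trans _ m0T)// lerD2l ltW.
have near_lt t : `|t - tau| <= e0 -> 0 < t < T.
  by rewrite ler_norml => /andP[h1 h2]; apply/andP; split; move: h1 h2 e0m m0tau m0T; lra.
have near_itv t : `|t - tau| <= e0 -> 0 <= t <= T.
  by move=> /near_lt/andP[h1 h2]; rewrite !ltW.
have nonneg t : `|t - tau| <= e0 -> 0 <= t by move=> /near_itv/andP[].
have jV := jointly_measurable_sqr T sigma jsigma.
have [M [M0 HM]] := volatility_moment P T mu sigma jsigma jmu hmoment.
have mV t (tt : `|t - tau| <= e0) := measurable_path T _ jV t (near_itv t tt).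
have V2 t : `|t - tau| <= e0 -> mean_le P (fun w => (sigma t w ^+ 2) ^+ 2) M.
  by move=> /near_itv tT; under eq_fun do rewrite -exprM; exact: HM.
have VZ : {ae P, forall w t, `|t - tau| <= e0 -> sigma t w ^+ 2 = f (Z t w)}.
  by apply: filterS hVZ => w H t /near_itv; exact: H.
have incr s t : `|s - tau| <= e0 -> `|t - tau| <= e0 -> `|s - t| <= e0 ->
    mean_le P (fun w => (Z s w - Z t w) ^+ 2) (kN * `|s - t| `^ gamma).
  by move=> hs ht st; apply: Hincr; [exact: near_lt|exact: nonneg|exact: le_trans st e0eta].
have tau_near : `|tau - tau| <= e0 by rewrite subrr normr0 ltW.
have mZ t (tt : `|t - tau| <= e0) := measurable_gaussian_process P Z hZ t (nonneg t tt).
have mK := measurable_kernel _ _ _ hK.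
have [kap iK] := kernel_weight_mean _ _ _ hK.
have [B0 V_bound] := squared_volatility_bound P T mu sigma jsigma jmu hmoment tau tauI.
have ck : continuous (derive1 f) by exact: (derivable_continuous _ df1).
have N_bound t : `|t - tau| <= e0 ->
    mean_le P (fun w => (Z t w - Z tau w) ^+ 2) (kN * `|t - tau| `^ gamma).
  by move=> tt; exact: (incr t tau tt tau_near tt).
have V_cont := gaussian_mean_continuous P Z _ hZ tau gamma kN M e0 f df df1 g1 e00 e01 M0 kN0 nonneg mV V2 VZ incr.
have N_cont := increment_sqr_small P Z tau gamma kN e0 g1 e00 e01 kN0 incr.
have N_cov e : 0 < e -> exists2 eta, 0 < eta & forall r s : R, `|r| <= eta -> `|s| <= eta ->
    `|\int[P]_w ((Z (tau + r) w - Z tau w) * (Z (tau + s) w - Z tau w)) - LZ tau * CZ r s| <=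
    e * (r ^+ 2 + s ^+ 2) `^ (gamma / 2).
  move=> ee0; have [et et0 H] := uniform_scaling P Z hZ T gamma LZ CZ g0 hU e ee0.
  exists (Num.min et e0); first by rewrite lt_min et0.
  have tr (x : R) : `|x| <= e0 -> 0 <= tau + x.
    by rewrite ler_norml => /andP[h1 h2]; move: h1 h2 e0tau; lra.
  move=> r s; rewrite !le_min => /andP[r1 r2] /andP[s1 s2].
  exact: (H tau r s htau (tr r r2) (tr s s2) r1 s1).
have C_hom a r s : 0 < a -> CZ (a * r) (a * s) = a `^ gamma * CZ r s.
  by case: hU => -[_ _ _ H] _ _; exact: H.
have V_approx := gaussian_first_order P Z _ hZ tau gamma kN M e0 f df df1 cf2 g1 e00 e01 M0 kN0 nonneg mV V2 VZ incr.
have [k1 [et1 [k10 et10 Hcov]]] := bigO_linear_bound _ hcov.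
have [k2 [et2 [k20 et20 Hmean]]] := bigO_linear_bound _ hmean.
have et0 : 0 < Num.min et1 et2 by rewrite lt_min et10.
have k0 : 0 <= k1 + k2 by exact: addr_ge0.
have cov_tau (r : R) : `|r| <= Num.min et1 et2 -> 0 <= tau + r ->
    `|\int[P]_w ((Z (tau + r) w - Z tau w) * Z tau w)| <= (k1 + k2) * `|r|.
  rewrite le_min => /andP[r1 _] _; have := Hcov r r1; rewrite unlock => /le_trans; apply.
  by rewrite ler_wpM2r// lerDl.
have mean_tau (r : R) : `|r| <= Num.min et1 et2 -> 0 <= tau + r ->
    `|\int[P]_w Z (tau + r) w - \int[P]_w Z tau w| <= (k1 + k2) * `|r|.
  rewrite le_min => /andP[_ r2] _; have := Hmean r r2; rewrite unlock => /le_trans; apply.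
  by rewrite ler_wpM2r// lerDr.
(* The abstract theorem is used with driving process [Z], conditioning variable [Z tau] and factor
   f'. *)
have trig := gaussian_trig P Z hZ tau gamma kap (LZ tau * kernel_form K CZ) e0 (k1 + k2) _ K
  g1 g2 e0tau (ltW tau0) mK iK et0 k0 cov_tau mean_tau.
have := mixed_normal_cvg P T tau gamma kap B0 kN e0 (LZ tau) K (derive1 f) CZ _ Z (Z tau) htau jV g0 mK iK V_bound
  e00 e01 e0tau e0T (mZ tau tau_near) ck mZ N_bound V_cont N_cont N_cov C_hom V_approx trig.
have -> : (fun p : Omega * measurableTypeR R =>
    Num.sqrt (derive1 f (Z tau p.1) ^+ 2 * (LZ tau * kernel_form K CZ)) * p.2) =
  (fun p => Num.sqrt (derive1 f (Z tau p.1) ^+ 2 * LZ tau * kernel_form K CZ) * p.2).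
  by apply/funext => p; rewrite mulrA.
exact.
Qed.

End gaussian_case.

(** * Both cases on the product extension *)

Theorem theorem6p2 (R : realType) (d : measure_display)
  (Omega : measurableType d) (P : probability Omega R)
  (F : R -> set_system Omega) (hF : complete_filtration P F)
  (B : R -> Omega -> R) (hB : brownian_motion P F B)
  (T tau : R) (htau : 0 < tau < T)
  (X mu sigma : R -> Omega -> R)
  (hmu : adapted F mu) (hsigma : adapted F sigma)
  (hmu_meas : jointly_measurable T mu)
  (hsigma_meas : jointly_measurable T sigma)
  (hX : ito_process P F B T X mu sigma)
  (hleverage : independent P (sigma_process2 mu sigma) (sigma_process B))
  (hmoment : moment_bound P T mu sigma)
  (gamma : R) (L : R -> R) (C : R -> R -> R)
  (hscaling : scaling_condition P T (fun t w => sigma t w ^+ 2) gamma L C)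
  (K : R -> R) (hK : admissible_kernel gamma C K) :
  (forall W f g : R -> Omega -> R,
     brownian_motion P F W ->
     progressively_measurable F f -> progressively_measurable F g ->
     ito_process P F W T (fun t w => sigma t w ^+ 2) f g ->
     (ereal_sup [set 'E_P[fun w => `|f t w|%R] | t in `[0%R, T]] < +oo)%E ->
     (ereal_sup [set 'E_P[fun w => (g t w ^+ 2)%R] | t in `[0%R, T]] < +oo)%E ->
     'E_P[fun w => ((g (tau + h) w - g tau w) ^+ 2)%R]%E @[h --> 0] --> 0%E ->
     gamma = 1 -> (forall x y, C x y = brownian_C x y) ->
     exists (d' : measure_display) (Omega' : measurableType d')
       (P' : probability Omega' R) (proj : Omega' -> Omega) (xi : Omega' -> R),
       [/\ extension_of P P' proj,
           has_law P' xi (normal_prob 0 1),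
           independent P' (sigma_var xi) (sigma_var (g tau \o proj)) &
           cvg_in_distribution P'
             (fun h w => h `^ (- (gamma / 2)) *
                kernel_error K T tau (fun t w => sigma t w ^+ 2) h (proj w))
             (fun w => Num.sqrt (g tau (proj w) ^+ 2 *
                kernel_form K (@brownian_C R)) * xi w)])
  /\
  (forall (f : R -> R) (Z : R -> Omega -> R) (LZ : R -> R) (CZ : R -> R -> R),
     (forall x, derivable f x 1) -> (forall x, derivable (derive1 f) x 1) ->
     continuous (derive1 (derive1 f)) ->
     gaussian_process P Z ->
     {ae P, forall w, forall t, 0 <= t <= T -> sigma t w ^+ 2 = f (Z t w)} ->
     1 <= gamma < 2 ->
     scaling_condition_uniform P T Z gamma LZ CZ ->
     (fun r : R => fine 'E_P[fun w => ((Z (tau + r) w - Z tau w) * Z tau w)%R])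
       =O_ (nbhs (0 : R)) (fun r : R => `|r|) ->
     (fun r : R => fine 'E_P[Z (tau + r)] - fine 'E_P[Z tau])
       =O_ (nbhs (0 : R)) (fun r : R => `|r|) ->
     ('E_P[fun w => (derive1 f (Z tau w) ^+ 4)%R] < +oo)%E ->
     (exists eps : R, 0 < eps /\
        (\int[P]_w ereal_sup
           [set (derive1 (derive1 f) (Z t w) ^+ 4)%R%:E |
              t in `](tau - eps)%R, (tau + eps)%R[] < +oo)%E) ->
     exists (d' : measure_display) (Omega' : measurableType d')
       (P' : probability Omega' R) (proj : Omega' -> Omega) (xi : Omega' -> R),
       [/\ extension_of P P' proj,
           has_law P' xi (normal_prob 0 1),
           independent P' (sigma_var xi)
             (sigma_process (fun t => Z t \o proj)) &
           cvg_in_distribution P'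
             (fun h w => h `^ (- (gamma / 2)) *
                kernel_error K T tau (fun t w => sigma t w ^+ 2) h (proj w))
             (fun w => Num.sqrt (derive1 f (Z tau (proj w)) ^+ 2 * LZ tau *
                kernel_form K CZ) * xi w)]).
Proof.
have /andP[tau0 tauT] := htau.
split.
- move=> W f g hW pf pg hV supf supg g_cont g1 CE; subst gamma.
  (* The extension is the product with a standard normal law, projected on the first coordinate; the
     second coordinate is xi, independent of whatever is pulled back from the first. *)
  exists _, _, (P \x (normal_prob 0 1 : probability (measurableTypeR R) R))%E, fst, snd; split.
  + exact: normal_extension.
  + exact: normal_extension_law.
  + apply: normal_extension_independent; apply: sigma_var_fst.
    apply: (known_measurable P F hF tau _ (ltW tau0)).
    exact: (progressive_known P F hF g pg tau (ltW tau0)).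
  + exact: (ito_case P F W hF hW T tau htau mu sigma hmu_meas hsigma_meas hmoment K C hK CE
      f g pf pg hV supf supg g_cont).
- move=> f Z LZ CZ df df1 cf2 hZ hVZ hgamma hU hcov hmean _ _.
  exists _, _, (P \x (normal_prob 0 1 : probability (measurableTypeR R) R))%E, fst, snd; split.
  + exact: normal_extension.
  + exact: normal_extension_law.
  + apply: normal_extension_independent; apply: sigma_process_fst => t t0.
    exact: (measurable_gaussian_process P Z hZ t t0).
  + exact: (gaussian_case P T tau htau mu sigma hmu_meas hsigma_meas hmoment gamma K C hK
      f Z LZ CZ df df1 cf2 hZ hVZ hgamma hU hcov hmean).
Qed.
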